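(* Let $0<\omega_1<\omega_2$, $\alpha>0$, $n_c\in\mathbb{N}$ positive, and let $g_1$, $g_2$ be the convolution kernels (see context) for which $(F^*F+\alpha I)^{-1}$ acts as $O\mapsto (g_2I_2)*g_1*O$, where $F$ is the linearized forward operator. There exist convolution kernels $G_{jj'}^{\omega_i},G_{2,\alpha}\in\mathbb{R}^{2n_c\times 2n_c}$ ($j,j',i=1,2$) such that the convolutional neural network with scaled residual layers $\psi=\psi_2\circ\psi_1$ given, for an input $O_I\in\mathbb{R}^{2n_c\times n_c}$, by $$\psi_1(O_I)=\sum_{i=1}^2 \big(P_u^TG_{22}^{\omega_i}*P_u +P_l^TG_{11}^{\omega_i}*P_l-P_u^TG_{12}^{\omega_i}*P_l - P_l^TG_{12}^{\omega_i}*P_u\big)O_I+\alpha O_I=:\tilde{O}_I,$$ $$\psi_2(\tilde{O}_I)=\alpha^{-2}\tilde{O}_I -\big(P_u^T G_{2,\alpha}*P_u +P_l^T G_{2,\alpha}*P_l \big)\tilde{O}_I,$$ with $P_u=[I_{n_c}\;O_{n_c\times n_c}]$ and $P_l=[O_{n_c\times n_c}\;I_{n_c}]$, satisfies $$|\Psi_2-\psi_2\circ \psi_1(O_I)|_{\infty}\leq c_{{\bf cnn}}\,|O_{I}|_{\infty}\,\alpha^{-2}n_c^{-1},\qquad c_{{\bf cnn}}=2^7\sqrt{2}\, \pi\omega_{2}( |c_{\omega_{1}}|^2+ |c_{\omega_{2}}|^2)(\pi+2^3\omega_2^2),$$ where $\Psi_2$ is the discretization of $(g_2I_2)*g_1*O_I$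 on $[-1,1]^2$ described in the context and $|\cdot|_\infty$ is the maximum magnitude of the entries.
   Context: $\mathbb{S}$ is the unit circle in $\mathbb{R}^2$ and $c_\omega=\frac{e^{i\pi/4}\omega^2}{\sqrt{8\pi\omega}}$. The linearized forward operator is $F=\begin{bmatrix} F_1^{\omega_1} & F_2^{\omega_1} \\ F_1^{\omega_2} & F_2^{\omega_2} \end{bmatrix}$ with $[F_1^\omega\gamma](\hat x,\zeta)=-c_\omega\int(\hat x\cdot\zeta)e^{i\omega(\zeta-\hat x)\cdot y}\gamma(y)dy$, $[F_2^\omega\eta](\hat x,\zeta)=c_\omega\int e^{i\omega(\zeta-\hat x)\cdot y}\eta(y)dy$, $\hat x,\zeta\in\mathbb{S}$. Filters: $g_{jj'}^\omega(y)=(-1)^{j+j'}|c_\omega|^2\int_{\mathbb{S}\times\mathbb{S}}(\hat x\cdot\zeta)^{4-j-j'}\cos(\omega(\hat x-\zeta)\cdot y)\,d\hat x\,d\zeta$ for $j,j'=1,2$ (so $g_{21}^\omega=g_{12}^\omega$). Let $\mathcal{F}$ be the (distributional) Fourier transform on $\mathbb{R}^2$, $[\mathcal{F}f](\xi)=\int f(y)e^{-i\xi\cdot y}dy$, applied entrywise to matrices, $\delta$ the Dirac delta, $I_2$ the $2\times2$ identity, and $${\bf g}=\sum_{i=1}^2\begin{bmatrix} g_{11}^{\omega_i}+\frac\alpha2\delta & g_{12}^{\omega_i} \\ g_{21}^{\omega_i} & g_{22}^{\omega_i}+\frac\alpha2\delta \end{bmatrix},\qquad g_1=\sum_{i=1}^2\begin{bmatrix}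 g_{22}^{\omega_i}+\frac\alpha2\delta & -g_{12}^{\omega_i} \\ -g_{21}^{\omega_i} & g_{11}^{\omega_i}+\frac\alpha2\delta \end{bmatrix},\qquad g_2=\mathcal{F}^{-1}\big(\det(\mathcal{F}({\bf g}))^{-1}\big).$$ The $\mathcal{F}(g^{\omega}_{jj'})$ are functions (defined a.e.), and $g_2=\alpha^{-2}\delta-g_{2,\alpha}$ with $g_{2,\alpha}$ a bounded continuous real function. Discretization: $[-1,1]^2$ is the domain of the input, the intermediate output and the final output, with grid $x_{ij}=(\frac{2i-1}{n_c}-1,\frac{2j-1}{n_c}-1)$, $1\le i,j\le n_c$. A matrix $O_I=\begin{bmatrix} O_{I1} \\ O_{I2} \end{bmatrix}\in\mathbb{R}^{2n_c\times n_c}$ with $O_{I1},O_{I2}\in\mathbb{R}^{n_c\times n_c}$ is identified with the piecewise constant $\mathbb{R}^2$-valued function on $[-1,1]^2$ which on the grid cell (side $2/n_c$) centred at $x_{ij}$ equals $(O_{I1}[i,j],O_{I2}[i,j])^T$. Continuous convolutions are taken over $[-1,1]^2$: $[g*f](x)=\int_{[-1,1]^2}g(x-y)f(y)\,dy$ for $x\in[-1,1]^2$ (with $\delta*f=f$, and matrix kernels acting by matrix multiplication), and $(g_2I_2)*g_1*O_I$ means $(g_2I_2)*(g_1*O_I)$. $\Psi_2\in\mathbb{R}^{2n_c\times n_c}$ has as upper and lower $n_c\times n_c$ blocks the values of the first and second components of $(g_2I_2)*g_1*O_I$ at the points $x_{mn}$. The discrete convolution of $G\in\mathbb{R}^{2n_c\times2n_c}$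 (entries indexed by $\{-n_c,\dots,n_c-1\}^2$, corresponding to a uniform grid on $[-2,2]^2$) with $O\in\mathbb{R}^{n_c\times n_c}$ is $(G*O)[m,n]=\frac{4}{n_c^2}\sum_{i,j=1}^{n_c}G[m-i,n-j]O[i,j]$, and $(P^TG*P')O_I$ means $P^T\big(G*(P'O_I)\big)$. *)

(* Defs.v *)
From HB Require Import structures.
From mathcomp Require Import all_boot all_order all_algebra complex.
From mathcomp Require Import all_classical all_reals all_analysis.

Set Implicit Arguments.
Unset Strict Implicit.
Unset Printing Implicit Defensive.

Import Order.TTheory GRing.Theory Num.Theory.
Import numFieldNormedType.Exports.

Local Open Scope classical_set_scope.
Local Open Scope ring_scope.
Local Open Scope complex_scope.

(* Indices j, j', i in {1, 2} of the mathematics are elements 0, 1 of 'I_2, and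
   grid indices in {1, ..., n_c} are elements of 'I_n: all are shifted by one. *)

Notation leb2 R := (@lebesgue_measure R \x @lebesgue_measure R)%E.

Definition dot (R : realType) (x y : R * R) : R := x.1 * y.1 + x.2 * y.2.

Definition scale2 (R : realType) (a : R) (x : R * R) : R * R :=
  (a * x.1, a * x.2).

Definition expi (R : realType) (t : R) : R[i] := cos t +i* sin t.

Definition c_ (R : realType) (w : R) : R[i] :=
  expi (pi / 4) * (w ^+ 2 / Num.sqrt (8 * pi * w))%:C.

Definition norm_c (R : realType) (w : R) : R := Normc.normc (c_ w).

Definition circle_pt (R : realType) (t : R) : R * R := (cos t, sin t).

(* Arc length on the unit circle, through the parametrization by the angle. *)
Definition int_circle2 (R : realType) (f : R * R -> R * R -> R) : R :=
  \int[leb2 R]_(t in `[0, 2 * pi] `*` `[0, 2 * pi])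
     f (circle_pt t.1) (circle_pt t.2).

Definition gfilter (R : realType) (w : R) (j j' : 'I_2) (y : R * R) : R :=
  (-1) ^+ (j.+1 + j'.+1) * norm_c w ^+ 2 *
  int_circle2 (fun x z =>
    dot x z ^+ (4 - j.+1 - j'.+1) * cos (dot (scale2 w (x - z)) y)).

(* The pair (a, k) is the convolution kernel "a delta + k": a multiple of the
   Dirac mass plus a function.  Sums, opposites and scalar matrices of kernels
   are those of the product and function structures. *)
Definition dirac_kernel (R : realType) (a : R) : R * (R * R -> R) := (a, 0).
Definition fun_kernel (R : realType) (k : R * R -> R) : R * (R * R -> R) :=
  (0, k).

Definition io_domain (R : realType) : set (R * R) := `[-1, 1] `*` `[-1, 1].
Arguments io_domain R : clear implicits.

Definition conv (R : realType) (k : R * (R * R -> R)) (f : R * R -> R)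
    (x : R * R) : R :=
  k.1 * f x + \int[leb2 R]_(y in io_domain R) (k.2 (x - y) * f y).

Definition mxconv (R : realType) (K : 'M[(R * (R * R -> R))%type]_2)
    (f : R * R -> 'cV[R]_2) (x : R * R) : 'cV[R]_2 :=
  \col_j \sum_(k < 2) conv (K j k) (fun y => f y k 0) x.

Definition mx22 (T : Type) (a b c d : T) : 'M[T]_2 :=
  \matrix_(j, k) if j == 0 then (if k == 0 then a else b)
                 else (if k == 0 then c else d).

Definition gbold (R : realType) (alpha : R) (w : 'I_2 -> R) :
    'M[(R * (R * R -> R))%type]_2 :=
  \sum_(i < 2)
    let g j j' := fun_kernel (gfilter (w i) j j') in
    let d := dirac_kernel (alpha / 2) in
    mx22 (g 0 0 + d) (g 0 1)
         (g 1 0)     (g 1 1 + d).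

Definition g1 (R : realType) (alpha : R) (w : 'I_2 -> R) :
    'M[(R * (R * R -> R))%type]_2 :=
  \sum_(i < 2)
    let g j j' := fun_kernel (gfilter (w i) j j') in
    let d := dirac_kernel (alpha / 2) in
    mx22 (g 1 1 + d) (- g 0 1)
         (- g 1 0)   (g 0 0 + d).

(* Distributions are functionals that are only ever evaluated at, and compared
   on, Schwartz functions. *)

Definition axis (R : realType) (b : bool) : R * R :=
  if b then (0, 1) else (1, 0).

(* Iterated partial derivative; the word v lists the coordinates. *)
Definition partials (R : realType) (f : R * R -> R) (v : seq bool) :
    R * R -> R :=
  foldr (fun b g x => 'D_(axis R b) g x) f v.

Definition schwartz_real (R : realType) (f : R * R -> R) : Prop :=
  forall v : seq bool,
    [/\ continuous (partials f v),
        (forall b x, derivable (partials f v) x (axis R b))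
      & (forall p q : nat, exists M : R, forall x : R * R,
           `|x.1 ^+ p * x.2 ^+ q * partials f v x| <= M)].

Definition schwartz (R : realType) (f : R * R -> R[i]) : Prop :=
  schwartz_real (fun x => complex.Re (f x)) /\
  schwartz_real (fun x => complex.Im (f x)).

Definition cintegrable (R : realType) (f : R * R -> R[i]) : Prop :=
  (leb2 R).-integrable setT (fun x => (complex.Re (f x))%:E) /\
  (leb2 R).-integrable setT (fun x => (complex.Im (f x))%:E).

Definition cint (R : realType) (f : R * R -> R[i]) : R[i] :=
  (\int[leb2 R]_x complex.Re (f x)) +i* (\int[leb2 R]_x complex.Im (f x)).

Definition fourier_fun (R : realType) (f : R * R -> R[i]) (xi : R * R) :
    R[i] :=
  cint (fun y => f y * expi (- dot xi y)).

Definition inv_fourier_fun (R : realType) (f : R * R -> R[i]) (y : R * R) :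
    R[i] :=
  ((2 * pi) ^- 2)%:C * cint (fun xi => f xi * expi (dot xi y)).

Definition distribution (R : realType) := (R * R -> R[i]) -> R[i].

Definition dist_eq (R : realType) (S T : distribution R) : Prop :=
  forall phi, schwartz phi -> S phi = T phi.

Definition fourier (R : realType) (T : distribution R) : distribution R :=
  fun phi => T (fourier_fun phi).

Definition inv_fourier (R : realType) (T : distribution R) : distribution R :=
  fun phi => T (inv_fourier_fun phi).

Definition fun_dist (R : realType) (h : R * R -> R[i]) : distribution R :=
  fun phi => cint (fun x => h x * phi x).

Definition kernel_dist (R : realType) (k : R * (R * R -> R)) :
    distribution R :=
  fun phi => (k.1)%:C * phi (0, 0) + fun_dist (fun x => (k.2 x)%:C) phi.

(* The distribution T is the function h, defined almost everywhere. *)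
Definition dist_is_fun (R : realType) (T : distribution R)
    (h : R * R -> R[i]) : Prop :=
  (forall phi, schwartz phi -> cintegrable (fun x => h x * phi x)) /\
  dist_eq T (fun_dist h).

Definition g2 (R : realType) (alpha : R) (g2a : R * R -> R) :
    R * (R * R -> R) :=
  dirac_kernel (alpha ^- 2) - fun_kernel g2a.

(* g2a is the bounded continuous g_{2,alpha} for which alpha^-2 delta - g2a is
   the inverse Fourier transform of det (F g)^-1; ghat is a representative of
   the entrywise Fourier transform F g, which is only defined a.e. *)
Definition is_g2a (R : realType) (alpha : R) (w : 'I_2 -> R)
    (g2a : R * R -> R) : Prop :=
  [/\ continuous g2a,
      exists M : R, forall x, `|g2a x| <= M
    & exists ghat : R * R -> 'M[R[i]]_2,
        (forall j k, dist_is_fun (fourier (kernel_dist (gbold alpha w j k)))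
                       (fun xi => ghat xi j k)) /\
        dist_eq (kernel_dist (g2 alpha g2a))
          (inv_fourier (fun_dist (fun xi => (\det (ghat xi))^-1)))].

(* Centre of a grid cell: (2 i - 1) / n - 1 with the shifted index i. *)
Definition grid_pt (R : realType) (n : nat) (i j : 'I_n) : R * R :=
  ((2 * i + 1)%N%:R / n%:R - 1, (2 * j + 1)%N%:R / n%:R - 1).

(* The cells are half-open so as to be disjoint; this only affects the
   piecewise constant function on a null set avoiding the grid points. *)
Definition cell (R : realType) (n : nat) (i j : 'I_n) : set (R * R) :=
  let x := grid_pt R i j in
  `[x.1 - n%:R^-1, x.1 + n%:R^-1[ `*` `[x.2 - n%:R^-1, x.2 + n%:R^-1[.
Arguments cell R {n} i j.

Definition pwconst (R : realType) (n : nat) (O : 'M[R]_n) (x : R * R) : R :=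
  \sum_(i < n) \sum_(j < n) \1_(cell R i j) x * O i j.

Definition pwconst2 (R : realType) (n : nat) (O : 'M[R]_(n + n, n))
    (x : R * R) : 'cV[R]_2 :=
  \col_k (if k == 0 then pwconst (usubmx O) x else pwconst (dsubmx O) x).

Definition Psi2 (R : realType) (n : nat) (alpha : R) (w : 'I_2 -> R)
    (g2a : R * R -> R) (O : 'M[R]_(n + n, n)) : 'M[R]_(n + n, n) :=
  let f := mxconv ((g2 alpha g2a)%:M) (mxconv (g1 alpha w) (pwconst2 O)) in
  col_mx (\matrix_(i, j) f (grid_pt R i j) 0 0)
         (\matrix_(i, j) f (grid_pt R i j) 1 0).

Lemma shift_subproof (n : nat) (m i : 'I_n) : (m + n - i < n + n)%N.
Proof. by apply: (leq_ltn_trans (leq_subr _ _)); rewrite ltn_add2r. Qed.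

(* Position, in an array indexed by {-n, ..., n-1}, of the index m - i. *)
Definition shift (n : nat) (m i : 'I_n) : 'I_(n + n) :=
  Ordinal (shift_subproof m i).

Definition dconv (R : realType) (n : nat) (G : 'M[R]_(n + n)) (O : 'M[R]_n) :
    'M[R]_n :=
  \matrix_(k, l) (4 / n%:R ^+ 2 *
    \sum_(i < n) \sum_(j < n) G (shift k i) (shift l j) * O i j).

Definition Pu (R : realType) (n : nat) : 'M[R]_(n, n + n) :=
  row_mx 1%:M 0.
Definition Pl (R : realType) (n : nat) : 'M[R]_(n, n + n) :=
  row_mx 0 1%:M.

(* The layer (P^T G * P') O = P^T (G * (P' O)). *)
Definition layer (R : realType) (n : nat) (P : 'M[R]_(n, n + n))
    (G : 'M[R]_(n + n)) (P' : 'M[R]_(n, n + n)) (O : 'M[R]_(n + n, n)) :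
    'M[R]_(n + n, n) :=
  P^T *m dconv G (P' *m O).

Definition psi1 (R : realType) (n : nat) (alpha : R)
    (G : 'I_2 -> 'I_2 -> 'I_2 -> 'M[R]_(n + n)) (O : 'M[R]_(n + n, n)) :
    'M[R]_(n + n, n) :=
  \sum_(i < 2)
    (layer (Pu R n) (G i 1 1) (Pu R n) O + layer (Pl R n) (G i 0 0) (Pl R n) O
     - layer (Pu R n) (G i 0 1) (Pl R n) O
     - layer (Pl R n) (G i 0 1) (Pu R n) O)
  + alpha *: O.

Definition psi2 (R : realType) (n : nat) (alpha : R) (G2a : 'M[R]_(n + n))
    (O : 'M[R]_(n + n, n)) : 'M[R]_(n + n, n) :=
  alpha ^- 2 *: O
  - (layer (Pu R n) G2a (Pu R n) O + layer (Pl R n) G2a (Pl R n) O).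

Definition c_cnn (R : realType) (w : 'I_2 -> R) : R :=
  2 ^+ 7 * Num.sqrt 2 * pi * w 1
  * (norm_c (w 0) ^+ 2 + norm_c (w 1) ^+ 2) * (pi + 2 ^+ 3 * w 1 ^+ 2).

(* Main.v *)
(* The kernels G are averages of the filters over grid cells.  As the input is
   constant on each cell, psi_1 then equals g_1 * O exactly at the grid points,
   and so the only error lies in replacing, inside the convolution with
   g_{2,alpha}, the smooth part of g_1 * O by its value at the centre of each
   cell.  The filters being Lipschitz, this costs O(1/n) times
   sup |g_{2,alpha}|.

   To bound this supremum, one tests F g against Gaussians.  These are stable
   under products up to constants, and polynomials in them approximate
   indicators of rectangles, so that they determine a function almost
   everywhere: the matrix F g - alpha I is almost everywhere real symmetric,
   positive semidefinite, and zero outside [-2 omega_2, 2 omega_2]^2.  Hence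
   det (F g) >= alpha^2, with equality outside the square, so the Fourier
   transform alpha^-2 - det (F g)^-1 of g_{2,alpha} takes its values in
   [0, alpha^-2] and vanishes off the square, and
   |g_{2,alpha}| <= alpha^-2 (4 omega_2)^2 / (2 pi)^2.  Pointwise values of
   the continuous function g_{2,alpha} are recovered from its integrals
   against concentrating Gaussians. *)
Require Import Defs.
From HB Require Import structures.
From mathcomp Require Import all_boot all_order all_algebra complex.
From mathcomp Require Import all_classical all_reals all_analysis.
From mathcomp Require Import measurable_realfun.
From mathcomp Require Import ring lra zify.

Set Implicit Arguments.
Unset Strict Implicit.
Unset Printing Implicit Defensive.

Import Order.TTheory GRing.Theory Num.Theory.
Import numFieldNormedType.Exports.

Local Open Scope classical_set_scope.
Local Open Scope ring_scope.

(** * Integration of real-valued functions *)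

(** Identities between distributions become usable once the Fourier transform of the test function
    is known, and for Gaussians it is explicit. The transform is kept real throughout: a phase [th]
    inside a cosine yields real and imaginary parts together.

    The obstacle is that [ghat] is known only through its pairings. Its measurability, symmetry,
    sign and support all have to be extracted from them, and its entries need not be integrable.
    Multiplying by a fixed Gaussian makes them integrable; the pairing then identifies each weighted
    entry of F g - alpha I with the image of an explicit weight on the torus under the frequency map
    t -> omega (x - z) and its opposite. On the torus the quadratic form of the matrix is an
    integral of (u (x . z) - 1)^2 and each coordinate of a frequency is at most 2 omega in modulus;
    both facts are carried over to almost every xi by comparing the two sides on measurable sets. *)

Section toolkit.
Context d (T : measurableType d) (R : realType).
Variable mu : {measure set T -> \bar R}.

Lemma le_integrableR (f g : T -> R) : measurable_fun setT f ->
  mu.-integrable setT (EFin \o g) -> (forall x, `|f x| <= g x) ->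
  mu.-integrable setT (EFin \o f).
Proof.
move=> mf ig fg; apply: le_integrable ig => //; first exact/measurable_EFinP.
by move=> x _ /=; rewrite lee_fin (le_trans (fg x))// ler_norm.
Qed.

Lemma integrable_measurableR (f : T -> R) :
  mu.-integrable setT (EFin \o f) -> measurable_fun setT f.
Proof. by move=> /integrableP[/measurable_EFinP]. Qed.

Lemma integrableMb (f g : T -> R) (M : R) : measurable_fun setT f ->
  (forall x, `|f x| <= M) -> mu.-integrable setT (EFin \o g) ->
  mu.-integrable setT (EFin \o (fun x => f x * g x)).
Proof.
move=> mf fM ig; apply: (@le_integrableR _ (fun x => M * `|g x|)).
- by apply: measurable_funM => //; exact: integrable_measurableR.
- have -> : EFin \o (fun x => M * `|g x|) = (fun x => M%:E * (EFin \o (fun y => `|g y|)%R) x)%E.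
    by apply/funext => x.
  by apply: integrableZl => //; exact: integrable_norm.
- by move=> x; rewrite normrM ler_wpM2r.
Qed.

Lemma integrableZR (g : T -> R) (c : R) : mu.-integrable setT (EFin \o g) ->
  mu.-integrable setT (EFin \o (fun x => c * g x)).
Proof. by apply: (@integrableMb (cst c) g `|c|) => //. Qed.

Lemma integrableDR (f g : T -> R) : mu.-integrable setT (EFin \o f) ->
  mu.-integrable setT (EFin \o g) ->
  mu.-integrable setT (EFin \o (fun x => f x + g x)).
Proof.
move=> mf mg; rewrite (_ : EFin \o _ = ((EFin \o f) \+ (EFin \o g))%E)//.
exact: integrableD.
Qed.

Lemma integrable_sumR n (f : 'I_n -> T -> R) :
  (forall i, mu.-integrable setT (EFin \o f i)) ->
  mu.-integrable setT (EFin \o (fun x => \sum_(i < n) f i x)).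
Proof.
elim: n f => [|n IH] f fi.
  by under [X in EFin \o X]eq_fun do rewrite big_ord0; exact: integrable0.
under [X in EFin \o X]eq_fun do rewrite big_ord_recl.
by apply: integrableDR => //; exact: IH.
Qed.

Lemma Rintegral_sumR n (f : 'I_n -> T -> R) :
  (forall i, mu.-integrable setT (EFin \o f i)) ->
  \int[mu]_x (\sum_(i < n) f i x) = \sum_(i < n) \int[mu]_x f i x.
Proof.
elim: n f => [|n IH] f fi.
  rewrite big_ord0; under eq_Rintegral do rewrite big_ord0.
  by rewrite /Rintegral integral0.
under eq_Rintegral do rewrite big_ord_recl.
by rewrite RintegralD ?IH ?big_ord_recl//; exact: integrable_sumR.
Qed.

Lemma Rdominated_convergence (f_ : nat -> T -> R) (f g : T -> R) :
  (forall n, measurable_fun setT (f_ n)) ->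
  (forall x, f_ n x @[n --> \oo] --> f x) ->
  mu.-integrable setT (EFin \o g) ->
  (forall n x, `|f_ n x| <= g x) ->
  measurable_fun setT f /\ \int[mu]_x f_ n x @[n --> \oo] --> \int[mu]_x f x.
Proof.
move=> mf ff ig fg.
have mlim : measurable_fun setT f by exact: (measurable_fun_cvg _ (fun x _ => ff x)).
split=> //.
have mfE n : measurable_fun setT (EFin \o f_ n) by apply/measurable_EFinP.
have cvE : {ae mu, forall x, setT x -> (EFin \o f_ n) x @[n --> \oo] --> (EFin \o f) x}.
  by apply/aeW => x _; apply: cvg_EFin; [exact: nearW|exact: ff].
have leE : {ae mu, forall x n, setT x -> (`|(EFin \o f_ n) x| <= (EFin \o g) x)%E}.
  by apply/aeW => x n _; rewrite /= lee_fin.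
have [i_f _ c] := dominated_convergence measurableT mfE
  ((measurable_EFinP _ _).2 mlim) cvE ig leE.
by apply: fine_cvg; rewrite fineK//; exact: integrable_fin_num.
Qed.

Lemma Rintegral_ae (f g : T -> R) : measurable_fun setT f ->
  measurable_fun setT g -> {ae mu, forall x, f x = g x} ->
  \int[mu]_x f x = \int[mu]_x g x.
Proof.
move=> mf mg fg; congr fine; apply: ae_eq_integral => //; [exact/measurable_EFinP..|].
by apply: filterS fg => x /= -> _.
Qed.

End toolkit.

Section Rfubini.
Context d1 d2 (T1 : measurableType d1) (T2 : measurableType d2) (R : realType).
Variables (m1 : {sigma_finite_measure set T1 -> \bar R}).
Variables (m2 : {sigma_finite_measure set T2 -> \bar R}).
Variable f : T1 * T2 -> R.
Hypothesis intf : ((m1 \x m2)%E).-integrable setT (EFin \o f).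

(** Only almost everywhere: on a null set the inner integral may fail to be finite, and [fine] then
    returns 0. *)
Let aeF : ae_eq m1 setT (fubini_F m2 (EFin \o f))
  (EFin \o (fun x => \int[m2]_y f (x, y))).
Proof.
apply: filterS (ae_integrable1 intf) => x iy _ /=.
by rewrite /fubini_F /Rintegral fineK//; exact: integrable_fin_num.
Qed.

Let aeG : ae_eq m2 setT (fubini_G m1 (EFin \o f))
  (EFin \o (fun y => \int[m1]_x f (x, y))).
Proof.
apply: filterS (ae_integrable2 intf) => x iy _ /=.
by rewrite /fubini_G /Rintegral fineK//; exact: integrable_fin_num.
Qed.

Lemma measurable_RintegralF : measurable_fun setT (fun x => \int[m2]_y f (x, y)).
Proof.
have -> : (fun x => \int[m2]_y f (x, y)) = fine \o fubini_F m2 (EFin \o f) by [].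
by apply: measurableT_comp => //; exact: (measurable_fubini_F intf).
Qed.

Lemma measurable_RintegralG : measurable_fun setT (fun y => \int[m1]_x f (x, y)).
Proof.
have -> : (fun y => \int[m1]_x f (x, y)) = fine \o fubini_G m1 (EFin \o f) by [].
by apply: measurableT_comp => //; exact: (measurable_fubini_G intf).
Qed.

Lemma integrable_RintegralF :
  m1.-integrable setT (EFin \o (fun x => \int[m2]_y f (x, y))).
Proof.
apply: (le_integrable measurableT _ _ (integrable_fubini_F intf)).
  by apply/measurable_EFinP; exact: measurable_RintegralF.
move=> x _; rewrite /= /Rintegral -/(fubini_F m2 (EFin \o f) x).
by case: fubini_F => //=; rewrite normr0 leey.
Qed.

Lemma Rfubini1 : \int[(m1 \x m2)%E]_z f z = \int[m1]_x \int[m2]_y f (x, y).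
Proof.
rewrite {1}/Rintegral -(integral12_prod_meas1 intf); congr fine.
apply: ae_eq_integral => //; first exact: (measurable_fubini_F intf).
by apply/measurable_EFinP; exact: measurable_RintegralF.
Qed.

Lemma Rfubini2 : \int[(m1 \x m2)%E]_z f z = \int[m2]_y \int[m1]_x f (x, y).
Proof.
rewrite {1}/Rintegral -(integral21_prod_meas1 intf); congr fine.
apply: ae_eq_integral => //; first exact: (measurable_fubini_G intf).
by apply/measurable_EFinP; exact: measurable_RintegralG.
Qed.

End Rfubini.

Section tensor.
Context d1 d2 (T1 : measurableType d1) (T2 : measurableType d2) (R : realType).
Variables (m1 : {sigma_finite_measure set T1 -> \bar R}).
Variables (m2 : {sigma_finite_measure set T2 -> \bar R}).

Lemma integrable_tensor (u : T1 -> R) (v : T2 -> R) :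
  m1.-integrable setT (EFin \o u) -> m2.-integrable setT (EFin \o v) ->
  ((m1 \x m2)%E).-integrable setT (EFin \o (fun x => u x.1 * v x.2)).
Proof.
move=> iu iv; apply/integrable12ltyP.
  apply/measurable_EFinP; apply: measurable_funM.
    by apply: measurableT_comp => //; exact: integrable_measurableR iu.
  by apply: measurableT_comp => //; exact: integrable_measurableR iv.
rewrite [ltLHS](_ : _ = \int[m1]_x (`|u x|%:E * \int[m2]_y `|v y|%:E))%E; last first.
  apply: eq_integral => x _; rewrite -ge0_integralZl//; last first.
    by apply/measurable_EFinP; apply: measurableT_comp => //; exact: integrable_measurableR iv.
  by apply: eq_integral => y _ /=; rewrite -EFinM normrM.
have [_ v_] := integrableP _ _ _ iv; have [_ u_] := integrableP _ _ _ iu.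
rewrite ge0_integralZr//=; last 2 first.
  by apply/measurable_EFinP; apply: measurableT_comp => //; exact: integrable_measurableR iu.
  by apply: integral_ge0.
by rewrite lte_mul_pinfty ?ge0_fin_numE//; exact: integral_ge0.
Qed.

Lemma integrable_prod_bounded (f : T1 * T2 -> R) (u : T1 -> R) (v : T2 -> R) :
  measurable_fun setT f ->
  m1.-integrable setT (EFin \o u) -> m2.-integrable setT (EFin \o v) ->
  (forall x, `|f x| <= u x.1 * v x.2) ->
  ((m1 \x m2)%E).-integrable setT (EFin \o f).
Proof. by move=> mf iu iv fuv; apply: le_integrableR fuv => //; exact: integrable_tensor. Qed.

End tensor.

Section indicator.
Context d (T : measurableType d) (R : realType).
Variable mu : {measure set T -> \bar R}.

Lemma patch_indic (D : set T) (f : T -> R) : f \_ D = (fun x => \1_D x * f x).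
Proof.
apply/funext => x; rewrite patchE indicE; case: (x \in D); first by rewrite mul1r.
by rewrite mul0r.
Qed.

Lemma Rintegral_indic (D : set T) (f : T -> R) :
  \int[mu]_(x in D) f x = \int[mu]_x (\1_D x * f x).
Proof. by rewrite Rintegral_mkcond patch_indic. Qed.

Lemma indic_ge0_le1 (D : set T) x : 0 <= (\1_D x : R) <= 1.
Proof. by rewrite indicE; case: (x \in D); rewrite /= ?lexx ?ler01. Qed.

Lemma norm_indic_le1 (D : set T) x : `|\1_D x : R| <= 1.
Proof. by rewrite ger0_norm; case/andP: (indic_ge0_le1 D x). Qed.

End indicator.

(** * Gaussians *)

Section trigonometric_bounds.
Context {R : realType}.

Lemma norm_sin_le1 (t : R) : `|sin t| <= 1.
Proof. by rewrite ler_norml sin_geN1 sin_le1. Qed.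

Lemma norm_cos_le1 (t : R) : `|cos t| <= 1.
Proof. by rewrite ler_norml cos_geN1 cos_le1. Qed.

End trigonometric_bounds.

Section gauss.
Context {R : realType}.
Implicit Types (p a b x : R).
Notation mu := (@lebesgue_measure R).

(** Not normalised: the maximum is 1, so that values lie in the interval [0, 1] on which the
    polynomials below act, and [p] is an inverse squared width, so that it adds up under
    products. *)
Definition gauss p a x : R := expR (- (p * (x - a) ^+ 2)).

Lemma gauss_gt0 p a x : 0 < gauss p a x. Proof. exact: expR_gt0. Qed.

Lemma gauss_le1 p a x : 0 <= p -> gauss p a x <= 1.
Proof.
by move=> p0; rewrite -expR0 ler_expR oppr_le0 mulr_ge0// sqr_ge0.
Qed.

Lemma is_derive_mul (f g : R -> R) x df dg :
  is_derive x 1 f df -> is_derive x 1 g dg ->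
  is_derive x 1 (fun y => f y * g y) (df * g x + f x * dg).
Proof.
move=> hf hg; apply: (@is_derive_eq _ _ _ (f * g)); rewrite /GRing.scale/=.
by rewrite addrC [in RHS]mulrC.
Qed.

Lemma is_derive_gauss p a x :
  is_derive x 1 (gauss p a) (- (2 * p * (x - a)) * gauss p a x).
Proof.
have h : is_derive x (1 : R) (fun y => - (p * (y - a) ^+ 2)) (- (2 * p * (x - a))).
  apply: (@is_derive_eq _ _ _ (- (p *: (id - cst a) ^+ 2))).
  by rewrite /GRing.scale/= subr0 !mulr1 /= mulr2n expr1 !fctE; ring.
have := @is_derive1_comp R expR _ x _ _ (is_derive_expR _) h.
by rewrite mulrC.
Qed.

Lemma continuous_gauss p a : continuous (gauss p a).
Proof.
move=> x; apply: differentiable_continuous; apply/derivable1_diffP.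
by have [] := is_derive_gauss p a x.
Qed.

Lemma measurable_gauss p a : measurable_fun setT (gauss p a).
Proof. exact: (continuous_measurable_fun (@continuous_gauss p a)). Qed.

(** The normal law of variance 1 / (2 p) provides integrability and the total mass sqrt (pi / p). *)
Lemma gauss_normal_pdf p a : 0 < p ->
  gauss p a = (fun x => Num.sqrt (pi / p) * normal_pdf a (Num.sqrt (2 * p))^-1 x).
Proof.
move=> p0; apply/funext => x.
have s0 : (Num.sqrt (2 * p))^-1 != 0 by rewrite invr_neq0// gt_eqF// sqrtr_gt0 mulr_gt0.
rewrite normal_pdfE// /normal_peak /normal_fun exprVn sqr_sqrtr ?mulr_ge0 ?ltW//.
have -> : (2 * p)^-1 * pi *+ 2 = pi / p by field; rewrite gt_eqF.
rewrite mulrA mulfV ?mul1r; last by rewrite gt_eqF// sqrtr_gt0 divr_gt0// pi_gt0.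
by congr expR; field; rewrite gt_eqF.
Qed.

Lemma integrable_gauss p a : 0 < p -> mu.-integrable setT (EFin \o gauss p a).
Proof.
move=> p0; rewrite gauss_normal_pdf//; apply: integrableZR.
exact: integrable_normal_pdf.
Qed.

Lemma integral_gauss p a : 0 < p -> \int[mu]_x gauss p a x = Num.sqrt (pi / p).
Proof.
move=> p0; rewrite gauss_normal_pdf// RintegralZl//; last exact: integrable_normal_pdf.
by rewrite [X in _ * X](_ : _ = 1) ?mulr1// /Rintegral integral_normal_pdf.
Qed.

Lemma gaussD p q a x : gauss (p + q) a x = gauss p a x * gauss q a x.
Proof. by rewrite /gauss -expRD mulrDl opprD. Qed.

Lemma norm_gauss_bound p a x : 0 < p -> `|x - a| * gauss p a x <= 1 + p^-1.
Proof.
move=> p0.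
have h1 : `|x - a| <= 1 + (x - a) ^+ 2.
  by rewrite -(real_normK (num_real (x - a))); set y := `|_|; nra.
have h2 : p * (x - a) ^+ 2 * gauss p a x <= 1.
  rewrite /gauss expRN ler_pdivrMr ?expR_gt0// mul1r.
  by apply: le_trans (expR_ge1Dx _); rewrite lerDr.
have := gauss_le1 a x (ltW p0); have := gauss_gt0 p a x.
move: (gauss p a x) h1 h2 => g h1 h2 g0 g1.
apply: (@le_trans _ _ ((1 + (x - a) ^+ 2) * g)); first by rewrite ler_wpM2r// ltW.
rewrite mulrDl mul1r lerD// -[leLHS](mulKf (lt0r_neq0 p0)) ger_pMr ?invr_gt0//.
by rewrite mulrA.
Qed.

(** Each factor [x - a] is absorbed by half of the exponent, so the induction on the polynomial has
    to range over all [p]. *)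
Lemma poly_gauss_bound (P : {poly R}) p : 0 < p ->
  exists2 M : R, 0 <= M & forall a x, `|P.[x - a] * gauss p a x| <= M.
Proof.
elim/poly_ind: P p => [|P c IH] p p0.
  by exists 0 => // a x; rewrite horner0 mul0r normr0.
have p20 : 0 < p / 2 by rewrite divr_gt0.
have [M M0 HM] := IH _ p20.
exists (M * (1 + (p / 2)^-1) + `|c|) => [|a x].
  by rewrite addr_ge0// mulr_ge0// addr_ge0// invr_ge0 ltW.
rewrite hornerMXaddC mulrDl (le_trans (ler_normD _ _))// lerD//.
  rewrite [in leLHS](splitr p) gaussD mulrACA normrM ler_pM//.
  by rewrite normrM [`|gauss _ _ _|]ger0_norm ?norm_gauss_bound// ltW// gauss_gt0.
by rewrite normrM ler_piMr// ger0_norm ?gauss_le1 ?ltW// gauss_gt0.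
Qed.

Lemma integrable_poly_gauss (P : {poly R}) p a : 0 < p ->
  mu.-integrable setT (EFin \o (fun x => P.[x - a] * gauss p a x)).
Proof.
move=> p0; have p20 : 0 < p / 2 by rewrite divr_gt0.
have mP q : measurable_fun setT (fun x : R => P.[x - a] * gauss q a x).
  apply: measurable_funM; last exact: measurable_gauss.
  apply: (@measurableT_comp _ _ _ _ _ _ (horner P)); last exact: measurable_funB.
  by apply: continuous_measurable_fun; exact: continuous_horner.
have [M M0 HM] := poly_gauss_bound P p20.
apply: (@le_integrableR _ _ R mu _ (fun x => M * gauss (p / 2) a x)).
- exact: mP.
- by apply: integrableZR; exact: integrable_gauss.
- move=> x; rewrite [in leLHS](splitr p) gaussD mulrA normrM.
by rewrite [X in _ * X]ger0_norm ?ler_wpM2r// ltW// gauss_gt0.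
Qed.

(** A crude decay rate that makes the boundary terms of the integration by parts vanish. It comes
    from 2 |x - a| <= p (x - a)^2 + 1 / p and exp n >= 1 + n. *)
Lemma gauss_harmonic p a : 0 < p -> exists2 C : R, 0 <= C &
  forall n : nat, gauss p a n%:R <= C * harmonic n /\ gauss p a (- n%:R) <= C * harmonic n.
Proof.
move=> p0.
have key x : gauss p a x <= expR (p^-1 + 2 * `|a|) * expR (- `|x|).
  rewrite -expRD ler_expR.
  have h : 2 * `|x - a| <= p * (x - a) ^+ 2 + p^-1.
    rewrite -(real_normK (num_real (x - a))); set y := `|_|.
    have : 0 <= p * (y - p^-1) ^+ 2 by rewrite mulr_ge0 ?sqr_ge0 ?ltW.
    rewrite sqrrB mulrDr mulrBr.
    have -> : p * p^-1 ^+ 2 = p^-1 by field; rewrite gt_eqF.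
    have -> : p * (y * p^-1 *+ 2) = 2 * y by field; rewrite gt_eqF.
    by lra.
  have h2 : `|x| <= `|x - a| + `|a| by rewrite -{1}(subrK a x) ler_normD.
  have h3 : 0 <= `|x - a| by []. have h4 : 0 <= `|a| by [].
  lra.
exists (expR (p^-1 + 2 * `|a|)) => [|n]; first exact: expR_ge0.
have h : expR (- n%:R) <= (harmonic n : R).
  by rewrite /harmonic/= expRN lef_pV2 ?posrE ?expR_gt0// -natr1 addrC expR_ge1Dx.
split; apply: (le_trans (key _)); rewrite ?normrN normr_nat ler_wpM2l//; exact: expR_ge0.
Qed.

(** The fundamental theorem on [-n, n] gives boundary terms that tend to 0, while dominated
    convergence identifies the limit of the left-hand side. *)
Lemma Rintegral_deriv0 (W w : R -> R) :
  (forall x, is_derive x 1 W (w x)) -> continuous w ->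
  mu.-integrable setT (EFin \o w) ->
  W n%:R @[n --> \oo] --> 0 -> W (- n%:R) @[n --> \oo] --> 0 ->
  \int[mu]_x w x = 0.
Proof.
move=> dW cw iw Wp Wn.
pose I n : set R := `[- n.+1%:R, n.+1%:R]%classic.
have FTC n : \int[mu]_(x in I n) w x = W n.+1%:R - W (- n.+1%:R).
  have cW : continuous W.
    by move=> x; apply: differentiable_continuous; apply/derivable1_diffP; have [] := dW x.
  have ab : - n.+1%:R < n.+1%:R :> R by rewrite gtrN.
  rewrite /Rintegral (@continuous_FTC2 _ w W)//.
  - exact: continuous_subspaceT.
  - split; [by move=> x _; have [] := dW x|..].
      by apply: cvg_at_right_filter; exact: cW.
    by apply: cvg_at_left_filter; exact: cW.
  - by move=> x _; rewrite derive1E; apply: derive_val.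
have mI n : measurable (I n) by exact: measurable_itv.
have mw : measurable_fun setT w by exact: integrable_measurableR iw.
have [_ c1] : measurable_fun setT w /\
    \int[mu]_x (\1_(I n) x * w x) @[n --> \oo] --> \int[mu]_x w x.
  apply: (Rdominated_convergence _ _ (integrable_norm iw)).
  - by move=> n; apply: measurable_funM => //; exact: measurable_indic (mI n).
  - move=> x; apply: cvg_near_cst; near=> n.
    rewrite indicE mem_set ?mul1r// /I/= in_itv/= -ler_norml.
    near: n; exists (Num.trunc `|x|) => // n /= xn.
    by rewrite (le_trans (ltW (truncnS_gt _)))// ler_nat.
  - by move=> n x; rewrite normrM ler_piMl// norm_indic_le1.
have c2 : \int[mu]_x (\1_(I n) x * w x) @[n --> \oo] --> 0.
  under eq_fun do rewrite -Rintegral_indic FTC.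
  have h : W n.+1%:R - W (- n.+1%:R) @[n --> \oo] --> (0 : R) - 0.
    apply: cvgB.
      by rewrite (cvg_shiftS (fun n => W n%:R)).
    by rewrite (cvg_shiftS (fun n => W (- n%:R))).
  by rewrite subr0 in h.
exact: (cvg_unique _ c1 c2).
Unshelve. all: by end_near. Qed.

Lemma is_derive_sin_affine b a th x :
  is_derive x 1 (fun y : R => sin (b * (y - a) + th)) (b * cos (b * (x - a) + th)).
Proof.
have h : is_derive x (1 : R) (fun y => b * (y - a) + th) b.
  apply: (@is_derive_eq _ _ _ (b *: (id - cst a) + cst th)).
  by rewrite /GRing.scale/= subr0 !mulr1 addr0.
have := @is_derive1_comp R sin _ x _ _ (is_derive_sin _) h.
by rewrite mulrC.
Qed.

Lemma is_derive_cos_affine b a th x :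
  is_derive b 1 (fun c : R => cos (c * (x - a) + th)) (- ((x - a) * sin (b * (x - a) + th))).
Proof.
have h : is_derive b (1 : R) (fun c => c * (x - a) + th) (x - a).
  apply: (@is_derive_eq _ _ _ (id * cst (x - a) + cst th)).
  by rewrite /GRing.scale/= mulr0 mulr1 !(addr0,add0r).
have := @is_derive1_comp R cos _ b _ _ (is_derive_cos _) h.
by rewrite mulrC mulrN.
Qed.

Let sin_bound (t : R) : `|sin t| <= 1. Proof. exact: norm_sin_le1. Qed.
Let cos_bound (t : R) : `|cos t| <= 1. Proof. exact: norm_cos_le1. Qed.

Let msin b a th : measurable_fun setT (fun x : R => sin (b * (x - a) + th)).
Proof.
apply: continuous_measurable_fun => x; apply: differentiable_continuous.
by apply/derivable1_diffP; have [] := is_derive_sin_affine b a th x.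
Qed.

Let mcos b a th : measurable_fun setT (fun x : R => cos (b * (x - a) + th)).
Proof.
have -> : (fun x : R => cos (b * (x - a) + th)) = (fun x => sin (b * (x - a) + (th + pi / 2))).
  by apply/funext => x; rewrite addrA sinDpihalf.
exact: msin.
Qed.

Lemma integrable_gauss_cos_center p a b th : 0 < p ->
  mu.-integrable setT (EFin \o (fun x => gauss p a x * cos (b * (x - a) + th))).
Proof.
move=> p0; under [X in EFin \o X]eq_fun do rewrite mulrC.
by apply: (@integrableMb _ _ _ mu _ (gauss p a) 1) => //; [exact: mcos|exact: integrable_gauss].
Qed.

Let integrable_linear_gauss_sin p a b th : 0 < p ->
  mu.-integrable setT (EFin \o (fun x => sin (b * (x - a) + th) * ((x - a) * gauss p a x))).
Proof.
move=> p0; apply: (@integrableMb _ _ _ mu _ (fun x => (x - a) * gauss p a x) 1) => //.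
  exact: msin.
have := integrable_poly_gauss 'X a p0.
by under [X in EFin \o X]eq_fun do rewrite hornerX.
Qed.

(* Integrating the derivative of [gauss * sin] over the line gives the
   differential equation [K' b = - b / (2 p) * K b] for the cosine transform. *)
Lemma gauss_by_parts p a b th : 0 < p ->
  \int[mu]_x (sin (b * (x - a) + th) * ((x - a) * gauss p a x)) =
  b / (2 * p) * \int[mu]_x (gauss p a x * cos (b * (x - a) + th)).
Proof.
move=> p0.
pose W x := gauss p a x * sin (b * (x - a) + th).
pose w x := - (2 * p) * (sin (b * (x - a) + th) * ((x - a) * gauss p a x)) +
   b * (gauss p a x * cos (b * (x - a) + th)).
have i1 := integrable_linear_gauss_sin a b th p0.
have i2 := integrable_gauss_cos_center a b th p0.
have dW x : is_derive x 1 W (w x).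
  have := is_derive_mul (is_derive_gauss p a x) (is_derive_sin_affine b a th x).
  by move=> h0; apply: (is_derive_eq h0); rewrite /w; ring.
have [C C0 HC] := gauss_harmonic a p0.
have cv0 : C * harmonic n @[n --> \oo] --> (0 : R).
  by rewrite -[X in _ --> X](mulr0 C); apply: cvgMr; exact: cvg_harmonic.
have WC x : `|W x| <= gauss p a x.
  by rewrite normrM [X in X * _]gtr0_norm ?gauss_gt0// ler_piMr// ltW// gauss_gt0.
have : \int[mu]_x w x = 0.
  apply: (Rintegral_deriv0 dW).
  - have csin : continuous (fun x : R => sin (b * (x - a) + th)).
      move=> x; apply: differentiable_continuous; apply/derivable1_diffP.
      by have [] := is_derive_sin_affine b a th x.
    have ccos : continuous (fun x : R => cos (b * (x - a) + th)).
      have -> : (fun x : R => cos (b * (x - a) + th)) =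
                (fun x => sin (b * (x - a) + (th + pi / 2))).
        by apply/funext => x; rewrite addrA sinDpihalf.
      move=> x; apply: differentiable_continuous; apply/derivable1_diffP.
      by have [] := is_derive_sin_affine b a (th + pi / 2) x.
    move=> x; apply: cvgD; apply: cvgM; [exact: cvg_cst| |exact: cvg_cst|].
      apply: cvgM; first exact: csin.
      by apply: cvgM; [apply: cvgB; [exact: cvg_id|exact: cvg_cst]|exact: continuous_gauss].
    by apply: cvgM; [exact: continuous_gauss|exact: ccos].
  - by apply: integrableDR; exact: integrableZR.
  - apply: norm_cvg0; apply: (squeeze_cvgr _ (cvg_cst 0) cv0).
    by apply: nearW => n; rewrite normr_ge0/= (le_trans (WC _))//; case: (HC n).
  - apply: norm_cvg0; apply: (squeeze_cvgr _ (cvg_cst 0) cv0).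
    by apply: nearW => n; rewrite normr_ge0/= (le_trans (WC _))//; case: (HC n).
rewrite RintegralD//; [|exact: integrableZR..].
rewrite !RintegralZl// mulNr => /eqP; rewrite addrC subr_eq0 => /eqP h.
apply: (@mulfI _ (2 * p)); first by rewrite mulf_neq0// gt_eqF.
by rewrite -h mulrA mulrCA mulfV ?mulr1// mulf_neq0// gt_eqF.
Qed.

(** Differentiation under the integral sign turns [gauss_by_parts] into a linear differential
    equation in the frequency. The phase [th] covers the cosine and sine transforms at once, at 0
    and at plus or minus pi / 2. *)
Lemma Rintegral_gauss_cos_center p a b th : 0 < p ->
  \int[mu]_x (gauss p a x * cos (b * (x - a) + th)) =
  Num.sqrt (pi / p) * gauss (4 * p)^-1 0 b * cos th.
Proof.
move=> p0.
pose K (c : R) := \int[mu]_x (gauss p a x * cos (c * (x - a) + th)).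
have dK (c : R) : is_derive c 1 K (- (c / (2 * p)) * K c).
  pose f (c x : R) := gauss p a x * cos (c * (x - a) + th).
  have df (c' x : R) : is_derive c' 1 (f ^~ x) (- (sin (c' * (x - a) + th) * ((x - a) * gauss p a x))).
    have := is_derive_mul (is_derive_cst (gauss p a x) c' 1) (is_derive_cos_affine c' a th x).
    by move=> h0; apply: (is_derive_eq h0); rewrite mul0r add0r /=; ring.
  have df1 c' x : partial1of2 f c' x = - (sin (c' * (x - a) + th) * ((x - a) * gauss p a x)).
    by rewrite partial1of2E; have [_ ->] := df c' x.
  have Ic : `]c - 1, c + 1[%classic c by rewrite /= in_itv/= ltrBlDr ltrDl ltr01.
  have iG : mu.-integrable setT (EFin \o (fun x => `|(x - a) * gauss p a x|)).
    have := integrable_norm (integrable_poly_gauss 'X a p0).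
    by under [X in EFin \o X]eq_fun do rewrite hornerX.
  have GG c' x : `|partial1of2 f c' x| <= `|(x - a) * gauss p a x|.
    by rewrite df1 normrN normrM ler_piMl.
  have H1 x : `]c - 1, c + 1[%classic x -> mu.-integrable setT (EFin \o f x).
    by move=> _; exact: integrable_gauss_cos_center.
  have H2 (x y : R) : `]c - 1, c + 1[%classic x -> setT y -> derivable (f ^~ y) x 1.
    by move=> _ _; have [] := df x y.
  have H3 (x y : R) : `]c - 1, c + 1[%classic x -> setT y ->
    `|partial1of2 f x y| <= `|(y - a) * gauss p a y| by move=> _ _; exact: GG.
  have d1 := derivable_under_integral measurableT Ic H1 H2 (fun y => normr_ge0 _) iG H3.
  have d2 := differentiation_under_integral measurableT Ic H1 H2 (fun y => normr_ge0 _) iG H3.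
  apply: DeriveDef => //; rewrite -derive1E d2.
  under eq_Rintegral do rewrite df1 -mulN1r.
  rewrite RintegralZl//; last exact: integrable_linear_gauss_sin.
  by rewrite mulN1r gauss_by_parts// mulNr.
(* The exponential is the integrating factor of K' = - c / (2 p) K, so E is constant. *)
pose E c := K c * expR ((4 * p)^-1 * c ^+ 2).
have dE (c : R) : is_derive c 1 E 0.
  have h : is_derive c (1 : R) (fun c => (4 * p)^-1 * c ^+ 2) ((2 * p)^-1 * c).
    apply: (@is_derive_eq _ _ _ (cst (4 * p)^-1 * (id * id))).
    by rewrite /GRing.scale/=; field; rewrite gt_eqF.
  have h2 := @is_derive1_comp R expR _ c _ _ (is_derive_expR _) h.
  have := is_derive_mul (dK c) h2.
  by move=> h0; apply: (is_derive_eq h0); rewrite /=; field; rewrite gt_eqF.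
have := is_derive_0_is_cst b 0 dE.
rewrite /E expr0n/= mulr0 expR0 mulr1.
have -> : K 0 = Num.sqrt (pi / p) * cos th.
  rewrite /K; under eq_Rintegral do rewrite mul0r add0r mulrC.
  by rewrite RintegralZl ?integral_gauss ?integrable_gauss// mulrC.
move=> h; rewrite -/(K b) mulrAC -h /gauss subr0 -mulrA -expRD subrr expR0 mulr1 //.
Qed.

Lemma Rintegral_gauss_cos p a b th : 0 < p ->
  \int[mu]_x (gauss p a x * cos (b * x + th)) =
  Num.sqrt (pi / p) * gauss (4 * p)^-1 0 b * cos (b * a + th).
Proof.
move=> p0; rewrite -(@Rintegral_gauss_cos_center p a)//.
by apply: eq_Rintegral => x _; congr (_ * cos _); ring.
Qed.

Lemma integrable_gauss_cos p a b th : 0 < p ->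
  mu.-integrable setT (EFin \o (fun x => gauss p a x * cos (b * x + th))).
Proof.
move=> p0; have := integrable_gauss_cos_center a b (b * a + th) p0.
by under [X in EFin \o X]eq_fun do rewrite mulrBr addrA subrK.
Qed.

End gauss.

Section poly_gauss.
Local Open Scope complex_scope.
Context {R : realType}.
Implicit Types (p q : R) (a x : R * R) (P Q : {poly R}).

(** The class is closed under differentiation, unlike that of Gaussians; this is what makes all
    iterated partial derivatives accessible in the proof that Gaussians are Schwartz functions. *)
Definition poly_gauss P p (a x : R) : R := P.[x - a] * gauss p a x.

Definition poly_gauss_deriv P p : {poly R} := P^`() - (2 * p) *: ('X * P).

Lemma is_derive_poly_gauss P p (a x : R) :
  is_derive x 1 (poly_gauss P p a) (poly_gauss (poly_gauss_deriv P p) p a x).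
Proof.
have h : is_derive x (1 : R) (fun y => P.[y - a]) P^`().[x - a].
  have h1 : is_derive x (1 : R) (fun y => y - a) 1.
    apply: (@is_derive_eq _ _ _ (id - cst a)); exact: subr0.
  have := @is_derive1_comp R (horner P) _ x _ _ (is_derive_poly P (x - a)) h1.
  by rewrite mulr1.
have h0 := is_derive_mul h (is_derive_gauss p a x).
by apply: (is_derive_eq h0); rewrite /poly_gauss /poly_gauss_deriv hornerD hornerN hornerZ hornerM hornerX; ring.
Qed.

Definition poly_gauss2 P Q p q a x : R :=
  poly_gauss P p a.1 x.1 * poly_gauss Q q a.2 x.2.

Lemma is_derive_axis (b : bool) (u v : R -> R) (x : R * R) (du dv : R) :
  is_derive x.1 1 u du -> is_derive x.2 1 v dv ->
  is_derive x (axis R b) (fun y : R * R => u y.1 * v y.2)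
    (if b then u x.1 * dv else du * v x.2).
Proof.
move=> [du1 du2] [dv1 dv2].
suff h : h^-1 *: ((fun y : R * R => u y.1 * v y.2) (h *: axis R b + x) - u x.1 * v x.2) @[h --> 0^'] -->
    (if b then u x.1 * dv else du * v x.2).
  split; first by apply/cvg_ex; exists (if b then u x.1 * dv else du * v x.2).
  exact/cvg_lim.
case: b => /=.
  rewrite (_ : (fun h => _) = (fun h : R => u x.1 * (h^-1 *: (v (h *: 1 + x.2) - v x.2)))); last first.
    by apply/funext => h; rewrite /GRing.scale/= mulr0 add0r; ring.
  by apply: cvgMr; rewrite -dv2; exact: dv1.
rewrite (_ : (fun h => _) = (fun h : R => (h^-1 *: (u (h *: 1 + x.1) - u x.1)) * v x.2)); last first.
  by apply/funext => h; rewrite /GRing.scale/= mulr0 add0r; ring.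
by apply: cvgMl; rewrite -du2; exact: du1.
Qed.

Lemma is_derive_poly_gauss2 P Q p q a b x :
  is_derive x (axis R b) (poly_gauss2 P Q p q a)
   (if b then poly_gauss2 P (poly_gauss_deriv Q q) p q a x
    else poly_gauss2 (poly_gauss_deriv P p) Q p q a x).
Proof. by apply: is_derive_axis; exact: is_derive_poly_gauss. Qed.

Lemma continuous_poly_gauss2 P Q p q a : continuous (poly_gauss2 P Q p q a).
Proof.
have c P' p' (a' : R) : continuous (poly_gauss P' p' a').
  move=> x; apply: differentiable_continuous; apply/derivable1_diffP.
  by have [] := is_derive_poly_gauss P' p' a' x.
move=> x; apply: cvgM.
  exact: (continuous_comp (g := poly_gauss P p a.1) cvg_fst (c _ _ _ _)).
exact: (continuous_comp (g := poly_gauss Q q a.2) cvg_snd (c _ _ _ _)).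
Qed.

Lemma partials_poly_gauss2 P Q p q a s : exists P' Q',
  partials (poly_gauss2 P Q p q a) s = poly_gauss2 P' Q' p q a.
Proof.
elim: s => [|b s [P' [Q' IH]]]; first by exists P, Q.
rewrite /= -/(partials _ s) IH.
exists (if b then P' else poly_gauss_deriv P' p), (if b then poly_gauss_deriv Q' q else Q').
apply/funext => x; have [_ ->] := is_derive_poly_gauss2 P' Q' p q a b x.
by case: b.
Qed.

Lemma schwartz_real_poly_gauss2 P Q p q a : 0 < p -> 0 < q ->
  schwartz_real (poly_gauss2 P Q p q a).
Proof.
move=> p0 q0 s; have [P' [Q' ->]] := partials_poly_gauss2 P Q p q a s.
split=> [|b x|m n]; first exact: continuous_poly_gauss2.
  by have [] := is_derive_poly_gauss2 P' Q' p q a b x.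
have bnd p' k P1 (a' : R) : 0 < p' -> exists2 M : R, 0 <= M &
    forall x : R, `|x ^+ k * poly_gauss P1 p' a' x| <= M.
  move=> p'0; have [M M0 HM] := poly_gauss_bound (('X + a'%:P) ^+ k * P1) p'0.
  exists M => // x; have := HM a' x.
  by rewrite hornerM horner_exp hornerD hornerX hornerC subrK /poly_gauss mulrA.
have [M M0 HM] := bnd p m P' a.1 p0; have [N N0 HN] := bnd q n Q' a.2 q0.
exists (M * N) => x; rewrite /poly_gauss2 mulrACA normrM.
by rewrite ler_pM.
Qed.

Definition gauss2 p q a x : R := gauss p a.1 x.1 * gauss q a.2 x.2.

Lemma poly_gauss2_1 p q a : poly_gauss2 1 1 p q a = gauss2 p q a.
Proof. by apply/funext => x; rewrite /poly_gauss2 /poly_gauss !hornerC !mul1r. Qed.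

Lemma schwartz_gauss2 p q a : 0 < p -> 0 < q ->
  schwartz (fun x => (gauss2 p q a x)%:C).
Proof.
move=> p0 q0; split => /=.
  by rewrite -/(gauss2 p q a) -poly_gauss2_1; exact: schwartz_real_poly_gauss2.
have := @schwartz_real_poly_gauss2 0 1 p q a p0 q0.
by rewrite /poly_gauss2 /poly_gauss; under eq_fun do rewrite horner0 !mul0r.
Qed.

Lemma gauss2_gt0 p q a x : 0 < gauss2 p q a x.
Proof. by rewrite mulr_gt0// gauss_gt0. Qed.

Lemma measurable_gauss2 p q a : measurable_fun setT (gauss2 p q a).
Proof.
apply: measurable_funM.
  exact: (measurableT_comp (measurable_gauss p a.1) measurable_fst).
exact: (measurableT_comp (measurable_gauss q a.2) measurable_snd).
Qed.

Lemma integrable_gauss2 p q a : 0 < p -> 0 < q ->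
  (leb2 R).-integrable setT (EFin \o gauss2 p q a).
Proof. by move=> p0 q0; apply: integrable_tensor; exact: integrable_gauss. Qed.

Lemma measurable_dot a : measurable_fun setT (dot a).
Proof.
by apply: measurable_funD; apply: measurable_funM.
Qed.

Lemma measurable_cos : measurable_fun setT (@cos R).
Proof. by apply: continuous_measurable_fun; exact: continuous_cos. Qed.

Lemma integrable_gauss2_cos p q a b th : 0 < p -> 0 < q ->
  (leb2 R).-integrable setT (EFin \o (fun x => gauss2 p q a x * cos (dot b x + th))).
Proof.
move=> p0 q0; under [X in EFin \o X]eq_fun do rewrite mulrC.
apply: (@integrableMb _ _ _ (leb2 R) (fun x => cos (dot b x + th)) (gauss2 p q a) 1); last 2 first.
- by move=> x; exact: norm_cos_le1.
- exact: integrable_gauss2.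
apply: (measurableT_comp measurable_cos).
by apply: measurable_funD => //; exact: measurable_dot.
Qed.

Lemma Rintegral_gauss2_cos p q a b th : 0 < p -> 0 < q ->
  \int[leb2 R]_x (gauss2 p q a x * cos (dot b x + th)) =
  Num.sqrt (pi / p) * Num.sqrt (pi / q) *
  gauss2 (4 * p)^-1 (4 * q)^-1 (0, 0) b * cos (dot b a + th).
Proof.
move=> p0 q0; rewrite Rfubini1; last exact: integrable_gauss2_cos.
under eq_Rintegral.
  move=> x _ /=.
  under eq_Rintegral do rewrite /gauss2 /dot /= -mulrA addrAC addrC -/(dot _ _).
  rewrite RintegralZl//; last exact: integrable_gauss_cos.
  rewrite Rintegral_gauss_cos// mulrCA.
  rewrite (_ : b.2 * a.2 + _ = b.1 * x + (b.2 * a.2 + th)); last by ring.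
  over.
rewrite RintegralZl//; last exact: integrable_gauss_cos.
rewrite Rintegral_gauss_cos// /gauss2/= /dot.
rewrite (_ : b.1 * a.1 + (b.2 * a.2 + th) = b.1 * a.1 + b.2 * a.2 + th); ring.
Qed.

Lemma Rintegral_gauss2 p q a : 0 < p -> 0 < q ->
  \int[leb2 R]_x gauss2 p q a x = Num.sqrt (pi / p) * Num.sqrt (pi / q).
Proof.
move=> p0 q0; have := @Rintegral_gauss2_cos p q a (0, 0) 0 p0 q0.
rewrite /dot /= !mul0r !addr0 cos0 mulr1.
rewrite /gauss2 /gauss /= !subrr expr0n /= !mulr0 oppr0 expR0 !mulr1 => <-.
by apply: eq_Rintegral => x _; rewrite !mul0r !addr0 cos0 mulr1.
Qed.

End poly_gauss.

(** * Gaussians separate finite signed measures on the plane *)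

Section interval_approximation.
Context {R : realType}.

(** The two forms of Bernoulli's inequality: (1 - z)^m is close to 1 when m z is small, and at most
    1 / (1 + m z) when m z is large. *)
Lemma onemX_bernoulli (z : R) (m : nat) : 0 <= z <= 1 ->
  1 - m%:R * z <= (1 - z) ^+ m /\ (1 - z) ^+ m * (1 + m%:R * z) <= 1.
Proof.
move=> /andP[z0 z1]; elim: m => [|m [IH1 IH2]].
  by rewrite expr0 mul0r subr0 addr0 mulr1.
have e0 : 0 <= (1 - z) ^+ m by rewrite exprn_ge0// subr_ge0.
have m0 : 0 <= m%:R :> R by [].
rewrite exprS -natr1; move: ((1 - z) ^+ m) (m%:R : R) e0 m0 IH1 IH2 => e k e0 k0 h1 h2.
split.
  apply: (@le_trans _ _ ((1 - z) * (1 - k * z))); last by rewrite ler_wpM2l// subr_ge0.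
  by rewrite -subr_ge0 (_ : _ - _ = k * (z * z)) ?mulr_ge0//; ring.
apply: le_trans h2; rewrite -subr_ge0 (_ : _ - _ = e * (k * (z * z) + z * z)); last by ring.
by rewrite mulr_ge0// addr_ge0// ?mulr_ge0.
Qed.

(** With s the square root of y, Bernoulli's inequality bounds n s^n by 1 / (1 - s), which leaves a
    factor s^n tending to 0. *)
Lemma cvg_natr_mul_expr (y : R) : 0 <= y < 1 -> n%:R * y ^+ n @[n --> \oo] --> 0.
Proof.
move=> /andP[y0 y1]; set s := Num.sqrt y.
have s0 : 0 <= s by exact: sqrtr_ge0.
have s1 : s < 1 by rewrite -sqrtr1 ltr_sqrt.
have c : (1 - s)^-1 * s ^+ n @[n --> \oo] --> 0.
  rewrite -[X in _ --> X](mulr0 (1 - s)^-1); apply: cvgMr.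
  by apply: cvg_expr; rewrite ger0_norm.
apply: (squeeze_cvgr _ (cvg_cst 0) c); apply: nearW => n.
rewrite mulr_ge0 ?exprn_ge0//=.
have -> : y = s * s by rewrite -expr2 sqr_sqrtr.
rewrite exprMn mulrA ler_wpM2r ?exprn_ge0//.
rewrite -[leRHS]mul1r ler_pdivlMr ?subr_gt0//.
have := @onemX_bernoulli (1 - s) n; rewrite subr_ge0 ltW//= gerBl s0.
move=> /(_ isT)[_]; rewrite subKr; apply: le_trans.
rewrite -mulrA mulrCA ler_wpM2l ?exprn_ge0//.
by rewrite lerDr.
Qed.

(* As n tends to infinity, these tend on [0, 1] to the indicator of [1/2, 1];
   composed with a Gaussian they approximate the indicator of an interval. *)
Definition threshold_poly (n : nat) : {poly R} := 1 - (1 - 'X ^+ n) ^+ (n * 2 ^ n).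

Lemma threshold_polyE n (y : R) : (threshold_poly n).[y] = 1 - (1 - y ^+ n) ^+ (n * 2 ^ n).
Proof. by rewrite !(hornerE, horner_exp). Qed.

Lemma norm_threshold_poly n (y : R) : 0 <= y <= 1 -> `|(threshold_poly n).[y]| <= 1.
Proof.
move=> /andP[y0 y1]; rewrite threshold_polyE.
have h : 0 <= y ^+ n <= 1 by rewrite exprn_ge0// exprn_ile1.
have h2 : 0 <= (1 - y ^+ n) ^+ (n * 2 ^ n) <= 1.
  by case/andP: h => h1 h2; rewrite exprn_ge0 ?exprn_ile1// ?subr_ge0// gerBl.
by rewrite ger0_norm ?subr_ge0 ?gerBl; case/andP: h2.
Qed.

(** In [onemX_bernoulli] with z = y^n and m = n 2^n, the product m z is n (2 y)^n: it tends to 0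
    below 1/2 and is at least n from 1/2 on. The extra factor n in the exponent is what sends the
    endpoint 1/2 itself to 1. *)
Lemma cvg_threshold_poly (y : R) : 0 <= y <= 1 ->
  (threshold_poly n).[y] @[n --> \oo] --> ((2^-1 <= y)%R%:R : R).
Proof.
move=> /andP[y0 y1].
have h n : 0 <= y ^+ n <= 1 by rewrite exprn_ge0// exprn_ile1.
have h2 n m : 0 <= (1 - y ^+ n) ^+ m <= 1.
  by case/andP: (h n) => h1 h2; rewrite exprn_ge0 ?exprn_ile1// ?subr_ge0// gerBl.
have e n : (n * 2 ^ n)%:R * y ^+ n = n%:R * (2 * y) ^+ n :> R.
  by rewrite natrM natrX exprMn mulrA.
rewrite (funext (fun n => threshold_polyE n y)).
have [ly|ly] := leP (2^-1 : R) y.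
  rewrite /= -[X in _ --> X]subr0; apply: cvgB; first exact: cvg_cst.
  apply: (squeeze_cvgr _ (cvg_cst 0) cvg_harmonic); apply: nearW => n.
  case/andP: (h2 n (n * 2 ^ n)%N) => -> _ /=.
  have [_] := onemX_bernoulli (n * 2 ^ n) (h n); rewrite e => b.
  rewrite -[leRHS]mul1r ler_pdivlMr//; apply: le_trans b.
  rewrite ler_wpM2l//; first by case/andP: (h2 n (n * 2 ^ n)%N).
  rewrite -natr1 addrC lerD2l ler_peMr// exprn_ege1//.
  by rewrite -(@ler_pM2l _ 2^-1) ?invr_gt0// mulr1 mulrA mulVf// mul1r.
have c : n%:R * (2 * y) ^+ n @[n --> \oo] --> 0.
  apply: cvg_natr_mul_expr; rewrite mulr_ge0//=.
  by rewrite -(@ltr_pM2l _ 2^-1) ?invr_gt0// mulr1 mulrA mulVf// mul1r.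
apply: (squeeze_cvgr _ (cvg_cst 0) c); apply: nearW => n /=.
rewrite subr_ge0; case/andP: (h2 n (n * 2 ^ n)%N) => _ -> /=.
have [b _] := onemX_bernoulli (n * 2 ^ n) (h n).
by rewrite -e lerBlDl -lerBlDr.
Qed.

(** Empty and one-point intervals are included because they occur as intersections of intervals, and
    the boxes must form a system closed under intersection. *)
Lemma interval_gauss_approx (l u : R) : exists (p a : R) (P : nat -> {poly R}),
  [/\ 0 < p, forall n y, 0 <= y <= 1 -> `|(P n).[y]| <= 1 &
    forall x, (P n).[gauss p a x] @[n --> \oo] --> (\1_(`[l, u]%classic : set R) x : R)].
Proof.
have [ul|lu|->] := ltgtP u l.
- exists 1, 0, (fun=> 0); split => [//|n y _|x]; first by rewrite horner0 normr0.
  under eq_fun do rewrite horner0.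
  rewrite indicE memNset; first exact: cvg_cst.
  by rewrite /= in_itv/= => /andP[lx xu]; move: (lt_le_trans ul (le_trans lx xu)); rewrite ltxx.
- set r := (u - l) / 2; set a := (u + l) / 2.
  have er : 2 * r = u - l by rewrite /r; field.
  have ea : 2 * a = u + l by rewrite /a; field.
  have r0 : 0 < r by rewrite divr_gt0 ?subr_gt0.
  clearbody r a.
  have ln20 : 0 < ln 2 :> R by rewrite ln_gt0// ltr1n.
  (* This width makes the Gaussian equal to 1/2 exactly at the two endpoints, so that [l, u] is the
     set where it is at least 1/2. *)
  exists (ln 2 / r ^+ 2), a, threshold_poly.
  have p0 : 0 < ln 2 / r ^+ 2 by rewrite divr_gt0// exprn_gt0.
  split => // [|x]; first exact: norm_threshold_poly.
  rewrite indicE (_ : (x \in _) = (2^-1 <= gauss (ln 2 / r ^+ 2) a x)).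
    by apply: cvg_threshold_poly; rewrite ltW ?gauss_gt0//= gauss_le1// ltW.
  rewrite /gauss -[X in X <= _](@lnK _ 2^-1) ?posrE ?invr_gt0// ler_expR.
  rewrite lnV ?posrE// lerN2 mulrAC ler_pdivrMr ?exprn_gt0// ler_pM2l//.
  rewrite -(real_normK (num_real (x - a))) ler_pXn2r ?nnegrE ?(ltW r0)//.
  rewrite ler_norml mem_setE in_itv/=.
  by apply/idP/idP => /andP[? ?]; apply/andP; split; lra.
(* For a single point, powers of a Gaussian that reaches 1 only there. *)
- exists 1, l, (fun n => 'X ^+ n); split => // [n y /andP[y0 y1]|x].
    by rewrite !hornerE ger0_norm ?exprn_ge0// exprn_ile1.
  under eq_fun do rewrite hornerXn.
  rewrite set_itv1 indicE.
  have [->|xl] := eqVneq x l.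
    rewrite mem_set//= /gauss subrr expr0n/= mulr0 oppr0 expR0.
    by under eq_fun do rewrite expr1n; exact: cvg_cst.
  rewrite memNset /=; last exact/eqP.
  apply: cvg_expr; rewrite gtr0_norm ?gauss_gt0// /gauss -[ltRHS]expR0 ltr_expR oppr_lt0 mul1r.
  by rewrite exprn_even_gt0//= subr_eq0.
Qed.

End interval_approximation.

Section bounded_functional.
Context d (T : measurableType d) (R : realType).
Implicit Types (L : (T -> R) -> R) (f g : T -> R).

Definition bounded_measurable f := measurable_fun setT f /\ exists M, forall x, `|f x| <= M.

(** A functional substitute for a finite signed measure: linear on bounded measurable functions and
    continuous under bounded pointwise convergence. Differences of integrals over unrelated spaces
    fit in directly. *)
Definition bounded_continuous L :=
  (forall f g (c : R), bounded_measurable f -> bounded_measurable g ->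
     L (fun x => f x + c * g x) = L f + c * L g) /\
  (forall (f_ : nat -> T -> R) f, (forall n, measurable_fun setT (f_ n)) ->
     (forall n x, `|f_ n x| <= 1) -> (forall x, f_ n x @[n --> \oo] --> f x) ->
     L (f_ n) @[n --> \oo] --> L f).

Lemma bounded_measurable_cst (c : R) : bounded_measurable (cst c).
Proof. by split=> //; exists `|c|. Qed.

Lemma bounded_measurableD f g : bounded_measurable f -> bounded_measurable g ->
  bounded_measurable (fun x => f x + g x).
Proof.
move=> [mf [M HM]] [mg [N HN]]; split; first exact: measurable_funD.
by exists (M + N) => x; rewrite (le_trans (ler_normD _ _))// lerD.
Qed.

Lemma bounded_measurableM f g : bounded_measurable f -> bounded_measurable g ->
  bounded_measurable (fun x => f x * g x).
Proof.
move=> [mf [M HM]] [mg [N HN]]; split; first exact: measurable_funM.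
by exists (M * N) => x; rewrite normrM ler_pM.
Qed.

Lemma bounded_measurableX f n : bounded_measurable f ->
  bounded_measurable (fun x => f x ^+ n).
Proof.
move=> bf; elim: n => [|n IH]; first exact: bounded_measurable_cst.
by under eq_fun do rewrite exprS; exact: bounded_measurableM.
Qed.

Lemma bounded_measurable_horner f (P : {poly R}) : bounded_measurable f ->
  bounded_measurable (fun x => P.[f x]).
Proof.
move=> bf; elim/poly_ind: P => [|P c IH].
  by under eq_fun do rewrite horner0; exact: bounded_measurable_cst.
under eq_fun do rewrite hornerMXaddC.
apply: bounded_measurableD; last exact: bounded_measurable_cst.
exact: bounded_measurableM.
Qed.

Lemma bounded_measurable_indic (A : set T) : measurable A -> bounded_measurable (\1_A).
Proof.
by move=> mA; split; [exact: measurable_indic|exists 1 => x; exact: norm_indic_le1].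
Qed.

Lemma bounded_continuous0 L : bounded_continuous L -> L (cst 0) = 0.
Proof.
move=> [lin _]; have := lin (cst 0) (cst 0) 1 (bounded_measurable_cst 0) (bounded_measurable_cst 0).
rewrite mul1r (_ : (fun _ => _) = cst 0); last by apply/funext => x /=; rewrite mulr0 addr0.
by move/eqP; rewrite -subr_eq0 opprD addrA subrr sub0r oppr_eq0 => /eqP.
Qed.

Lemma bounded_continuous_poly L f g (P : {poly R}) : bounded_continuous L ->
  bounded_measurable f -> bounded_measurable g ->
  (forall k, L (fun x => f x ^+ k * g x) = 0) ->
  L (fun x => P.[f x] * g x) = 0.
Proof.
move=> bL bf bg h.
(* The power of f in front is generalised because [poly_ind] splits P into P X + c, and the X joins
   that power. *)
suff H k : L (fun x => f x ^+ k * (P.[f x] * g x)) = 0.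
  by have := H 0; under eq_fun do rewrite expr0 mul1r.
elim/poly_ind: P k => [|P c IH] k.
  by under eq_fun do rewrite horner0 mul0r mulr0; exact: bounded_continuous0.
rewrite (_ : (fun x => _) = (fun x => f x ^+ k.+1 * (P.[f x] * g x) + c * (f x ^+ k * g x))).
  rewrite bL.1 ?IH ?h ?mulr0 ?addr0//.
    by do 2?apply: bounded_measurableM => //; [exact: bounded_measurableX|exact: bounded_measurable_horner].
  by apply: bounded_measurableM => //; exact: bounded_measurableX.
by apply/funext => x; rewrite hornerMXaddC exprS; ring.
Qed.

(** A lambda-system must contain the whole space. The exhausting sequence F gives this by
    continuity, since only bounded boxes are accessible to the approximation. *)
Lemma lambda_system_bounded_continuous L : bounded_continuous L ->
  (exists2 F : nat -> set T, nondecreasing_seq F &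
     \bigcup_n F n = setT /\ forall n, measurable (F n) /\ L (\1_(F n)) = 0) ->
  lambda_system setT [set A | measurable A /\ L (\1_A) = 0].
Proof.
move=> bL [F Fnd [FT HF]].
have nd : ndseq_closed [set A | measurable A /\ L (\1_A) = 0].
  move=> G Gnd HG; split; first by apply: bigcup_measurable => k _; case: (HG k).
  have c : L (\1_(G n)) @[n --> \oo] --> L (\1_(\bigcup_n G n)).
    apply: bL.2 => [n|n x|x]; first by apply: measurable_indic; case: (HG n).
      exact: norm_indic_le1.
    have [[k _ Gkx]|nG] := pselect ((\bigcup_n G n) x).
      apply: cvg_near_cst; exists k => // n /= kn.
      rewrite !indicE !mem_set//; first by exists k.
      by move: x Gkx; apply/subsetPset; exact: Gnd.
    apply: cvg_near_cst; apply: nearW => n; rewrite !indicE !memNset// => Gnx.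
    by apply: nG; exists n.
  apply: (cvg_unique _ c) => //.
  by apply: cvg_near_cst; apply: nearW => n; case: (HG n).
split => // [|A B BA [mA A0] [mB B0]].
  by rewrite -FT; exact: nd.
split; first exact: measurableD.
have -> : \1_(A `\` B) = (fun x => \1_A x + (-1) * \1_B x) :> (T -> R).
  apply/funext => x; rewrite !indicE mulN1r.
  have [Bx|nBx] := pselect (B x).
    by rewrite memNset ?(mem_set Bx) ?(mem_set (BA _ Bx)) ?subrr// => -[].
  rewrite (memNset nBx) subr0; have [Ax|nAx] := pselect (A x).
    by rewrite !mem_set.
  by rewrite !memNset// => -[].
by rewrite bL.1 ?A0 ?B0 ?mulr0 ?addr0//; exact: bounded_measurable_indic.
Qed.

End bounded_functional.

Section closed_boxes.
Context {R : realType}.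

Definition closed_boxes : set (set (R * R)) :=
  [set A | exists l1 u1 l2 u2 : R, A = `[l1, u1]%classic `*` `[l2, u2]%classic].

Lemma setI_closed_boxes : setI_closed closed_boxes.
Proof.
have I2 (l u l' u' : R) : `[l, u]%classic `&` `[l', u']%classic =
    `[Order.max l l', Order.min u u']%classic.
  apply/seteqP; split => x; rewrite /= !in_itv/= ge_max le_min.
    by move=> [/andP[-> ->] /andP[-> ->]].
  by move=> /andP[/andP[-> ->] /andP[-> ->]].
move=> _ _ [l1 [u1 [l2 [u2 ->]]]] [l1' [u1' [l2' [u2' ->]]]].
rewrite -setXI !I2.
by exists (Order.max l1 l1'), (Order.min u1 u1'), (Order.max l2 l2'), (Order.min u2 u2').
Qed.

Definition centered_box (n : nat) : set (R * R) := `[- n%:R, n%:R] `*` `[- n%:R, n%:R].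

Lemma nondecreasing_centered_box : nondecreasing_seq centered_box.
Proof.
move=> m n mn; apply/subsetPset => -[x y] [/=]; rewrite !in_itv/= -!ler_norml => hx hy.
have h : m%:R <= n%:R :> R by rewrite ler_nat.
by split; rewrite /= in_itv/= -ler_norml (le_trans _ h).
Qed.

Lemma bigcup_centered_box : \bigcup_n centered_box n = setT.
Proof.
apply/seteqP; split => // -[x y] _.
exists (Num.trunc (Order.max `|x| `|y|)).+1 => //.
have h : Order.max `|x| `|y| <= (Num.trunc (Order.max `|x| `|y|)).+1%:R by exact: ltW (truncnS_gt _).
by split; rewrite /= in_itv/= -ler_norml (le_trans _ h)// le_max lexx// orbT.
Qed.

(** Half-planes with sides parallel to the axes are countable unions of closed boxes; they generate
    the cylinders over Borel sets, and a measurable rectangle is an intersection of two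
    cylinders. *)
Lemma measurable_closed_boxes (A : set (R * R)) : measurable A -> <<s closed_boxes >> A.
Proof.
pose S := <<s closed_boxes >>.
have [S0 SC SU] : sigma_algebra setT S by exact: smallest_sigma_algebra.
have SI (B C : set (R * R)) : S B -> S C -> S (B `&` C).
  move=> SB SC'.
  rewrite -(setCK (B `&` C)) setCI -setTD; apply: (SC).
  rewrite -bigcup2E; apply: (SU) => -[|[|n]] //=; rewrite -setTD; exact: SC.
have half (x : R) : S (`[x, +oo[ `*` setT) /\ S (setT `*` `[x, +oo[).
  split.
    rewrite (_ : _ `*` _ = \bigcup_n (`[x, n%:R]%classic `*` `[- n%:R, n%:R]%classic)).
      by apply: (SU) => n; apply: sub_sigma_algebra; exists x, n%:R, (- n%:R), n%:R.
    apply/seteqP; split => -[y z] /=.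
      rewrite in_itv/= andbT => -[xy _].
      have : setT (y, z) by []. rewrite -bigcup_centered_box => -[n _ [/= hy hz]].
      exists n => //; split => //=; move: hy; rewrite !in_itv/= xy.
      by move=> /andP[].
    by move=> [n _ [/=]]; rewrite !in_itv/= andbT => /andP[-> _].
  rewrite (_ : _ `*` _ = \bigcup_n (`[- n%:R, n%:R]%classic `*` `[x, n%:R]%classic)).
    by apply: (SU) => n; apply: sub_sigma_algebra; exists (- n%:R), n%:R, x, n%:R.
  apply/seteqP; split => -[y z] /=.
    rewrite in_itv/= andbT => -[_ xy].
    have : setT (y, z) by []. rewrite -bigcup_centered_box => -[n _ [/= hy hz]].
    exists n => //; split => //=; move: hz; rewrite !in_itv/= xy.
    by move=> /andP[].
  by move=> [n _ [/=]]; rewrite !in_itv/= andbT => _ /andP[-> _].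
have cyl (B : set R) : measurable B -> S (B `*` setT) /\ S (setT `*` B).
  have -> : (measurable : set (set R)) = (@RGenCInfty.G R).-sigma.-measurable.
    exact: RGenCInfty.measurableE.
  move: B; apply: smallest_sub => /=.
    split => [|C [h1 h2]|C h].
    - by rewrite set0X setX0.
    - split.
        by rewrite (_ : _ `*` _ = setT `\` (C `*` setT)); [exact: SC|
          apply/seteqP; split => -[y z] /=; tauto].
      by rewrite (_ : _ `*` _ = setT `\` (setT `*` C)); [exact: SC|
          apply/seteqP; split => -[y z] /=; tauto].
    - by split; [rewrite setX_bigcupl|rewrite setX_bigcupr]; apply: (SU) => k; case: (h k).
  by move=> _ [x ->]; exact: half.
rewrite measurable_prod_measurableType; apply: smallest_sub.
  exact: smallest_sigma_algebra.
move=> _ [B mB [C mC <-]].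
rewrite (_ : B `*` C = (B `*` setT) `&` (setT `*` C)).
  by apply: SI; [case: (cyl B mB)|case: (cyl C mC)].
by rewrite -setXI setIT setTI.
Qed.

(** Powers of a single Gaussian per coordinate suffice, since [interval_gauss_approx] uses
    polynomials in one Gaussian. This settles closed boxes, and the pi-lambda theorem does the
    rest. *)
Lemma gauss_determining (L : (R * R -> R) -> R) : bounded_continuous L ->
  (forall j k p q a, 0 < p -> 0 < q ->
     L (fun x => gauss p a.1 x.1 ^+ j * gauss q a.2 x.2 ^+ k) = 0) ->
  forall A, measurable A -> L (\1_A) = 0.
Proof.
move=> bL H.
have bm1 p a : 0 < p -> bounded_measurable (fun x : R * R => gauss p a x.1).
  move=> p0; split.
    exact: (measurableT_comp (measurable_gauss p a) measurable_fst).
  by exists 1 => x; rewrite gtr0_norm ?gauss_gt0 ?gauss_le1 ?ltW.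
have bm2 p a : 0 < p -> bounded_measurable (fun x : R * R => gauss p a x.2).
  move=> p0; split.
    exact: (measurableT_comp (measurable_gauss p a) measurable_snd).
  by exists 1 => x; rewrite gtr0_norm ?gauss_gt0 ?gauss_le1 ?ltW.
have box l1 u1 l2 u2 : L (\1_(`[l1, u1] `*` `[l2, u2])) = 0.
  have [p [a [P [p0 P1 cP]]]] := interval_gauss_approx l1 u1.
  have [q [b [Q [q0 Q1 cQ]]]] := interval_gauss_approx l2 u2.
  have e n : L (fun x => (P n).[gauss p a x.1] * (Q n).[gauss q b x.2]) = 0.
    (* The two polynomials are expanded one after the other, each time with the other factor
       fixed. *)
    apply: bounded_continuous_poly => // [||k]; [exact: bm1| |].
      exact/bounded_measurable_horner/bm2.
    under eq_fun do rewrite mulrC.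
    apply: bounded_continuous_poly => // [||k']; [exact: bm2| |].
      exact/bounded_measurableX/bm1.
    under eq_fun do rewrite mulrC.
    exact: (H _ _ _ _ (a, b)).
  have g01 (p' a' x : R) : 0 < p' -> 0 <= gauss p' a' x <= 1.
    by move=> p'0; rewrite ltW ?gauss_gt0//= gauss_le1// ltW.
  have c : L (fun x => (P n).[gauss p a x.1] * (Q n).[gauss q b x.2]) @[n --> \oo] -->
      L (\1_(`[l1, u1] `*` `[l2, u2])).
    apply: bL.2 => [n|n x|x].
    - apply: (bounded_measurableM _ _).1; apply: bounded_measurable_horner; [exact: bm1|exact: bm2].
    - by rewrite normrM mulr_ile1//; [apply: P1|apply: Q1]; exact: g01.
    - rewrite indicE in_setX -mulnb natrM; apply: cvgM; [exact: cP|exact: cQ].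
  by apply: (cvg_unique _ c) => //; apply: cvg_near_cst; apply: nearW.
have lam : lambda_system setT [set A : set (R * R) | measurable A /\ L (\1_A) = 0].
  apply: lambda_system_bounded_continuous => //.
  exists centered_box; first exact: nondecreasing_centered_box.
  split; first exact: bigcup_centered_box.
  by move=> n; split; [apply: measurableX; exact: measurable_itv|exact: box].
move=> A /measurable_closed_boxes; move: A.
suff : <<s closed_boxes >> `<=` [set A : set (R * R) | measurable A /\ L (\1_A) = 0].
  by move=> h A /h [].
apply: lambda_system_subset => //; first exact: setI_closed_boxes.
move=> _ [l1 [u1 [l2 [u2 ->]]]]; split; last exact: box.
by apply: measurableX; exact: measurable_itv.
Qed.

End closed_boxes.

Lemma ord2P (j : 'I_2) : j = 0 \/ j = 1.
Proof. by case: j => [[|[|//]] h]; [left|right]; exact/val_inj. Qed.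

Section bounded_continuous_instances.
Context d (T : measurableType d) (R : realType).

(** Integration against the image under Phi of the measure with density w. It is used with the
    identity for the symbol, and with the frequency map and its opposite for the filters. *)
Lemma bounded_continuous_integral d' (T' : measurableType d') (mu : {measure set T' -> \bar R})
    (w : T' -> R) (Phi : T' -> T) :
  mu.-integrable setT (EFin \o w) -> measurable_fun setT Phi ->
  bounded_continuous (fun f : T -> R => \int[mu]_t (w t * f (Phi t))).
Proof.
move=> iw mPhi.
have i f : bounded_measurable f -> mu.-integrable setT (EFin \o (fun t => w t * f (Phi t))).
  move=> [mf [M HM]]; under [X in EFin \o X]eq_fun do rewrite mulrC.
  by apply: (@integrableMb _ _ _ mu (fun t => f (Phi t)) w M) => //; exact: (measurableT_comp mf).
split=> [f g c bf bg|f_ f mf bf cf].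
  rewrite -RintegralZl//; last exact: i.
  rewrite -RintegralD//; [|exact: i|by apply: integrableZR; exact: i].
  by apply: eq_Rintegral => t _; ring.
have [] // := @Rdominated_convergence _ _ _ mu (fun n t => w t * f_ n (Phi t))
  (fun t => w t * f (Phi t)) (fun t => `|w t|).
- move=> n; apply: measurable_funM; first exact: integrable_measurableR iw.
  exact: measurableT_comp.
- by move=> t; apply: cvgMr; exact: cf.
- exact: integrable_norm.
- by move=> n t; rewrite normrM ler_piMr.
Qed.

Lemma bounded_continuous_comb (L1 L2 : (T -> R) -> R) (c : R) :
  bounded_continuous L1 -> bounded_continuous L2 ->
  bounded_continuous (fun f => L1 f + c * L2 f).
Proof.
move=> [l1 c1] [l2 c2]; split=> [f g k bf bg|f_ f mf bf cf].
  by rewrite l1// l2//; ring.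
by apply: cvgD; [exact: c1|apply: cvgMr; exact: c2].
Qed.

Lemma aeS (mu : {measure set T -> \bar R}) (P Q : T -> Prop) :
  (forall x, P x -> Q x) -> {ae mu, forall x, P x} -> {ae mu, forall x, Q x}.
Proof. exact: filterS. Qed.

Lemma aeS2 (mu : {measure set T -> \bar R}) (P Q S : T -> Prop) :
  (forall x, P x -> Q x -> S x) ->
  {ae mu, forall x, P x} -> {ae mu, forall x, Q x} -> {ae mu, forall x, S x}.
Proof. exact: filterS2. Qed.

Lemma ae_forall_ord2 (mu : {measure set T -> \bar R}) (P : 'I_2 -> 'I_2 -> T -> Prop) :
  (forall j k, {ae mu, forall x, P j k x}) -> {ae mu, forall x, forall j k, P j k x}.
Proof.
move=> h.
apply: filterS2 (filterI (h 0 0) (h 0 1)) (filterI (h 1 0) (h 1 1)) => x [a b] [c e] j k.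
by have [->|->] := ord2P j; have [->|->] := ord2P k.
Qed.

(** Testing on A = [f < 0], where the integrand is minus its absolute value, forces the integral of
    |f| over A to vanish. *)
Lemma ae_ge0 (mu : {measure set T -> \bar R}) (f : T -> R) :
  mu.-integrable setT (EFin \o f) ->
  (forall A, measurable A -> 0 <= \int[mu]_x (f x * \1_A x)) ->
  {ae mu, forall x, 0 <= f x}.
Proof.
move=> intf H; have mf := integrable_measurableR intf.
pose A := [set x | f x < 0].
have mA : measurable A.
  rewrite (_ : A = setT `&` f @^-1` `]-oo, 0[%classic); last first.
    by rewrite setTI; apply/seteqP; split => x; rewrite /= in_itv.
  by apply: mf => //; exact: measurable_itv.
have ifA : mu.-integrable setT (EFin \o (fun x => f x * \1_A x)).
  under [X in EFin \o X]eq_fun do rewrite mulrC.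
  by apply: (@integrableMb _ _ _ mu (\1_A) f 1) => // x; exact: norm_indic_le1.
have E x : `|f x * \1_A x| = - (f x * \1_A x).
  rewrite indicE; have [fx|fx] := ltP (f x) 0.
    by rewrite mem_set// mulr1 ltr0_norm.
  by rewrite memNset ?mulr0 ?normr0 ?oppr0//; rewrite /A/= => /(le_lt_trans fx); rewrite ltxx.
have h : (\int[mu]_(x in setT) `|(f x * \1_A x)%R%:E| = 0)%E.
  have n : (0 <= \int[mu]_(x in setT) `|(f x * \1_A x)%R%:E|)%E by apply: integral_ge0.
  apply/eqP; rewrite eq_le n andbT.
  rewrite (_ : (\int[mu]_(x in setT) _)%E = (- \int[mu]_x (f x * \1_A x))%:E).
    by rewrite lee_fin oppr_le0 H.
  rewrite -[in RHS]mulN1r -RintegralZl// /Rintegral fineK.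
    by apply: eq_integral => x _ /=; rewrite E mulN1r.
  by apply: integrable_fin_num => //; exact: integrableZR.
have mfA := (measurable_EFinP _ _).2 (integrable_measurableR ifA).
have := (ae_eq_integral_abs mu measurableT mfA).1 h.
apply: filterS => x /= /(_ I) [] fx0; rewrite leNgt; apply/negP => fx.
by move: fx0; rewrite indicE mem_set// mulr1 => fx0; move: fx; rewrite fx0 ltxx.
Qed.

End bounded_continuous_instances.

(** * The filters as integrals over the torus *)

Section boxes.
Context {R : realType}.

Lemma indic_setX (A B : set R) (x : R * R) : \1_(A `*` B) x = \1_A x.1 * \1_B x.2 :> R.
Proof. by rewrite indicE in_setX -mulnb natrM. Qed.

Lemma integrable_indic_box (a b a' b' : R) (c d c' d' : bool) :
  (leb2 R).-integrable setT
   (EFin \o \1_([set` Interval (BSide c a) (BSide d b)] `*` [set` Interval (BSide c' a') (BSide d' b')])).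
Proof.
rewrite (funext (indic_setX _ _)); apply: integrable_tensor; exact: integrable_indic_itv.
Qed.

Lemma Rintegral_indic_box (a b a' b' : R) (c d c' d' : bool) : a <= b -> a' <= b' ->
  \int[leb2 R]_x \1_([set` Interval (BSide c a) (BSide d b)] `*` [set` Interval (BSide c' a') (BSide d' b')]) x
   = (b - a) * (b' - a').
Proof.
move=> ab ab'.
have h (u v : R) (c1 d1 : bool) : u <= v ->
    lebesgue_measure [set` Interval (BSide c1 u) (BSide d1 v)] = (v - u)%:E.
  move=> uv; rewrite lebesgue_measure_itv/= lte_fin; case: ifP => //.
  by move/negbT; rewrite -leNgt => vu; rewrite (@le_anti _ _ u v) ?uv// subrr.
have mI (u v : R) (c1 d1 : bool) : measurable [set` Interval (BSide c1 u) (BSide d1 v)].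
  exact: measurable_itv.
have := integral_indic (leb2 R) measurableT (measurableX (mI a b c d) (mI a' b' c' d')).
rewrite setIT => e.
have e2 := @product_measure1E _ _ _ _ R (@lebesgue_measure R) (@lebesgue_measure R) _ _
  (mI a b c d) (mI a' b' c' d').
have e3 : ((b - a)%:E * (b' - a')%:E = lebesgue_measure [set` Interval (BSide c a) (BSide d b)] *
    lebesgue_measure [set` Interval (BSide c' a') (BSide d' b')])%E by rewrite !h.
exact: (congr1 fine (etrans e (etrans e2 (esym e3)))).
Qed.

End boxes.

Section plane.
Context {R : realType}.

(* The canonical sigma-finite structure on product measures is shadowed by the
   one on products of subprobabilities, hence this copy of [leb2]. *)
Definition plane_measure :
  set (measurableTypeR R * measurableTypeR R)%type -> \bar R := leb2 R.

HB.instance Definition _ := Measure.copy plane_measure (leb2 R).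

Lemma plane_measure_sigma_finite : sigma_finite setT plane_measure.
Proof.
exists centered_box; first by rewrite bigcup_centered_box.
move=> n.
pose I : set R := `[- n%:R, n%:R]%classic.
have mI : measurable I by exact: measurable_itv.
split; first exact: measurableX.
have -> : (plane_measure (centered_box n) = lebesgue_measure I * lebesgue_measure I)%E.
  exact: (@product_measure1E _ _ _ _ R (@lebesgue_measure R) (@lebesgue_measure R) _ _ mI mI).
have h : (lebesgue_measure I < +oo)%E.
  by rewrite lebesgue_measure_itv/=; case: ifP => // _; rewrite -EFinB ltry.
by rewrite lte_mul_pinfty// ge0_fin_numE.
Qed.

HB.instance Definition _ :=
  Measure_isSigmaFinite.Build _ _ _ plane_measure plane_measure_sigma_finite.

End plane.
Arguments plane_measure R : clear implicits.

Section circle.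
Context {R : realType}.
Implicit Types (t : R * R) (w : R).

Definition torus : set (R * R) := `[0, 2 * pi] `*` `[0, 2 * pi].

Definition circle_dot t : R := dot (circle_pt t.1) (circle_pt t.2).
Definition circle_diff w t : R * R := scale2 w (circle_pt t.1 - circle_pt t.2).

(** The indicator is part of the weight, so that all integrals run over the whole plane of
    angles. *)
Definition circle_weight (e : nat) t : R := \1_torus t * circle_dot t ^+ e.

Lemma measurable_torus : measurable torus.
Proof. by apply: measurableX; exact: measurable_itv. Qed.

Lemma integrable_torus : (leb2 R).-integrable setT (EFin \o (\1_torus : R * R -> R)).
Proof. exact: integrable_indic_box. Qed.

Lemma measurable_sin : measurable_fun setT (@sin R).
Proof. by apply: continuous_measurable_fun; exact: continuous_sin. Qed.

Lemma measurable_circle_dot : measurable_fun setT circle_dot.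
Proof.
apply: measurable_funD; apply: measurable_funM.
- exact: (measurableT_comp measurable_cos measurable_fst).
- exact: (measurableT_comp measurable_cos measurable_snd).
- exact: (measurableT_comp measurable_sin measurable_fst).
- exact: (measurableT_comp measurable_sin measurable_snd).
Qed.

Lemma measurable_circle_diff w : measurable_fun setT (circle_diff w).
Proof.
apply/measurable_fun_pairP; split; apply: measurable_funM => //; apply: measurable_funB.
- exact: (measurableT_comp measurable_cos measurable_fst).
- exact: (measurableT_comp measurable_cos measurable_snd).
- exact: (measurableT_comp measurable_sin measurable_fst).
- exact: (measurableT_comp measurable_sin measurable_snd).
Qed.

Lemma norm_circle_dot t : `|circle_dot t| <= 1.
Proof. by rewrite /circle_dot /dot /= -cosB norm_cos_le1. Qed.

Lemma norm_circle_weight e t : `|circle_weight e t| <= \1_torus t.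
Proof.
rewrite normrM normrX ger0_norm; last by case/andP: (indic_ge0_le1 R torus t).
by rewrite ler_piMr ?exprn_ile1 ?norm_circle_dot.
Qed.

Lemma measurable_circle_weight e : measurable_fun setT (circle_weight e).
Proof.
apply: measurable_funM; first exact: measurable_indic measurable_torus.
by apply: measurable_funX; exact: measurable_circle_dot.
Qed.

Lemma integrable_circle_weight e : (leb2 R).-integrable setT (EFin \o circle_weight e).
Proof.
apply: (@le_integrableR _ _ R (leb2 R) _ (\1_torus)).
- exact: measurable_circle_weight.
- exact: integrable_torus.
- exact: norm_circle_weight.
Qed.

Lemma circle_diff_le w t : 0 <= w ->
  `|(circle_diff w t).1| <= 2 * w /\ `|(circle_diff w t).2| <= 2 * w.
Proof.
move=> w0; rewrite /circle_diff /scale2 /=; split.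
  rewrite normrM ger0_norm// mulrC ler_wpM2r//.
  by rewrite (le_trans (ler_normB _ _))// lerD// norm_cos_le1.
rewrite normrM ger0_norm// mulrC ler_wpM2r//.
by rewrite (le_trans (ler_normB _ _))// lerD// ler_norml sin_geN1 sin_le1.
Qed.

Definition filter_coef w (j k : 'I_2) : R := (-1) ^+ (j.+1 + k.+1) * norm_c w ^+ 2.
Definition filter_exp (j k : 'I_2) : nat := (4 - j.+1 - k.+1)%N.

Lemma gfilterE w j k y :
  gfilter w j k y = filter_coef w j k *
   \int[leb2 R]_t (circle_weight (filter_exp j k) t * cos (dot (circle_diff w t) y)).
Proof.
rewrite /gfilter /int_circle2 Rintegral_indic; congr (_ * _).
by apply: eq_Rintegral => t _; rewrite /circle_weight -mulrA.
Qed.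

Lemma integrable_circle_cos w e y : (leb2 R).-integrable setT
  (EFin \o (fun t => circle_weight e t * cos (dot (circle_diff w t) y))).
Proof.
under [X in EFin \o X]eq_fun do rewrite mulrC.
apply: (@integrableMb _ _ _ (leb2 R) (fun t => cos (dot (circle_diff w t) y)) _ 1).
- apply: (measurableT_comp measurable_cos); apply: measurable_funD; apply: measurable_funM => //.
    exact: (measurableT_comp measurable_fst (measurable_circle_diff w)).
  exact: (measurableT_comp measurable_snd (measurable_circle_diff w)).
- by move=> t; exact: norm_cos_le1.
- exact: integrable_circle_weight.
Qed.

Lemma integrable_circle_gauss w e p q a th : 0 < p -> 0 < q ->
  ((plane_measure R \x plane_measure R)%E).-integrable setT
    (EFin \o (fun z : (R * R) * (R * R) => circle_weight e z.2 * cos (dot (circle_diff w z.2) z.1) *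
       (gauss2 p q (0, 0) z.1 * cos (dot a z.1 + th)))).
Proof.
move=> p0 q0.
apply: integrable_prod_bounded; last 3 first.
- exact: (@integrable_gauss2 _ p q (0, 0)).
- exact: integrable_torus.
- move=> z; rewrite (normrM (circle_weight e z.2 * _)) (normrM (circle_weight e z.2))
    (normrM (gauss2 p q (0, 0) z.1)) -mulrA [leRHS]mulrC.
  apply: ler_pM => //; first exact: norm_circle_weight.
  rewrite [X in _ * (X * _)]gtr0_norm ?gauss2_gt0// mulrCA ler_piMr ?mulr_ile1 ?norm_cos_le1//.
  by rewrite ltW// gauss2_gt0.
- apply: measurable_funM; apply: measurable_funM.
  + exact: (measurableT_comp (measurable_circle_weight e) measurable_snd).
  + apply: (measurableT_comp measurable_cos).
    have m1 : measurable_fun setT (fun z : (R * R) * (R * R) => circle_diff w z.2).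
      exact: (measurableT_comp (measurable_circle_diff w) measurable_snd).
    apply: measurable_funD; apply: measurable_funM.
    * exact: (measurableT_comp measurable_fst m1).
    * exact: (measurableT_comp measurable_fst measurable_fst).
    * exact: (measurableT_comp measurable_snd m1).
    * exact: (measurableT_comp measurable_snd measurable_fst).
  + exact: (measurableT_comp (measurable_gauss2 p q (0, 0)) measurable_fst).
  + apply: (measurableT_comp measurable_cos); apply: measurable_funD => //.
    exact: (measurableT_comp (measurable_dot a) measurable_fst).
Qed.

Lemma gauss2C p q (a x : R * R) : gauss2 p q (0, 0) (x + a) = gauss2 p q a (- x).
Proof. by rewrite /gauss2 /= ![in RHS]/gauss /gauss !subr0 -!opprD !sqrrN. Qed.

Lemma gauss2NC p q (a x : R * R) : gauss2 p q (0, 0) (a - x) = gauss2 p q a x.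
Proof. by rewrite addrC gauss2C opprK. Qed.

Lemma mulr_cos_cos (s t : R) : cos s * cos t = 2^-1 * (cos (s + t) + cos (t - s)).
Proof. by rewrite cosD cosB; field. Qed.

(** The constant of Fourier inversion in one dimension: the transform of a Gaussian of parameter P
    is its mass times a Gaussian of parameter 1 / (4 P). *)
Lemma sqrt_pi_mul (P : R) : 0 < P -> Num.sqrt (pi / P) * Num.sqrt (pi / (4 * P)^-1) = 2 * pi.
Proof.
move=> P0; rewrite -sqrtrM ?divr_ge0 ?pi_ge0 ?ltW//.
rewrite (_ : pi / P * _ = (2 * pi) ^+ 2); last by rewrite invrK; field; rewrite gt_eqF.
by rewrite sqrtr_sqr ger0_norm// mulr_ge0// pi_ge0.
Qed.

Lemma integrable_circle_weightM e (f : R * R -> R) : bounded_measurable f ->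
  (leb2 R).-integrable setT (EFin \o (fun t => circle_weight e t * f t)).
Proof.
move=> [mf [M HM]]; under [X in EFin \o X]eq_fun do rewrite mulrC.
by apply: (@integrableMb _ _ _ (leb2 R) f _ M) => //; exact: integrable_circle_weight.
Qed.

Lemma measurable_circle_diffN w : measurable_fun setT (fun t => - circle_diff w t).
Proof.
apply/measurable_fun_pairP; split.
  exact: (measurableT_comp (@oppr_measurable R setT)
    (measurableT_comp measurable_fst (measurable_circle_diff w))).
exact: (measurableT_comp (@oppr_measurable R setT)
  (measurableT_comp measurable_snd (measurable_circle_diff w))).
Qed.

Lemma bounded_measurable_gauss2 P Q (a : R * R) : 0 < P -> 0 < Q ->
  bounded_measurable (gauss2 P Q a).
Proof.
move=> P0 Q0; split; first exact: measurable_gauss2.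
exists 1 => x; rewrite gtr0_norm ?gauss2_gt0// mulr_ile1 ?gauss_le1// ltW//.
  exact: gauss_gt0.
exact: gauss_gt0.
Qed.

Lemma bounded_measurable_comp (Phi : R * R -> R * R) (g : R * R -> R) :
  bounded_measurable g -> measurable_fun setT Phi -> bounded_measurable (fun t => g (Phi t)).
Proof.
by move=> [mg [M HM]] mPhi; split; [exact: (measurableT_comp mg mPhi)|exists M].
Qed.

Lemma integrable_circle_sym w e (f : R * R -> R) : bounded_measurable f ->
  (leb2 R).-integrable setT (EFin \o (fun t => circle_weight e t *
    (f (circle_diff w t) + f (- circle_diff w t)))).
Proof.
move=> bf; apply: integrable_circle_weightM; apply: bounded_measurableD.
  exact: (bounded_measurable_comp bf (measurable_circle_diff w)).
exact: (bounded_measurable_comp bf (measurable_circle_diffN w)).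
Qed.

Lemma integrable_circle_gauss2 w e P Q (a : R * R) : 0 < P -> 0 < Q ->
  (leb2 R).-integrable setT (EFin \o (fun t => circle_weight e t *
    (gauss2 P Q a (circle_diff w t) + gauss2 P Q a (- circle_diff w t)))).
Proof. by move=> P0 Q0; apply: integrable_circle_sym; exact: bounded_measurable_gauss2. Qed.

(** With the masses in front, the factor next to the filter is the real or imaginary part of the
    transform of [gauss2 P Q a], according to [th]. After Fubini, the product of cosines becomes
    half a sum of two cosines, whose integrals against the Gaussian are Gaussians at plus and minus
    the frequency. The constant 2 pi^2 is (2 pi)^2 / 2, one factor 2 pi per coordinate by
    [sqrt_pi_mul]. *)
Lemma gfilter_gauss2 w j k (P Q : R) a th : 0 < P -> 0 < Q ->
  let p := (4 * P)^-1 in let q := (4 * Q)^-1 in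
  (leb2 R).-integrable setT (EFin \o (fun y => gfilter w j k y * (gauss2 p q (0, 0) y * cos (dot a y + th)))) /\
  Num.sqrt (pi / P) * Num.sqrt (pi / Q) *
    \int[leb2 R]_y (gfilter w j k y * (gauss2 p q (0, 0) y * cos (dot a y + th))) =
  2 * pi ^+ 2 * cos th * filter_coef w j k *
    \int[leb2 R]_t (circle_weight (filter_exp j k) t *
       (gauss2 P Q a (circle_diff w t) + gauss2 P Q a (- circle_diff w t))).
Proof.
move=> P0 Q0 p q.
have p0 : 0 < p by rewrite invr_gt0 mulr_gt0.
have q0 : 0 < q by rewrite invr_gt0 mulr_gt0.
set e := filter_exp j k.
have int := @integrable_circle_gauss w e p q a th p0 q0.
have E y : gfilter w j k y * (gauss2 p q (0, 0) y * cos (dot a y + th)) =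
    filter_coef w j k * \int[leb2 R]_t (circle_weight e t * cos (dot (circle_diff w t) y) *
     (gauss2 p q (0, 0) y * cos (dot a y + th))).
  by rewrite RintegralZr// ?gfilterE ?mulrA//; exact: integrable_circle_cos.
have intF := integrable_RintegralF int.
split.
  by rewrite (funext E); apply: integrableZR.
under eq_Rintegral do rewrite E.
rewrite RintegralZl//.
rewrite -(Rfubini1 int) (Rfubini2 int).
pose I := \int[leb2 R]_t (circle_weight e t *
  (gauss2 P Q a (circle_diff w t) + gauss2 P Q a (- circle_diff w t))).
have -> : \int[leb2 R]_t \int[leb2 R]_y (circle_weight e t * cos (dot (circle_diff w t) y) *
     (gauss2 p q (0, 0) y * cos (dot a y + th))) =
   \int[leb2 R]_t (2^-1 * (Num.sqrt (pi / p) * Num.sqrt (pi / q) * cos th) *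
     (circle_weight e t * (gauss2 P Q a (circle_diff w t) + gauss2 P Q a (- circle_diff w t)))).
  apply: eq_Rintegral => t _.
  transitivity (\int[leb2 R]_y (circle_weight e t * 2^-1 *
      (gauss2 p q (0, 0) y * cos (dot (circle_diff w t + a) y + th) +
       gauss2 p q (0, 0) y * cos (dot (a - circle_diff w t) y + th)))).
    apply: eq_Rintegral => y _.
    transitivity (circle_weight e t * gauss2 p q (0, 0) y *
      (cos (dot (circle_diff w t) y) * cos (dot a y + th))); first by ring.
    rewrite mulr_cos_cos.
    rewrite (_ : dot (circle_diff w t) y + _ = dot (circle_diff w t + a) y + th); last first.
      by rewrite /dot /=; ring.
    rewrite (_ : dot a y + th - _ = dot (a - circle_diff w t) y + th); last first.
      by rewrite /dot /=; ring.
    ring.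
  rewrite RintegralZl//; last by apply: integrableDR; exact: integrable_gauss2_cos.
  rewrite RintegralD//; [|exact: integrable_gauss2_cos..].
  rewrite !Rintegral_gauss2_cos//.
  have d0 b : dot b (0, 0) = 0 :> R by rewrite /dot /= !mulr0 addr0.
  have e4 (z : R) : (4 * (4 * z)^-1)^-1 = z.
    by have [->|z0] := eqVneq z 0; [rewrite mulr0 invr0 mulr0 invr0|field].
  rewrite !d0 !add0r !e4 gauss2C gauss2NC; ring.
rewrite RintegralZl//; last exact: integrable_circle_gauss2.
have hP := sqrt_pi_mul P0; have hQ := sqrt_pi_mul Q0.
rewrite -/p -/q in hP hQ *; rewrite -/I.
transitivity ((Num.sqrt (pi / P) * Num.sqrt (pi / p)) * (Num.sqrt (pi / Q) * Num.sqrt (pi / q)) *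
   2^-1 * cos th * filter_coef w j k * I); first by ring.
by rewrite hP hQ; field.
Qed.

End circle.

(** * The Fourier transform of the filters *)

Section fourier_gauss2.
Context {R : realType}.
Local Open Scope complex_scope.
Implicit Types (a y : R * R).

Lemma dotC a y : dot a y = dot y a.
Proof. by rewrite /dot mulrC [X in _ + X]mulrC. Qed.

Lemma dot0 y : dot (0, 0) y = 0 :> R.
Proof. by rewrite /dot !mul0r addr0. Qed.

Lemma complex_Re_mulr (z : R[i]) (r : R) : complex.Re (z * r%:C) = complex.Re z * r.
Proof. by case: z => x y /=; rewrite mulr0 subr0. Qed.

Lemma complex_Im_mulr (z : R[i]) (r : R) : complex.Im (z * r%:C) = complex.Im z * r.
Proof. by case: z => x y /=; rewrite mulr0 add0r. Qed.

Lemma complex_Re_mull (z : R[i]) (r : R) : complex.Re (r%:C * z) = r * complex.Re z.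
Proof. by case: z => x y /=; rewrite mul0r subr0. Qed.

Lemma complex_Im_mull (z : R[i]) (r : R) : complex.Im (r%:C * z) = r * complex.Im z.
Proof. by case: z => x y /=; rewrite mul0r addr0. Qed.

Lemma complex_ReD (z t : R[i]) : complex.Re (z + t) = complex.Re z + complex.Re t.
Proof. by case: z; case: t. Qed.

Lemma complex_ImD (z t : R[i]) : complex.Im (z + t) = complex.Im z + complex.Im t.
Proof. by case: z; case: t. Qed.

Lemma Re_cint (f : R * R -> R[i]) : complex.Re (cint f) = \int[leb2 R]_x complex.Re (f x).
Proof. by []. Qed.

Lemma Im_cint (f : R * R -> R[i]) : complex.Im (cint f) = \int[leb2 R]_x complex.Im (f x).
Proof. by []. Qed.

Definition gauss2_mass (P Q : R) : R := Num.sqrt (pi / P) * Num.sqrt (pi / Q).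

(** The imaginary part, minus a sine, is written as a cosine with phase pi / 2, so that both parts
    are instances of one real formula. *)
Lemma fourier_gauss2 P Q a y : 0 < P -> 0 < Q ->
  let G := gauss2_mass P Q * gauss2 (4 * P)^-1 (4 * Q)^-1 (0, 0) y in
  complex.Re (fourier_fun (fun x => (gauss2 P Q a x)%:C) y) = G * cos (dot a y + 0) /\
  complex.Im (fourier_fun (fun x => (gauss2 P Q a x)%:C) y) = G * cos (dot a y + pi / 2).
Proof.
move=> P0 Q0 G; rewrite /fourier_fun /cint /=.
rewrite /G /gauss2_mass -!(dotC y) -!Rintegral_gauss2_cos//; split; apply: eq_Rintegral => x _.
  by rewrite cosN mul0r subr0 addr0.
by rewrite mul0r addr0 cosDpihalf sinN.
Qed.

Lemma fourier_gauss2_0 P Q a : 0 < P -> 0 < Q ->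
  complex.Re (fourier_fun (fun x => (gauss2 P Q a x)%:C) (0, 0)) = gauss2_mass P Q /\
  complex.Im (fourier_fun (fun x => (gauss2 P Q a x)%:C) (0, 0)) = 0.
Proof.
move=> P0 Q0; have [-> ->] := fourier_gauss2 a (0, 0) P0 Q0.
rewrite dotC dot0 !add0r cos0 cos_pihalf mulr0 /gauss2 /gauss/= !subrr.
by rewrite expr0n/= !mulr0 oppr0 expR0 !mulr1.
Qed.

Lemma gboldE (alpha : R) (w : 'I_2 -> R) (j k : 'I_2) :
  (gbold alpha w j k).1 = alpha * (j == k)%:R /\
  (gbold alpha w j k).2 = (fun y => \sum_(i < 2) gfilter (w i) j k y).
Proof.
rewrite /gbold summxE !big_ord_recl big_ord0.
have [->|->] := ord2P j; have [->|->] := ord2P k; rewrite !mxE /=; split.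
all: try (apply/funext => y; rewrite !big_ord_recl big_ord0 /= ?addr0 //).
all: rewrite ?mulr0 ?mulr1 ?addr0 ?add0r //=; lra.
Qed.

End fourier_gauss2.

Section symbol.
Context {R : realType}.
Local Open Scope complex_scope.
Variables (alpha : R) (omega : 'I_2 -> R) (ghat : R * R -> 'M[R[i]]_2).
Hypothesis ghatP : forall j k,
  dist_is_fun (fourier (kernel_dist (gbold alpha omega j k))) (fun xi => ghat xi j k).
Implicit Types (P Q : R) (a : R * R) (j k : 'I_2).

Lemma integrable_Re_ghat j k P Q a : 0 < P -> 0 < Q ->
  (leb2 R).-integrable setT (EFin \o (fun xi => complex.Re (ghat xi j k) * gauss2 P Q a xi)).
Proof.
move=> P0 Q0; have [/(_ _ (schwartz_gauss2 a P0 Q0))[i _] _] := ghatP j k.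
rewrite (_ : EFin \o _ = (fun x => (complex.Re (ghat x j k * (gauss2 P Q a x)%:C))%:E))//.
by apply/funext => x; rewrite complex_Re_mulr.
Qed.

Lemma integrable_Im_ghat j k P Q a : 0 < P -> 0 < Q ->
  (leb2 R).-integrable setT (EFin \o (fun xi => complex.Im (ghat xi j k) * gauss2 P Q a xi)).
Proof.
move=> P0 Q0; have [/(_ _ (schwartz_gauss2 a P0 Q0))[_ i] _] := ghatP j k.
rewrite (_ : EFin \o _ = (fun x => (complex.Im (ghat x j k * (gauss2 P Q a x)%:C))%:E))//.
by apply/funext => x; rewrite complex_Im_mulr.
Qed.

(* Up to a constant factor, the pairing of f with the Fourier transform of a
   filter: cos (dot (circle_diff w t) y) transforms into Dirac masses at
   circle_diff w t and its opposite. *)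
Definition circle_pairing w (j k : 'I_2) (f : R * R -> R) : R :=
  \int[leb2 R]_t (circle_weight (filter_exp j k) t *
     (f (circle_diff w t) + f (- circle_diff w t))).

(** The Dirac part evaluates the transform of the Gaussian at 0, hence the mass. In the filter part
    the phase enters only through the factor cos th, which is 1 for the real part and 0 for the
    imaginary part. *)
Lemma Rintegral_ghat j k P Q a : 0 < P -> 0 < Q ->
  \int[leb2 R]_xi (complex.Re (ghat xi j k) * gauss2 P Q a xi) =
    alpha * (j == k)%:R * gauss2_mass P Q +
    \sum_(i < 2) 2 * pi ^+ 2 * filter_coef (omega i) j k * circle_pairing (omega i) j k (gauss2 P Q a) /\
  \int[leb2 R]_xi (complex.Im (ghat xi j k) * gauss2 P Q a xi) = 0.
Proof.
move=> P0 Q0; have [_ /(_ _ (schwartz_gauss2 a P0 Q0)) h] := ghatP j k.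
have [k1 k2] := gboldE alpha omega j k.
have [F1 F2] := fourier_gauss2_0 a P0 Q0.
pose S th := \sum_(i < 2) 2 * pi ^+ 2 * cos th * filter_coef (omega i) j k *
  circle_pairing (omega i) j k (gauss2 P Q a).
have part th : \int[leb2 R]_y ((\sum_(i < 2) gfilter (omega i) j k y) *
    (gauss2_mass P Q * gauss2 (4 * P)^-1 (4 * Q)^-1 (0, 0) y * cos (dot a y + th))) = S th.
  have ig i := (gfilter_gauss2 (omega i) j k a th P0 Q0).1.
  transitivity (gauss2_mass P Q * \int[leb2 R]_y (\sum_(i < 2)
     (gfilter (omega i) j k y * (gauss2 (4 * P)^-1 (4 * Q)^-1 (0, 0) y * cos (dot a y + th))))).
    rewrite -RintegralZl//; last exact: integrable_sumR.
    by apply: eq_Rintegral => y _; rewrite -mulr_suml; ring.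
  rewrite Rintegral_sumR// mulr_sumr; apply: eq_bigr => i _.
  exact: (gfilter_gauss2 (omega i) j k a th P0 Q0).2.
have hR := congr1 (@complex.Re R) h; have hI := congr1 (@complex.Im R) h.
move: hR hI; rewrite /fourier /kernel_dist k1 k2 complex_ReD complex_ImD.
rewrite complex_Re_mull complex_Im_mull F1 F2 /fun_dist !Re_cint !Im_cint.
have e1 : \int[leb2 R]_y complex.Re ((\sum_(i < 2) gfilter (omega i) j k y)%:C *
    fourier_fun (fun x => (gauss2 P Q a x)%:C) y) = S 0.
  rewrite -part; apply: eq_Rintegral => y _.
  by rewrite complex_Re_mull (fourier_gauss2 _ _ P0 Q0).1.
have e2 : \int[leb2 R]_y complex.Im ((\sum_(i < 2) gfilter (omega i) j k y)%:C *
    fourier_fun (fun x => (gauss2 P Q a x)%:C) y) = S (pi / 2).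
  rewrite -part; apply: eq_Rintegral => y _.
  by rewrite complex_Im_mull (fourier_gauss2 _ _ P0 Q0).2.
rewrite e1 e2 => hR hI; split.
  transitivity (\int[leb2 R]_xi complex.Re (ghat xi j k * (gauss2 P Q a xi)%:C)).
    by apply: eq_Rintegral => x _; rewrite complex_Re_mulr.
  by rewrite -hR; congr (_ + _); apply: eq_bigr => i _; rewrite cos0 mulr1.
transitivity (\int[leb2 R]_xi complex.Im (ghat xi j k * (gauss2 P Q a xi)%:C)).
  by apply: eq_Rintegral => x _; rewrite complex_Im_mulr.
rewrite -hI mulr0 add0r /S big1// => i _.
by rewrite cos_pihalf mulr0 !mul0r.
Qed.

End symbol.

Section symbol_indicator.
Context {R : realType}.
Local Open Scope complex_scope.
Variables (alpha : R) (omega : 'I_2 -> R) (ghat : R * R -> 'M[R[i]]_2).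
Hypothesis ghatP : forall j k,
  dist_is_fun (fourier (kernel_dist (gbold alpha omega j k))) (fun xi => ghat xi j k).
Implicit Types (P Q : R) (a : R * R) (j k : 'I_2).

(** A fixed positive weight: the entries of [ghat] are only known to be integrable after
    multiplication by a Schwartz function. *)
Local Notation gamma := (gauss2 1 1 (0 : R, 0 : R)).

(** Completing the square. Thanks to the weight, the new parameter 1 + n p is positive for n = 0 as
    well. *)
Lemma gauss_mulX (p a x : R) n : 0 < p -> gauss 1 0 x * gauss p a x ^+ n =
  expR (- (n%:R * p * a ^+ 2 / (1 + n%:R * p))) * gauss (1 + n%:R * p) (n%:R * p * a / (1 + n%:R * p)) x.
Proof.
move=> p0; rewrite /gauss -expRM_natl -!expRD; congr expR.
have h : 1 + n%:R * p != 0 by rewrite gt_eqF// ltr_wpDr// mulr_ge0// ltW.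
by rewrite mul1r subr0; field.
Qed.

Lemma gauss2_mulX (p q : R) a n m : 0 < p -> 0 < q -> exists P Q b c,
  [/\ 0 < P, 0 < Q & forall x, gamma x * (gauss p a.1 x.1 ^+ n * gauss q a.2 x.2 ^+ m) = c * gauss2 P Q b x].
Proof.
move=> p0 q0.
exists (1 + n%:R * p), (1 + m%:R * q),
  (n%:R * p * a.1 / (1 + n%:R * p), m%:R * q * a.2 / (1 + m%:R * q)),
  (expR (- (n%:R * p * a.1 ^+ 2 / (1 + n%:R * p))) * expR (- (m%:R * q * a.2 ^+ 2 / (1 + m%:R * q)))).
have h (i : nat) (r : R) : 0 < r -> 0 < 1 + i%:R * r.
  by move=> r0; rewrite ltr_wpDr// mulr_ge0// ltW.
split; [exact: h|exact: h|move=> x].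
rewrite /gauss2 /= (mulrACA (gauss 1 0 x.1)) (gauss_mulX a.1 x.1 n p0).
by rewrite (gauss_mulX a.2 x.2 m q0) (mulrACA (expR _)).
Qed.

(** The real part of an entry of F g - alpha I, as alpha delta transforms into the constant
    alpha. *)
Definition symbol_part j k (xi : R * R) : R := complex.Re (ghat xi j k) - alpha * (j == k)%:R.

Lemma integrable_symbol_part j k P Q a : 0 < P -> 0 < Q ->
  (leb2 R).-integrable setT (EFin \o (fun xi => symbol_part j k xi * gauss2 P Q a xi)).
Proof.
move=> P0 Q0.
rewrite (_ : (fun xi => _) = (fun xi => complex.Re (ghat xi j k) * gauss2 P Q a xi +
   (- (alpha * (j == k)%:R)) * gauss2 P Q a xi)).
  apply: integrableDR; first exact: (integrable_Re_ghat ghatP).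
  by apply: integrableZR; exact: integrable_gauss2.
by apply/funext => x; rewrite mulrDl.
Qed.

Lemma Rintegral_symbol_part j k P Q a : 0 < P -> 0 < Q ->
  \int[leb2 R]_xi (symbol_part j k xi * gauss2 P Q a xi) =
    \sum_(i < 2) 2 * pi ^+ 2 * filter_coef (omega i) j k * circle_pairing (omega i) j k (gauss2 P Q a).
Proof.
move=> P0 Q0.
transitivity (\int[leb2 R]_xi (complex.Re (ghat xi j k) * gauss2 P Q a xi +
   (- (alpha * (j == k)%:R)) * gauss2 P Q a xi)).
  by apply: eq_Rintegral => x _; rewrite mulrDl.
have ig := integrable_gauss2 a P0 Q0.
rewrite RintegralD//; [|exact: (integrable_Re_ghat ghatP)|exact: integrableZR].
rewrite RintegralZl// Rintegral_gauss2//.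
rewrite (Rintegral_ghat ghatP j k a P0 Q0).1 /gauss2_mass; ring.
Qed.

Lemma circle_pairingE w j k (f : R * R -> R) : bounded_measurable f ->
  circle_pairing w j k f =
  \int[leb2 R]_t (circle_weight (filter_exp j k) t * f (circle_diff w t)) +
  \int[leb2 R]_t (circle_weight (filter_exp j k) t * f (- circle_diff w t)).
Proof.
move=> bf; rewrite -RintegralD//.
- by apply: eq_Rintegral => t _; rewrite mulrDr.
- by apply: integrable_circle_weightM; exact: (bounded_measurable_comp bf (measurable_circle_diff w)).
- by apply: integrable_circle_weightM; exact: (bounded_measurable_comp bf (measurable_circle_diffN w)).
Qed.

(** Both sides, as functionals of the function in place of the indicator, are integrals against
    finite signed measures. Their difference L vanishes on products of powers of Gaussians, because
    the weight turns these into multiples of a single Gaussian, to which [Rintegral_symbol_part]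
    applies. *)
Lemma symbol_part_indic j k A : measurable A ->
  \int[leb2 R]_xi (symbol_part j k xi * gamma xi * \1_A xi) =
    \sum_(i < 2) 2 * pi ^+ 2 * filter_coef (omega i) j k *
      circle_pairing (omega i) j k (fun x => gamma x * \1_A x).
Proof.
move=> mA.
have bgamma : bounded_measurable gamma by exact: bounded_measurable_gauss2.
pose e := filter_exp j k.
pose c i := - (2 * pi ^+ 2 * filter_coef (omega i) j k).
pose L0 (f : R * R -> R) := \int[leb2 R]_xi (symbol_part j k xi * gamma xi * f xi).
pose La i (f : R * R -> R) := \int[leb2 R]_t (circle_weight e t * gamma (circle_diff (omega i) t) *
   f (circle_diff (omega i) t)).
pose Lb i (f : R * R -> R) := \int[leb2 R]_t (circle_weight e t * gamma (- circle_diff (omega i) t) *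
   f (- circle_diff (omega i) t)).
pose L f := (L0 f + c 0 * (La 0 f + 1 * Lb 0 f)) + c 1 * (La 1 f + 1 * Lb 1 f).
have bL : bounded_continuous L.
  have b0 : bounded_continuous L0.
    have i0 := @integrable_symbol_part j k 1 1 (0, 0) ltr01 ltr01.
    exact: (bounded_continuous_integral i0 (@measurable_id _ _ setT)).
  have ba i : bounded_continuous (La i).
    apply: bounded_continuous_integral; last exact: measurable_circle_diff.
    apply: integrable_circle_weightM; exact: (bounded_measurable_comp bgamma (measurable_circle_diff _)).
  have bb i : bounded_continuous (Lb i).
    apply: bounded_continuous_integral; last exact: measurable_circle_diffN.
    apply: integrable_circle_weightM; exact: (bounded_measurable_comp bgamma (measurable_circle_diffN _)).
  by do 2 (apply: bounded_continuous_comb; last exact: bounded_continuous_comb).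
have LE f : bounded_measurable f -> L f = L0 f -
    \sum_(i < 2) 2 * pi ^+ 2 * filter_coef (omega i) j k * circle_pairing (omega i) j k (fun x => gamma x * f x).
  move=> bf.
  have E i : circle_pairing (omega i) j k (fun x => gamma x * f x) = La i f + Lb i f.
    rewrite circle_pairingE; last exact: bounded_measurableM.
    by congr (_ + _); apply: eq_Rintegral => t _; rewrite mulrA.
  rewrite !big_ord_recl big_ord0 !E /L /c.
  rewrite (_ : lift ord0 ord0 = 1); last exact/val_inj.
  ring.
suff H : L (\1_A) = 0.
  have bA : bounded_measurable (\1_A : R * R -> R) by exact: bounded_measurable_indic.
  by move: (LE _ bA); rewrite H => /esym/eqP; rewrite subr_eq0 => /eqP.
apply: gauss_determining => // n m p q a p0 q0.
have [P [Q [b [C [P0 Q0 E]]]]] := gauss2_mulX a n m p0 q0.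
rewrite LE; last first.
  apply: bounded_measurableM; apply: bounded_measurableX; split.
  - exact: (measurableT_comp (measurable_gauss p a.1) measurable_fst).
  - by exists 1 => x; rewrite gtr0_norm ?gauss_gt0 ?gauss_le1 ?ltW.
  - exact: (measurableT_comp (measurable_gauss q a.2) measurable_snd).
  - by exists 1 => x; rewrite gtr0_norm ?gauss_gt0 ?gauss_le1 ?ltW.
have EE : (fun x : R * R => gamma x * (gauss p a.1 x.1 ^+ n * gauss q a.2 x.2 ^+ m)) =
    (fun x => C * gauss2 P Q b x) by apply/funext => x; exact: E.
rewrite EE.
have -> : L0 (fun x => gauss p a.1 x.1 ^+ n * gauss q a.2 x.2 ^+ m) =
    C * \int[leb2 R]_xi (symbol_part j k xi * gauss2 P Q b xi).
  rewrite -RintegralZl//; last exact: integrable_symbol_part.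
  by apply: eq_Rintegral => x _; rewrite -mulrA E mulrCA.
rewrite Rintegral_symbol_part// mulr_sumr -sumrB big1// => i _.
rewrite (_ : circle_pairing _ _ _ (fun x => C * _) = C * circle_pairing (omega i) j k (gauss2 P Q b)).
  ring.
rewrite /circle_pairing -RintegralZl//; last exact: integrable_circle_gauss2.
by apply: eq_Rintegral => t _; ring.
Qed.

Lemma Im_symbol_indic j k A : measurable A ->
  \int[leb2 R]_xi (complex.Im (ghat xi j k) * gamma xi * \1_A xi) = 0.
Proof.
move=> mA.
pose L (f : R * R -> R) := \int[leb2 R]_xi (complex.Im (ghat xi j k) * gamma xi * f xi).
apply: (gauss_determining (L := L)) => //.
  have i0 := @integrable_Im_ghat _ _ _ _ ghatP j k 1 1 (0, 0) ltr01 ltr01.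
  exact: (bounded_continuous_integral i0 (@measurable_id _ _ setT)).
move=> n m p q a p0 q0.
have [P [Q [b [C [P0 Q0 E]]]]] := gauss2_mulX a n m p0 q0.
transitivity (C * \int[leb2 R]_xi (complex.Im (ghat xi j k) * gauss2 P Q b xi)).
  rewrite -RintegralZl//; last exact: (integrable_Im_ghat ghatP).
  by apply: eq_Rintegral => x _; rewrite -mulrA E mulrCA.
by rewrite (Rintegral_ghat ghatP j k b P0 Q0).2 mulr0.
Qed.

End symbol_indicator.

(** * Sign, symmetry and support of the symbol almost everywhere *)

Section quadratic_form.
Context {R : realFieldType}.

Lemma quadratic_form_psd (a b c : R) :
  (forall u, 0 <= u ^+ 2 * a + 2 * u * b + c) -> [/\ 0 <= a, 0 <= c & b ^+ 2 <= a * c].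
Proof.
move=> h.
have c0 : 0 <= c by have := h 0; rewrite expr0n/= mulr0 !mul0r !add0r.
have a0 : 0 <= a.
  rewrite leNgt; apply/negP => a0.
  have na : 0 < - a by rewrite oppr_gt0.
  (* Adding the hypothesis at u and at - u gives - a u^2 <= c. As u >= 1, also - a u^2 >= - a u = -
     a + c > c, a contradiction. *)
  pose u := 1 + c / - a.
  have u1 : 1 <= u by rewrite lerDl divr_ge0// ltW.
  have cu : - a * u = - a + c by rewrite mulrDr mulr1 mulrCA mulfV ?gt_eqF// mulr1.
  have uu : - a * u <= - a * u ^+ 2.
    by rewrite ler_wpM2l ?(ltW na)// expr2 ler_peMl// (le_trans ler01).
  have := h u; have := h (- u); rewrite sqrrN => h1 h2.
  lra.
split=> //.
have [a00|a00] := eqVneq a 0.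
  rewrite a00 mul0r; have [->|b0] := eqVneq b 0; first by rewrite expr0n.
  (* For a = 0 the form is affine in u, and here it takes the value -1. *)
  have := h (- (c + 1) / (2 * b)); rewrite a00 mulr0 add0r.
  rewrite (_ : 2 * _ * b = - (c + 1)); last by field.
  by rewrite opprD addrAC addNr add0r oppr_ge0 ler10.
have ap : 0 < a by rewrite lt_neqAle eq_sym a00.
have := h (- b / a); rewrite (_ : _ + c = (a * c - b ^+ 2) / a); last by field.
by rewrite pmulr_lge0 ?invr_gt0// subr_ge0.
Qed.

End quadratic_form.

Section quadratic_form_rat.
Context {R : realType}.

(** This lets the exceptional null set be chosen independently of u. A negative value at u persists
    on a short interval to the right of u, which contains a rational; K bounds the difference
    quotients within distance 1. *)
Lemma quadratic_form_rat (a b c : R) :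
  (forall u : rat, 0 <= (ratr u) ^+ 2 * a + 2 * ratr u * b + c) ->
  forall u : R, 0 <= u ^+ 2 * a + 2 * u * b + c.
Proof.
move=> h u; rewrite leNgt; apply/negP.
set e := _ + c => e0.
pose K := `|a| * (2 * `|u| + 1) + 2 * `|b| + 1.
have K0 : 0 < K by rewrite ltr_wpDl// addr_ge0// ?mulr_ge0// addr_ge0// mulr_ge0.
pose d := Order.min 1 (- e / K).
have d0 : 0 < d by rewrite lt_min ltr01 divr_gt0// oppr_gt0.
have [r] := @rat_in_itvoo R u (u + d) (ltr_pwDr d0 (lexx u)).
rewrite in_itv/= => /andP[ur rd].
have := h r; rewrite leNgt => /negP; apply.
set v := ratr r in ur rd *.
have -> : v ^+ 2 * a + 2 * v * b + c = e + (v - u) * ((v + u) * a + 2 * b) by rewrite /e; ring.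
have vu : 0 < v - u < d by rewrite subr_gt0 ur ltrBlDl.
case/andP: vu => vu0 vud.
have le1 : (v + u) * a + 2 * b <= K.
  rewrite (le_trans (ler_norm _))// (le_trans (ler_normD _ _))// /K -addrA lerD//.
    rewrite normrM mulrC ler_wpM2l//.
    have d1 : d <= 1 by rewrite ge_min lexx.
    rewrite (_ : v + u = (v - u) + 2 * u); last by ring.
    rewrite (le_trans (ler_normD _ _))// addrC lerD ?normrM ?normr_nat//.
    by rewrite gtr0_norm// ltW// (lt_le_trans vud).
  by rewrite normrM normr_nat lerDl.
have h2 : (v - u) * ((v + u) * a + 2 * b) <= (v - u) * K by rewrite ler_wpM2l// ltW.
have h3 : (v - u) * K < - e.
  by rewrite -ltr_pdivlMr// (lt_le_trans vud)// ge_min lexx orbT.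
by rewrite addrC -ltrBrDr sub0r (le_lt_trans h2).
Qed.

End quadratic_form_rat.

Section ae_symbol.
Context {R : realType}.
Local Open Scope complex_scope.
Variables (alpha : R) (omega : 'I_2 -> R) (ghat : R * R -> 'M[R[i]]_2).
Hypothesis ghatP : forall j k,
  dist_is_fun (fourier (kernel_dist (gbold alpha omega j k))) (fun xi => ghat xi j k).
Hypothesis homega : 0 < omega 0 < omega 1.
Implicit Types (P Q : R) (a : R * R) (j k : 'I_2).

Local Notation gamma := (gauss2 1 1 (0 : R, 0 : R)).
Local Notation sym := (symbol_part alpha ghat).

Lemma integrable_gammaM (h f : R * R -> R) :
  (leb2 R).-integrable setT (EFin \o (fun xi => h xi * f xi)) -> forall A, measurable A ->
  (leb2 R).-integrable setT (EFin \o (fun xi => h xi * f xi * \1_A xi)).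
Proof.
move=> i A mA; under [X in EFin \o X]eq_fun do rewrite mulrC.
by apply: (@integrableMb _ _ _ (leb2 R) (\1_A) _ 1) => // x; exact: norm_indic_le1.
Qed.

Lemma bounded_gamma_indic A : measurable A -> bounded_measurable (fun x => gamma x * \1_A x).
Proof.
move=> mA; apply: bounded_measurableM; first exact: bounded_measurable_gauss2.
exact: bounded_measurable_indic.
Qed.

(* The weights of the four filters combine into (u (x . z) - 1)^2. *)
Lemma symbol_form_indic (u : R) A : measurable A ->
  0 <= \int[leb2 R]_xi ((u ^+ 2 * sym 0 0 xi + 2 * u * sym 0 1 xi + sym 1 1 xi) * gamma xi * \1_A xi).
Proof.
move=> mA.
have i j k : (leb2 R).-integrable setT (EFin \o (fun xi => sym j k xi * gamma xi * \1_A xi)).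
  by apply: integrable_gammaM => //; exact: (integrable_symbol_part ghatP).
rewrite (_ : \int[_]_xi _ = \int[leb2 R]_xi (u ^+ 2 * (sym 0 0 xi * gamma xi * \1_A xi) +
   2 * u * (sym 0 1 xi * gamma xi * \1_A xi) + sym 1 1 xi * gamma xi * \1_A xi)); last first.
  by apply: eq_Rintegral => x _; ring.
have i2 c j k := integrableZR c (i j k).
rewrite RintegralD//; last exact: integrableDR.
rewrite RintegralD// !RintegralZl// !(symbol_part_indic ghatP)//.
rewrite !mulr_sumr -!big_split/= sumr_ge0// => l _.
set f := fun x => gamma x * \1_A x.
have bf : bounded_measurable f by exact: bounded_gamma_indic.
have f0 x : 0 <= f x.
  by apply: mulr_ge0; [rewrite ltW// gauss2_gt0|case/andP: (indic_ge0_le1 R A x)].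
have ic e := integrable_circle_sym (omega l) e bf.
rewrite (_ : _ + _ = 2 * pi ^+ 2 * norm_c (omega l) ^+ 2 *
   \int[leb2 R]_t (u ^+ 2 * (circle_weight 2 t * (f (circle_diff (omega l) t) + f (- circle_diff (omega l) t))) +
     - (2 * u) * (circle_weight 1 t * (f (circle_diff (omega l) t) + f (- circle_diff (omega l) t))) +
     circle_weight 0 t * (f (circle_diff (omega l) t) + f (- circle_diff (omega l) t)))); last first.
  have ic2 c e := integrableZR c (ic e).
  rewrite RintegralD//; last exact: integrableDR.
  rewrite RintegralD// !RintegralZl// /circle_pairing /filter_coef /filter_exp /=.
  rewrite (_ : (4 - 1 - 1 = 2)%N)// (_ : (4 - 1 - 2 = 1)%N)// (_ : (4 - 2 - 2 = 0)%N)//.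
  rewrite (_ : (1 + 1 = 2)%N)// (_ : (1 + 2 = 3)%N)// (_ : (2 + 2 = 4)%N)//; ring.
apply: mulr_ge0; first by apply: mulr_ge0; [apply: mulr_ge0|]; rewrite ?sqr_ge0.
apply: Rintegral_ge0 => t _.
rewrite (_ : _ + _ = \1_torus t * (u * circle_dot t - 1) ^+ 2 *
   (f (circle_diff (omega l) t) + f (- circle_diff (omega l) t))); last first.
  by rewrite /circle_weight; ring.
apply: mulr_ge0; last by rewrite addr_ge0.
by apply: mulr_ge0; [case/andP: (indic_ge0_le1 R torus t)|exact: sqr_ge0].
Qed.

Lemma ae_eq0 (f : R * R -> R) : (leb2 R).-integrable setT (EFin \o f) ->
  (forall A, measurable A -> \int[leb2 R]_x (f x * \1_A x) = 0) ->
  {ae leb2 R, forall x, f x = 0}.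
Proof.
move=> i h.
have h1 : {ae leb2 R, forall x, 0 <= f x} by apply: ae_ge0 => // A mA; rewrite h.
have h2 : {ae leb2 R, forall x, 0 <= -1 * f x}.
  apply: ae_ge0 => [|A mA]; first exact: integrableZR.
  rewrite (_ : \int[_]_x _ = \int[leb2 R]_x (-1 * (f x * \1_A x))).
    rewrite RintegralZl ?h ?mulr0//.
    under [X in EFin \o X]eq_fun do rewrite mulrC.
    by apply: (@integrableMb _ _ _ (leb2 R) (\1_A) _ 1) => // x; exact: norm_indic_le1.
  by apply: eq_Rintegral => x _; rewrite mulrA.
move: h1 h2; apply: aeS2 => x h1 h2; apply/eqP.
by rewrite eq_le h1 andbT -oppr_ge0 -mulN1r.
Qed.

Lemma ae_symbol_form : {ae leb2 R, forall xi, forall u : R,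
  0 <= u ^+ 2 * sym 0 0 xi + 2 * u * sym 0 1 xi + sym 1 1 xi}.
Proof.
have h (u : R) : {ae leb2 R, forall xi, 0 <= u ^+ 2 * sym 0 0 xi + 2 * u * sym 0 1 xi + sym 1 1 xi}.
  have : {ae leb2 R, forall xi, 0 <= (u ^+ 2 * sym 0 0 xi + 2 * u * sym 0 1 xi + sym 1 1 xi) * gamma xi}.
    apply: ae_ge0 => [|A mA]; last exact: symbol_form_indic.
    have i j k : (leb2 R).-integrable setT (EFin \o (fun xi => sym j k xi * gamma xi)).
      exact: (integrable_symbol_part ghatP).
    rewrite (_ : (fun x => _) = (fun xi => u ^+ 2 * (sym 0 0 xi * gamma xi) +
      2 * u * (sym 0 1 xi * gamma xi) + sym 1 1 xi * gamma xi)).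
      by apply: integrableDR => //; apply: integrableDR; exact: integrableZR.
    by apply/funext => x; ring.
  apply: aeS => xi; rewrite pmulr_lge0//; exact: gauss2_gt0.
(* The null sets are united along an enumeration of the rationals; a number that codes no rational
   merely repeats the instance u = 0. *)
have : {ae leb2 R, forall xi, forall n : nat,
    let u := ratr (odflt 0 (unpickle n : option rat)) in
    0 <= u ^+ 2 * sym 0 0 xi + 2 * u * sym 0 1 xi + sym 1 1 xi}.
  by apply: ae_foralln => n; exact: h.
apply: aeS => xi H; apply: quadratic_form_rat => u.
by have := H (pickle u); rewrite pickleK.
Qed.

(** The two entries of [ghat] are chosen independently of each other, but both pairings depend only
    on the sum of the indices. *)
Lemma ae_symbol_sym : {ae leb2 R, forall xi, sym 0 1 xi = sym 1 0 xi}.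
Proof.
have i j k : (leb2 R).-integrable setT (EFin \o (fun xi => sym j k xi * gamma xi)).
  exact: (integrable_symbol_part ghatP).
have : {ae leb2 R, forall xi, sym 0 1 xi * gamma xi + -1 * (sym 1 0 xi * gamma xi) = 0}.
  apply: ae_eq0 => [|A mA]; first by apply: integrableDR => //; exact: integrableZR.
  rewrite (_ : \int[_]_x _ = \int[leb2 R]_xi (sym 0 1 xi * gamma xi * \1_A xi +
     -1 * (sym 1 0 xi * gamma xi * \1_A xi))); last by apply: eq_Rintegral => x _; ring.
  have iA j k := integrable_gammaM (i j k) mA.
  rewrite RintegralD//; last exact: integrableZR.
  rewrite RintegralZl// !(symbol_part_indic ghatP)//.
  by rewrite /circle_pairing /filter_coef /filter_exp /= mulN1r subrr.
apply: aeS => xi; rewrite mulN1r => /eqP; rewrite subr_eq0 => /eqP.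
by apply: mulIf; rewrite gt_eqF// gauss2_gt0.
Qed.

Lemma ae_symbol_Im : {ae leb2 R, forall xi, forall j k, complex.Im (ghat xi j k) = 0}.
Proof.
have h j k : {ae leb2 R, forall xi, complex.Im (ghat xi j k) = 0}.
  have : {ae leb2 R, forall xi, complex.Im (ghat xi j k) * gamma xi = 0}.
    apply: ae_eq0 => [|A mA]; first exact: (integrable_Im_ghat ghatP).
    exact: (Im_symbol_indic ghatP).
  apply: aeS => xi /eqP; rewrite mulf_eq0 (gt_eqF (gauss2_gt0 _ _ _ _)) orbF.
  by move/eqP.
exact: ae_forall_ord2.
Qed.

(** Frequencies omega_i (x - z) with x, z on the circle lie in the disc of radius 2 omega_2; the
    square around it has an explicit area of (4 omega_2)^2. *)
Definition freq_box : set (R * R) := `[- (2 * omega 1), 2 * omega 1] `*` `[- (2 * omega 1), 2 * omega 1].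

Lemma circle_diff_freq_box i t : freq_box (circle_diff (omega i) t) /\ freq_box (- circle_diff (omega i) t).
Proof.
case/andP: homega => o0 o1.
have oi : 0 <= omega i <= omega 1.
  by have [->|->] := ord2P i; rewrite ?lexx ?andbT !ltW// (lt_trans o0).
case/andP: oi => oi0 oi1.
have [h1 h2] := circle_diff_le t oi0.
have h : 2 * omega i <= 2 * omega 1 by rewrite ler_pM2l.
by split; split; rewrite /= in_itv/= -ler_norml ?normrN (le_trans _ h).
Qed.

(** The circle pairing samples its argument only at frequencies and their opposites, all inside the
    box, so it vanishes on test sets outside. *)
Lemma ae_symbol_out : {ae leb2 R, forall xi, forall j k, ~ freq_box xi -> sym j k xi = 0}.
Proof.
have mB : measurable freq_box by apply: measurableX; exact: measurable_itv.
have h j k : {ae leb2 R, forall xi, ~ freq_box xi -> sym j k xi = 0}.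
  have : {ae leb2 R, forall xi, sym j k xi * gamma xi * \1_(~` freq_box) xi = 0}.
    apply: ae_eq0 => [|A mA].
      by apply: integrable_gammaM; [exact: (integrable_symbol_part ghatP)|exact: measurableC].
    rewrite (_ : \int[_]_x _ = \int[leb2 R]_xi (sym j k xi * gamma xi * \1_((~` freq_box) `&` A) xi)).
      rewrite (symbol_part_indic ghatP); last by apply: measurableI => //; exact: measurableC.
      rewrite big1// => i _; rewrite /circle_pairing.
      rewrite (_ : \int[_]_t _ = 0) ?mulr0// -[RHS](@Rintegral_set0 _ _ _ (leb2 R) (cst 0)).
      rewrite [RHS]Rintegral_indic; apply: eq_Rintegral => t _.
      have [h1 h2] := circle_diff_freq_box i t.
      by rewrite !indicE !memNset ?mulr0 ?addr0 ?mulr0// => -[].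
    by apply: eq_Rintegral => x _; rewrite indicI -mulrA.
  apply: aeS => xi + nB; rewrite indicE mem_set// mulr1 => /eqP.
  by rewrite mulf_eq0 (gt_eqF (gauss2_gt0 _ _ _ _)) orbF => /eqP.
exact: ae_forall_ord2.
Qed.

End ae_symbol.

(** * A supremum bound for the second kernel *)

Section plane_measurability.
Context {R : realType}.

(** The plane carries the product sigma-algebra; an open set is the countable union of the rational
    boxes that it contains. *)
Lemma open_measurable_plane (U : set (R * R)) : open U -> measurable U.
Proof.
move=> oU.
pose box (q : (rat * rat) * (rat * rat)) : set (R * R) :=
  `]ratr q.1.1, ratr q.1.2[ `*` `]ratr q.2.1, ratr q.2.2[.
pose F q := if `[< box q `<=` U >] then box q else set0.
rewrite (_ : U = \bigcup_q F q).
  apply: countable_bigcupT_measurable; first exact: countableP.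
  move=> q; rewrite /F; case: ifP => _ //.
  by apply: measurableX; exact: measurable_itv.
apply/seteqP; split => [[x y] Ux|x [q _]]; last first.
  by rewrite /F; case: asboolP => // h /h.
have /nbhs_ballP[e /= e0 eU] : nbhs (x, y) U by apply: open_nbhs_nbhs; split.
have I z : exists l u : rat, [/\ ratr l < z < ratr u, z - e < ratr l & ratr u < z + e].
  have [l] := @rat_in_itvoo R (z - e) z (ltac:(by rewrite ltrBlDr ltrDl)).
  have [u] := @rat_in_itvoo R z (z + e) (ltac:(by rewrite ltrDl)).
  rewrite !in_itv/= => /andP[zu uz] /andP[zl lz].
  by exists l, u; split => //; rewrite lz zu.
have [l1 [u1 [/andP[a1 a2] a3 a4]]] := I x.
have [l2 [u2 [/andP[b1 b2] b3 b4]]] := I y.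
exists ((l1, u1), (l2, u2)) => //; rewrite /F; case: asboolP => [_|[]].
  by split; rewrite /= in_itv/= ?a1 ?a2 ?b1 ?b2.
move=> [s t] [/=]; rewrite !in_itv/= => /andP[s1 s2] /andP[t1 t2]; apply: eU.
by split; rewrite /ball/= ltr_distlC; apply/andP; split; lra.
Qed.

Lemma continuous_measurable_plane (f : R * R -> R) : continuous f -> measurable_fun setT f.
Proof.
move=> /continuousP cf; apply: (measurability (@RGenOInfty.G R)).
  exact: RGenOInfty.measurableE.
move=> _ [_ [x ->] <-]; rewrite setTI; apply: open_measurable_plane; apply: cf.
exact: rray_open.
Qed.

(** Inversion is discontinuous at 0. It is the pointwise limit of the continuous functions x / (x^2
    + 1 / (n + 1)), and this limit also respects the convention that 0 has inverse 0. *)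
Lemma measurable_inv : measurable_fun setT (fun x : R => x^-1).
Proof.
have h n : 0 < (harmonic n : R) by exact: harmonic_gt0.
have p n (x : R) : x ^+ 2 + harmonic n != 0 by rewrite gt_eqF// ltr_wpDl ?sqr_ge0.
pose f (n : nat) (x : R) : R := x * (x ^+ 2 + harmonic n)^-1.
have mf n : measurable_fun setT (f n).
  apply: continuous_measurable_fun => x; apply: cvgM; first exact: cvg_id.
  apply: cvgV; first exact: p.
  by apply: cvgD; [exact: exprn_continuous|exact: cvg_cst].
have cf x : f n x @[n --> \oo] --> x^-1.
  have [->|x0] := eqVneq x 0.
    by rewrite /f; under eq_fun do rewrite mul0r; rewrite invr0; exact: cvg_cst.
  have -> : x^-1 = x * (x ^+ 2 + 0)^-1 by rewrite addr0; field.
  apply: cvgMr; apply: cvgV; first by rewrite addr0 expf_neq0.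
  by apply: cvgD; [exact: cvg_cst|exact: cvg_harmonic].
exact: (measurable_fun_cvg mf (fun x _ => cf x)).
Qed.

(** An approximate identity. Near a continuity is used; away from a, half of the exponent provides
    the small factor E, and the other half leaves a Gaussian of twice the mass. *)
Lemma gauss2_point_bound (f : R * R -> R) (a : R * R) (B : R) :
  continuous f -> (exists M, forall x, `|f x| <= M) ->
  (forall p, 0 < p -> `|\int[leb2 R]_x (f x * gauss2 p p a x)| <= B * gauss2_mass p p) ->
  `|f a| <= B.
Proof.
move=> cf [M0 HM0] H.
have mf := continuous_measurable_plane cf.
have [M M1 HM] : exists2 M, 0 <= M & forall x, `|f x| <= M.
  by exists M0 => //; exact: le_trans (HM0 a).
apply/ler_addgt0Pl => e2 e20.
have [e [e0 ->]] : exists e : R, 0 < e /\ e2 = e + e.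
  by exists (e2 / 2); split; [rewrite divr_gt0|exact: splitr].
have /cvgrPdist_le/(_ e e0)/nbhs_ballP[d /= d0 Hd] := cf a.
(* Chosen so that e (p / 2) d^2 exceeds 4 M; then 4 M E <= e by exp t >= 1 + t. *)
pose p := 8 * M / (e * d ^+ 2) + 1.
have p0 : 0 < p by rewrite ltr_wpDl// divr_ge0// mulr_ge0// ltW// exprn_gt0.
have p20 : 0 < p / 2 by rewrite divr_gt0.
pose E := expR (- (p / 2 * d ^+ 2)).
have ME : 4 * M * E <= e.
  rewrite /E expRN ler_pdivrMr ?expR_gt0//.
  have h : 4 * M <= e * (p / 2 * d ^+ 2).
    rewrite (_ : e * _ = 4 * M + e * d ^+ 2 / 2); last first.
      by rewrite /p; field; rewrite gt_eqF//= gt_eqF.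
    by rewrite lerDl divr_ge0// mulr_ge0// ltW// exprn_gt0.
  apply: (le_trans h); rewrite ler_wpM2l ?ltW//.
  by apply: lt_le_trans (expR_ge1Dx _); rewrite ltrDr.
have bound x : `|(f a - f x) * gauss2 p p a x| <=
    e * gauss2 p p a x + 2 * M * E * gauss2 (p / 2) (p / 2) a x.
  rewrite normrM [X in _ * X]gtr0_norm ?gauss2_gt0//.
  have [/= xa|nxa] := pselect (ball a d x).
    apply: (@le_trans _ _ (e * gauss2 p p a x)).
      by apply: ler_wpM2r; [rewrite ltW// gauss2_gt0|exact: Hd].
    by rewrite lerDl !mulr_ge0// ?ltW ?gauss2_gt0// ?expR_gt0.
  have h1 : `|f a - f x| <= 2 * M.
    by rewrite mulr_natl mulr2n (le_trans (ler_normB _ _))// lerD.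
  have h2 : gauss2 p p a x <= E * gauss2 (p / 2) (p / 2) a x.
    rewrite /gauss2 {1 2}(splitr p) !gaussD mulrACA; apply: ler_wpM2r.
      by rewrite ltW// gauss2_gt0.
    rewrite /gauss -expRD ler_expR /E -opprD lerN2 -mulrDr ler_pM2l//.
    have sq (u : R) : d <= `|u| -> d ^+ 2 <= u ^+ 2.
      by move=> du; rewrite -(real_normK (num_real u)) ler_pXn2r ?nnegrE// ltW.
    have [h|h] := leP d `|x.1 - a.1|.
      by rewrite (le_trans (sq _ h))// lerDl sqr_ge0.
    have [h'|h'] := leP d `|x.2 - a.2|.
      by rewrite (le_trans (sq _ h'))// lerDr sqr_ge0.
    by exfalso; apply: nxa; split; rewrite /ball/= distrC.
  apply: (@le_trans _ _ (2 * M * (E * gauss2 (p / 2) (p / 2) a x))).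
    by rewrite ler_pM// ltW// gauss2_gt0.
  by rewrite mulrA lerDr mulr_ge0 ?ltW ?gauss2_gt0.
have ig q : 0 < q -> (leb2 R).-integrable setT (EFin \o gauss2 q q a).
  by move=> q0; exact: integrable_gauss2.
have ifg : (leb2 R).-integrable setT (EFin \o (fun x => f x * gauss2 p p a x)).
  by apply: (@integrableMb _ _ _ (leb2 R) f _ M) => //; exact: ig.
have imaj : (leb2 R).-integrable setT (EFin \o (fun x => e * gauss2 p p a x +
    2 * M * E * gauss2 (p / 2) (p / 2) a x)).
  by apply: integrableDR; apply: integrableZR; exact: ig.
have idiff : (leb2 R).-integrable setT (EFin \o (fun x => (f a - f x) * gauss2 p p a x)).
  apply: (@le_integrableR _ _ _ (leb2 R) _ _ _ imaj bound).
  apply: measurable_funM; last exact: measurable_gauss2.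
  exact: measurable_funB.
have mass2 : gauss2_mass (p / 2) (p / 2) = 2 * gauss2_mass p p.
  rewrite /gauss2_mass -!expr2 !sqr_sqrtr ?divr_ge0 ?pi_ge0 ?ltW//.
  by field; rewrite gt_eqF.
have massp : 0 < gauss2_mass p p by rewrite mulr_gt0// sqrtr_gt0 divr_gt0// pi_gt0.
have main : `|f a * gauss2_mass p p - \int[leb2 R]_x (f x * gauss2 p p a x)| <=
    e * gauss2_mass p p + 2 * M * E * (2 * gauss2_mass p p).
  have -> : f a * gauss2_mass p p - \int[leb2 R]_x (f x * gauss2 p p a x) =
      \int[leb2 R]_x ((f a - f x) * gauss2 p p a x).
    rewrite /gauss2_mass -(Rintegral_gauss2 a p0 p0) -RintegralZl//; last exact: ig.
    rewrite -RintegralB//; last by apply: integrableZR; exact: ig.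
    by apply: eq_Rintegral => x _; rewrite mulrBl.
  rewrite -mass2 /gauss2_mass -(Rintegral_gauss2 a p0 p0) -(Rintegral_gauss2 a p20 p20).
  rewrite -!RintegralZl//; [|exact: ig..].
  rewrite -RintegralD//; [|by apply: integrableZR; exact: ig..].
  apply: (le_trans (le_normr_Rintegral _ _)) => //.
  apply: le_Rintegral => //; exact: integrable_norm.
rewrite -(ler_pM2r massp).
rewrite -[X in _ * X](gtr0_norm massp) -normrM.
rewrite -(subrK (\int[leb2 R]_x (f x * gauss2 p p a x)) (f a * _)).
rewrite (le_trans (ler_normD _ _))// mulrDl lerD//; last by rewrite H.
apply: (le_trans main); rewrite [leRHS]mulrDl lerD2l.
rewrite (_ : 2 * M * E * _ = 4 * M * E * gauss2_mass p p); last by ring.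
by rewrite ler_wpM2r// ltW.
Qed.

End plane_measurability.

Section complex_measurable.
Context d (T : measurableType d) (R : realType).
Local Open Scope complex_scope.
Implicit Types f g : T -> R[i].

Definition cmeasurable f := measurable_fun setT (fun x => complex.Re (f x)) /\
  measurable_fun setT (fun x => complex.Im (f x)).

Lemma complex_ReM (z t : R[i]) :
  complex.Re (z * t) = complex.Re z * complex.Re t - complex.Im z * complex.Im t.
Proof. by case: z; case: t. Qed.

Lemma complex_ImM (z t : R[i]) :
  complex.Im (z * t) = complex.Re z * complex.Im t + complex.Im z * complex.Re t.
Proof. by case: z; case: t. Qed.

Lemma complex_real (z : R[i]) : complex.Im z = 0 -> z = (complex.Re z)%:C.
Proof. by case: z => a b /= ->. Qed.

Lemma cmeasurableM f g : cmeasurable f -> cmeasurable g -> cmeasurable (fun x => f x * g x).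
Proof.
move=> [fr fi] [gr gi]; split.
  rewrite (funext (fun x => complex_ReM (f x) (g x))).
  by apply: measurable_funB; exact: measurable_funM.
rewrite (funext (fun x => complex_ImM (f x) (g x))).
by apply: measurable_funD; exact: measurable_funM.
Qed.

Lemma cmeasurableB f g : cmeasurable f -> cmeasurable g -> cmeasurable (fun x => f x - g x).
Proof.
move=> [fr fi] [gr gi]; split.
  rewrite (_ : (fun x => _) = (fun x => complex.Re (f x) - complex.Re (g x))).
    exact: measurable_funB.
  by apply/funext => x; case: (f x); case: (g x).
rewrite (_ : (fun x => _) = (fun x => complex.Im (f x) - complex.Im (g x))).
  exact: measurable_funB.
by apply/funext => x; case: (f x); case: (g x).
Qed.

Lemma cmeasurableV f : cmeasurable f -> cmeasurable (fun x => (f x)^-1).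
Proof.
move=> [fr fi].
pose N x := (complex.Re (f x) ^+ 2 + complex.Im (f x) ^+ 2)^-1.
have mN : measurable_fun setT N.
  apply: (measurableT_comp measurable_inv).
  by apply: measurable_funD; exact: measurable_funX.
split.
  rewrite (_ : (fun x => _) = (fun x => complex.Re (f x) * N x)); first exact: measurable_funM.
  by apply/funext => x; rewrite /N; case: (f x).
rewrite (_ : (fun x => _) = (fun x => (- complex.Im (f x)) * N x)).
  apply: measurable_funM => //; exact: (measurableT_comp (@oppr_measurable R setT) fi).
by apply/funext => x; rewrite /N; case: (f x) => u v /=; rewrite mulNr.
Qed.

End complex_measurable.

Lemma det_mx2 (K : comNzRingType) (M : 'M[K]_2) : \det M = M 0 0 * M 1 1 - M 0 1 * M 1 0.
Proof.
rewrite (expand_det_row M 0) !big_ord_recl big_ord0 addr0 /cofactor !det_mx11 !mxE /=.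
rewrite (_ : lift 0 0 = 1 :> 'I_2); last exact/val_inj.
rewrite (_ : lift 1 0 = 0 :> 'I_2); last exact/val_inj.
by rewrite addn0 expr0 expr1 mul1r mulN1r mulrN.
Qed.

Section inverse_symbol.
Context {R : realType}.
Local Open Scope complex_scope.
Variables (alpha : R) (omega : 'I_2 -> R) (ghat : R * R -> 'M[R[i]]_2).
Hypothesis ghatP : forall j k,
  dist_is_fun (fourier (kernel_dist (gbold alpha omega j k))) (fun xi => ghat xi j k).
Hypothesis homega : 0 < omega 0 < omega 1.
Hypothesis halpha : 0 < alpha.

Local Notation gamma := (gauss2 1 1 (0 : R, 0 : R)).
Local Notation sym := (symbol_part alpha ghat).

(** For S positive semidefinite, det (S + alpha I) = det S + alpha tr S + alpha^2, where the first
    two terms are nonnegative, and zero where S vanishes. *)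
Lemma ae_det_ghat : {ae leb2 R, forall xi, exists D : R,
  [/\ \det (ghat xi) = D%:C, alpha ^+ 2 <= D & ~ freq_box omega xi -> D = alpha ^+ 2]}.
Proof.
have h1 := aeS2 (fun _ a b => conj a b) (ae_symbol_form ghatP) (ae_symbol_sym ghatP).
have h2 := aeS2 (fun _ a b => conj a b) (ae_symbol_Im ghatP) (ae_symbol_out ghatP homega).
move: h1 h2; apply: aeS2 => xi [q s] [im out].
have [a0 c0 bac] := quadratic_form_psd q.
have E j k : ghat xi j k = (sym j k xi + alpha * (j == k)%:R)%:C.
  by rewrite /symbol_part subrK; exact/complex_real/im.
exists ((sym 0 0 xi + alpha) * (sym 1 1 xi + alpha) - sym 0 1 xi * sym 1 0 xi); split.
- by rewrite det_mx2 !E -!rmorphM -rmorphB !eqxx !mulr1 !mulr0 !addr0.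
- rewrite -s -expr2.
  have : 0 <= alpha * (sym 0 0 xi + sym 1 1 xi) by apply: mulr_ge0; [exact: ltW|exact: addr_ge0].
  move: bac; rewrite !expr2; lra.
- by move=> nB; rewrite !out// !add0r mulr0 subr0 expr2.
Qed.

(** Measurability is hidden in the integrability against a Gaussian, which is then divided out. *)
Lemma measurable_ghat j k : cmeasurable (fun xi => ghat xi j k).
Proof.
have mg : measurable_fun setT (fun xi => (gamma xi)^-1).
  exact: (measurableT_comp measurable_inv (measurable_gauss2 _ _ _)).
have m (f : R * R -> R) : measurable_fun setT (fun xi => f xi * gamma xi) -> measurable_fun setT f.
  move=> mf; rewrite (_ : f = (fun xi => f xi * gamma xi * (gamma xi)^-1)).
    exact: measurable_funM.
  by apply/funext => x; rewrite mulfK// gt_eqF// gauss2_gt0.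
split; apply: m; apply: (@integrable_measurableR _ _ _ (leb2 R)).
  exact: (integrable_Re_ghat ghatP).
exact: (integrable_Im_ghat ghatP).
Qed.

Lemma measurable_inv_det : cmeasurable (fun xi => (\det (ghat xi))^-1).
Proof.
apply: cmeasurableV; rewrite (funext (fun x => det_mx2 (ghat x))).
by apply: cmeasurableB; apply: cmeasurableM; exact: measurable_ghat.
Qed.

(* The truncations hold almost everywhere for free and make the bounds
   [0 <= inv_defect <= alpha^-2] hold at every point. *)
Definition inv_defect (xi : R * R) : R :=
  Order.min (Order.max (alpha ^- 2 - complex.Re (\det (ghat xi))^-1) 0)
    (alpha ^- 2 * \1_(freq_box omega) xi).

Lemma measurable_freq_box : measurable (freq_box omega).
Proof. by apply: measurableX; exact: measurable_itv. Qed.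

Lemma measurable_inv_defect : measurable_fun setT inv_defect.
Proof.
apply: measurable_minr.
  by apply: measurable_maxr => //; apply: measurable_funB => //; case: measurable_inv_det.
by apply: measurable_funM => //; exact: measurable_indic measurable_freq_box.
Qed.

Lemma inv_defect_bounds xi : 0 <= inv_defect xi <= alpha ^- 2 * \1_(freq_box omega) xi.
Proof.
have a0 : 0 <= alpha ^- 2 * \1_(freq_box omega) xi.
  apply: mulr_ge0; first by rewrite invr_ge0 exprn_ge0// ltW.
  by case/andP: (indic_ge0_le1 R (freq_box omega) xi).
by rewrite /inv_defect le_min le_max lexx orbT a0/= ge_min lexx orbT.
Qed.

Lemma ae_inv_det : {ae leb2 R, forall xi, (\det (ghat xi))^-1 = (alpha ^- 2 - inv_defect xi)%:C}.
Proof.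
apply: aeS ae_det_ghat => xi [D [E aD out]].
have D0 : 0 < D by rewrite (lt_le_trans _ aD)// exprn_gt0.
have ED : (\det (ghat xi))^-1 = (D^-1)%:C by rewrite E fmorphV.
rewrite /inv_defect ED /=; congr (_%:C).
have DV : D^-1 <= alpha ^- 2 by rewrite lef_pV2 ?posrE ?exprn_gt0.
rewrite max_l ?subr_ge0// indicE.
have [B|nB] := pselect (freq_box omega xi).
  by rewrite mem_set// mulr1 min_l ?subKr// gerBl invr_ge0 ltW.
by rewrite memNset// mulr0 out// subrr minxx subr0.
Qed.

End inverse_symbol.

Section g2a_bound.
Context {R : realType}.
Local Open Scope complex_scope.
Variables (alpha : R) (omega : 'I_2 -> R) (g2a : R * R -> R).
Hypothesis homega : 0 < omega 0 < omega 1.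
Hypothesis halpha : 0 < alpha.
Hypothesis hg2 : is_g2a alpha omega g2a.

Lemma inv_fourier_gauss2 p a (xi : R * R) : 0 < p ->
  let G := (2 * pi) ^- 2 * (gauss2_mass p p * gauss2 (4 * p)^-1 (4 * p)^-1 (0, 0) xi) in
  complex.Re (inv_fourier_fun (fun x => (gauss2 p p a x)%:C) xi) = G * cos (dot a xi + 0) /\
  complex.Im (inv_fourier_fun (fun x => (gauss2 p p a x)%:C) xi) = G * cos (dot a xi - pi / 2).
Proof.
move=> p0 G; rewrite /inv_fourier_fun complex_Re_mull complex_Im_mull Re_cint Im_cint.
have e th : G * cos (dot a xi + th) =
    (2 * pi) ^- 2 * \int[leb2 R]_x (gauss2 p p a x * cos (dot xi x + th)).
  by rewrite Rintegral_gauss2_cos// (dotC xi) /G /gauss2_mass !mulrA.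
rewrite !e.
split; congr (_ * _); apply: eq_Rintegral => x _.
  by rewrite complex_Re_mull /= (dotC xi) addr0.
by rewrite complex_Im_mull /= (dotC xi) cosBpihalf.
Qed.

(** The defining identity of g_2 is tested on a Gaussian centred at a. The Dirac mass on one side
    and the constant alpha^-2 inside det (F g)^-1 on the other contribute the same value, the
    Gaussian at the origin. What remains expresses the integral of g_{2,alpha} through [inv_defect],
    which is at most alpha^-2 on a square of area (4 omega_2)^2 and zero elsewhere. *)
Lemma Rintegral_g2a_gauss2 p a : 0 < p ->
  `|\int[leb2 R]_x (g2a x * gauss2 p p a x)| <=
   alpha ^- 2 * (4 * omega 1) ^+ 2 / (2 * pi) ^+ 2 * gauss2_mass p p.
Proof.
move=> p0; have [cg [M HM] [ghat [ghatP /(_ _ (schwartz_gauss2 a p0 p0)) h]]] := hg2.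
have q0 : 0 < (4 * p)^-1 by rewrite invr_gt0 mulr_gt0.
have hR := congr1 (@complex.Re R) h.
pose G xi := (2 * pi) ^- 2 * (gauss2_mass p p * gauss2 (4 * p)^-1 (4 * p)^-1 (0, 0) xi).
have iG : (leb2 R).-integrable setT (EFin \o (fun xi => G xi * cos (dot a xi + 0))).
  rewrite (_ : (fun xi => _) = (fun xi => (2 * pi) ^- 2 * gauss2_mass p p *
    (gauss2 (4 * p)^-1 (4 * p)^-1 (0, 0) xi * cos (dot a xi + 0)))).
    by apply: integrableZR; exact: integrable_gauss2_cos.
  by apply/funext => x; rewrite /G; ring.
pose k := inv_defect alpha omega ghat.
have kb := inv_defect_bounds omega ghat halpha.
have mk : measurable_fun setT k by exact: (measurable_inv_defect ghatP).
have a2 : 0 <= alpha ^- 2 by rewrite invr_ge0 exprn_ge0// ltW.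
have pi2 : 0 <= (2 * pi) ^- 2 :> R by rewrite invr_ge0 exprn_ge0// mulr_ge0// pi_ge0.
have m0 : 0 <= gauss2_mass p p by rewrite mulr_ge0// sqrtr_ge0.
have G0 xi : 0 <= G xi.
  by apply: mulr_ge0 => //; apply: mulr_ge0 => //; rewrite ltW// gauss2_gt0.
have k_le xi : `|k xi| <= alpha ^- 2.
  have /andP[h1 h2] := kb xi; rewrite ger0_norm// (le_trans h2)//.
  by apply: ler_piMr => //; case/andP: (indic_ge0_le1 R (freq_box omega) xi).
have ik : (leb2 R).-integrable setT (EFin \o (fun xi => k xi * (G xi * cos (dot a xi + 0)))).
  by apply: (@integrableMb _ _ _ (leb2 R) k (fun xi => G xi * cos (dot a xi + 0)) (alpha ^- 2)).
have eR : complex.Re (inv_fourier (fun_dist (fun xi => (\det (ghat xi))^-1)) (fun x => (gauss2 p p a x)%:C)) =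
    alpha ^- 2 * \int[leb2 R]_xi (G xi * cos (dot a xi + 0)) -
    \int[leb2 R]_xi (k xi * (G xi * cos (dot a xi + 0))).
  rewrite /inv_fourier /fun_dist Re_cint.
  rewrite -RintegralZl// -RintegralB//; last exact: integrableZR.
  have [mdr mdi] := measurable_inv_det ghatP.
  have mG : measurable_fun setT G.
    by do 2 apply: measurable_funM => //; exact: measurable_gauss2.
  have mcos th : measurable_fun setT (fun xi => cos (dot a xi + th)).
    by apply: (measurableT_comp measurable_cos); apply: measurable_funD => //; exact: measurable_dot.
  apply: Rintegral_ae.
  - rewrite (_ : (fun x => _) = (fun xi => complex.Re (\det (ghat xi))^-1 * (G xi * cos (dot a xi + 0)) -
       complex.Im (\det (ghat xi))^-1 * (G xi * cos (dot a xi - pi / 2)))).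
      by apply: measurable_funB; apply: measurable_funM => //; apply: measurable_funM => //; exact: mcos.
    apply/funext => xi; have [e1 e2] := inv_fourier_gauss2 a xi p0.
    by rewrite complex_ReM e1 e2.
  - by apply: measurable_funB; apply: measurable_funM => //; apply: measurable_funM => //; exact: mcos.
  - apply: aeS (ae_inv_det ghatP homega halpha) => xi ->.
    have [e1 _] := inv_fourier_gauss2 a xi p0.
    by rewrite complex_Re_mull e1 mulrBl.
have eL : complex.Re (kernel_dist (g2 alpha g2a) (fun x => (gauss2 p p a x)%:C)) =
    alpha ^- 2 * gauss2 p p a (0, 0) - \int[leb2 R]_x (g2a x * gauss2 p p a x).
  rewrite /kernel_dist complex_ReD complex_Re_mull /fun_dist Re_cint /= subr0; congr (_ + _).
  rewrite -[RHS]mulN1r -RintegralZl//; last first.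
    apply: (@integrableMb _ _ _ (leb2 R) g2a _ M) => //; first exact: continuous_measurable_plane.
    exact: integrable_gauss2.
  by apply: eq_Rintegral => x _; rewrite /= mulr0 subr0 fctE sub0r mulN1r mulNr.
(* Fourier inversion at the origin for this one Gaussian. *)
have IG : \int[leb2 R]_xi (G xi * cos (dot a xi + 0)) = gauss2 p p a (0, 0).
  rewrite (_ : \int[_]_xi _ = \int[leb2 R]_xi ((2 * pi) ^- 2 * gauss2_mass p p *
    (gauss2 (4 * p)^-1 (4 * p)^-1 (0, 0) xi * cos (dot a xi + 0)))); last first.
    by apply: eq_Rintegral => x _; rewrite /G; ring.
  rewrite RintegralZl//; last exact: integrable_gauss2_cos.
  rewrite Rintegral_gauss2_cos// (dotC a) dot0 addr0 cos0 mulr1.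
  have e4 : (4 * (4 * p)^-1)^-1 = p by field; rewrite gt_eqF.
  rewrite e4 (_ : gauss2 p p (0, 0) a = gauss2 p p a (0, 0)); last first.
    by rewrite /gauss2 /gauss /= !subr0 !sub0r !sqrrN.
  rewrite mulrA -[RHS]mul1r; congr (_ * _).
  have hp := sqrt_pi_mul p0; rewrite /gauss2_mass.
  transitivity ((2 * pi) ^- 2 * ((Num.sqrt (pi / p) * Num.sqrt (pi / (4 * p)^-1)) *
     (Num.sqrt (pi / p) * Num.sqrt (pi / (4 * p)^-1)))); first by ring.
  by rewrite hp -expr2 mulVf// expf_neq0// mulf_neq0// gt_eqF// pi_gt0.
have -> : \int[leb2 R]_x (g2a x * gauss2 p p a x) = \int[leb2 R]_xi (k xi * (G xi * cos (dot a xi + 0))).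
  by move: hR; rewrite eL eR IG => /addrI /oppr_inj.
apply: (le_trans (le_normr_Rintegral _ _)) => //.
pose C := alpha ^- 2 * ((2 * pi) ^- 2 * gauss2_mass p p).
have iB : (leb2 R).-integrable setT (EFin \o (\1_(freq_box omega) : R * R -> R)).
  exact: integrable_indic_box.
apply: (@le_trans _ _ (\int[leb2 R]_xi (C * \1_(freq_box omega) xi))).
  apply: le_Rintegral => //; [exact: integrable_norm|exact: integrableZR|].
  move=> xi _; rewrite normrM.
  rewrite (_ : C * _ = alpha ^- 2 * \1_(freq_box omega) xi * ((2 * pi) ^- 2 * gauss2_mass p p)); last first.
    by rewrite /C; ring.
  have /andP[k0 k1] := kb xi.
  apply: ler_pM => //; first by rewrite ger0_norm.
  apply: (@le_trans _ _ (G xi)).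
    by rewrite normrM ger0_norm// ler_piMr// norm_cos_le1.
  apply: ler_wpM2l => //; apply: ler_piMr => //.
  by rewrite mulr_ile1 ?gauss_le1 ?(ltW (gauss_gt0 _ _ _))// ltW.
rewrite RintegralZl//.
have o1 : 0 <= 2 * omega 1 by case/andP: homega => o0 o1; rewrite mulr_ge0// ltW// (lt_trans o0).
rewrite Rintegral_indic_box; [|by rewrite ge0_cp..].
rewrite le_eqVlt; apply/orP; left; apply/eqP; rewrite /C.
have pi0 : (pi : R) != 0 by rewrite gt_eqF// pi_gt0.
move: (gauss2_mass p p) (pi : R) pi0 => N P P0.
by field; rewrite P0 gt_eqF.
Qed.

Lemma g2a_bound x : `|g2a x| <= alpha ^- 2 * (4 * omega 1) ^+ 2 / (2 * pi) ^+ 2.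
Proof.
have [cg bg _] := hg2; apply: (gauss2_point_bound cg bg) => p p0.
exact: Rintegral_g2a_gauss2.
Qed.

End g2a_bound.

(** * Discretization *)

Section translation.
Context {R : realType}.

Definition translate1 (c x : R) : R := x + c.
Definition translate2 (c x : R * R) : R * R := (x.1 + c.1, x.2 + c.2).

Lemma measurable_translate1 c : measurable_fun setT (translate1 c).
Proof. exact: measurable_funD. Qed.

Lemma measurable_translate2 c : measurable_fun setT
  (translate2 c : measurableTypeR R * measurableTypeR R -> measurableTypeR R * measurableTypeR R)%type.
Proof.
by apply/measurable_fun_pairP; split; apply: measurable_funD.
Qed.

Lemma lebesgue_measure_translate c (A : set R) : measurable A ->
  lebesgue_measure (translate1 c @^-1` A) = lebesgue_measure A.
Proof.
move=> mA.
suff : pushforward (@lebesgue_measure R) (translate1 c : _ -> measurableTypeR R) A = lebesgue_measure A by [].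
have mt := measurable_translate1 c.
apply/esym/lebesgue_measure_unique => //= _ [[a b]] _ <-.
rewrite /pushforward (_ : translate1 c @^-1` _ = `]a - c, b - c]%classic); last first.
  by apply/seteqP; split => x; rewrite /translate1 /= !in_itv/= ltrBlDr lerBrDr.
by rewrite !lebesgue_measure_itv/= !lte_fin ltrD2r -!EFinB opprB addrA subrK.
Qed.

(** A product measure is determined on rectangles, where the one-dimensional invariance applies. *)
Lemma leb2_translate c (A : set (R * R)) : measurable A ->
  leb2 R (translate2 c @^-1` A) = leb2 R A.
Proof.
move=> mA.
pose m' := measure_function_pushforward__canonical__measure_function_Measure (leb2 R) (measurable_translate2 c).
suff h : forall X, measurable X -> leb2 R X = m' X by exact/esym/h.
apply: product_measure_unique => B C mB mC.
have mB' : measurable (translate1 c.1 @^-1` B).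
  by rewrite -(setTI (_ @^-1` _)); exact: measurable_translate1.
have mC' : measurable (translate1 c.2 @^-1` C).
  by rewrite -(setTI (_ @^-1` _)); exact: measurable_translate1.
apply: (etrans (@product_measure1E _ _ _ _ R (@lebesgue_measure R) (@lebesgue_measure R) _ _ mB' mC')).
by congr (_ * _)%E; exact: lebesgue_measure_translate.
Qed.

Lemma Rintegral_translate c (f : R * R -> R) : measurable_fun setT f ->
  (leb2 R).-integrable setT (EFin \o (fun x => f (translate2 c x))) ->
  \int[leb2 R]_x f (translate2 c x) = \int[leb2 R]_x f x.
Proof.
move=> mf fi; congr fine.
have := @integral_pushforward _ _ _ _ R _ (measurable_translate2 c) (leb2 R) setT (EFin \o f)
  ((measurable_EFinP _ _).2 mf).
rewrite preimage_setT => /(_ fi measurableT) e; rewrite -[LHS]e.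
apply: eq_measure_integral => [|? A mA _]; first exact: measurable_translate2.
exact: (leb2_translate c mA).
Qed.

End translation.

Section matrix_norm.
Context {R : realType}.

Lemma matrix_norm_le m n (M : 'M[R]_(m, n)) (b : R) : 0 <= b ->
  (forall i j, `|M i j| <= b) -> `|M| <= b.
Proof.
move=> b0 h; rewrite [leLHS]mx_normrE; apply: bigmax_le => // -[i j] _; exact: h.
Qed.

Lemma norm_entry_le m n (M : 'M[R]_(m, n)) i j : `|M i j| <= `|M|.
Proof.
rewrite [leRHS]mx_normrE; exact: (le_bigmax _ (fun ij : 'I_m * 'I_n => `|M ij.1 ij.2|) (i, j)).
Qed.

End matrix_norm.

Section filter_bounds.
Context {R : realType}.

(** The l^1 distance is dual to the bound 2 w on each coordinate of a frequency. *)
Definition dist1 (y z : R * R) : R := `|y.1 - z.1| + `|y.2 - z.2|.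

Lemma dist1_ge0 y z : 0 <= dist1 y z. Proof. exact: addr_ge0. Qed.

Lemma cos_lipschitz (a b : R) : `|cos a - cos b| <= `|a - b|.
Proof.
wlog ab : a b / a <= b.
  move=> h; have [|/ltW] := leP a b; first exact: h.
  by move=> ba; rewrite distrC [leRHS]distrC; exact: h.
have [c _] := @MVT_segment R cos (fun x => - sin x) a b ab (fun x _ => is_derive_cos x)
  (continuous_subspaceT (@continuous_cos R)).
rewrite distrC [leRHS]distrC => ->; rewrite normrM normrN.
by rewrite ler_piMl// ler_norml sin_geN1 sin_le1.
Qed.

Lemma dist1_continuous (f : R * R -> R) (L : R) : 0 <= L ->
  (forall y z, `|f y - f z| <= L * dist1 y z) -> continuous f.
Proof.
move=> L0 fL y; apply/cvgrPdist_le => e e0.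
pose d := e / (2 * L + 1).
have L1 : 0 < 2 * L + 1 by rewrite ltr_wpDl// mulr_ge0.
have d0 : 0 < d by rewrite divr_gt0.
have : nbhs y (ball y d) by exact: nbhsx_ballx.
apply: filterS => z [b1 b2].
apply: (le_trans (fL y z)); apply: (@le_trans _ _ (L * (2 * d))).
  by rewrite ler_wpM2l// mulr_natl mulr2n lerD// ltW.
have -> : L * (2 * d) = e * (2 * L) / (2 * L + 1) by rewrite /d; ring.
by rewrite ler_pdivrMr//; apply: ler_wpM2l; [exact: ltW|rewrite lerDl].
Qed.

(** The cosine is 1-Lipschitz, its frequency has coordinates of modulus at most 2 w, and (2 pi)^2 is
    the area of the torus. *)
Lemma gfilter_lipschitz (w : R) j k y z : 0 <= w ->
  `|gfilter w j k y - gfilter w j k z| <=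
   norm_c w ^+ 2 * ((2 * pi) ^+ 2 * (2 * w)) * dist1 y z.
Proof.
move=> w0; rewrite !gfilterE -mulrBr -RintegralB//; [|exact: integrable_circle_cos..].
rewrite normrM /filter_coef normrM normrX normrN1 expr1n mul1r.
rewrite (_ : _ * dist1 y z = norm_c w ^+ 2 * ((2 * pi) ^+ 2 * (2 * w * dist1 y z))); last by ring.
rewrite (ger0_norm (sqr_ge0 _)); apply: ler_wpM2l; first exact: sqr_ge0.
set e := filter_exp j k.
have i : (leb2 R).-integrable setT (EFin \o (fun t => circle_weight e t * cos (dot (circle_diff w t) y) -
    circle_weight e t * cos (dot (circle_diff w t) z))).
  under [X in EFin \o X]eq_fun do rewrite -[X in _ + X]mulN1r.
  by apply: integrableDR; [|apply: integrableZR]; exact: integrable_circle_cos.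
apply: (le_trans (le_normr_Rintegral measurableT i)).
have -> : (2 * pi) ^+ 2 * (2 * w * dist1 y z) = \int[leb2 R]_t (2 * w * dist1 y z * \1_torus t).
  rewrite RintegralZl//; last exact: integrable_torus.
  rewrite Rintegral_indic_box ?mulr_ge0 ?pi_ge0// subr0 expr2; ring.
apply: le_Rintegral => //; [exact: integrable_norm|by apply: integrableZR; exact: integrable_torus|].
move=> t _; rewrite -mulrBr normrM mulrC ler_pM//; last exact: norm_circle_weight.
apply: (le_trans (cos_lipschitz _ _)).
rewrite (_ : _ - _ = (circle_diff w t).1 * (y.1 - z.1) + (circle_diff w t).2 * (y.2 - z.2)); last first.
  by rewrite /dot; ring.
have [h1 h2] := circle_diff_le t w0.
by rewrite (le_trans (ler_normD _ _))// [leRHS]mulrDr lerD// normrM ler_wpM2r.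
Qed.

Lemma gfilter_norm_le (w : R) j k y : `|gfilter w j k y| <= norm_c w ^+ 2 * (2 * pi) ^+ 2.
Proof.
rewrite gfilterE normrM /filter_coef normrM normrX normrN1 expr1n mul1r.
rewrite (ger0_norm (sqr_ge0 _)) ler_wpM2l ?sqr_ge0//.
set e := filter_exp j k.
apply: (le_trans (le_normr_Rintegral measurableT (integrable_circle_cos w e y))).
have -> : (2 * pi) ^+ 2 = \int[leb2 R]_t (\1_torus t) :> R.
  rewrite Rintegral_indic_box ?mulr_ge0 ?pi_ge0// subr0 expr2; ring.
apply: le_Rintegral => //.
- by apply: integrable_norm => //; exact: integrable_circle_cos.
- exact: integrable_torus.
- move=> t _; rewrite normrM -[leRHS]mulr1 ler_pM//; [exact: norm_circle_weight|exact: norm_cos_le1].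
Qed.

End filter_bounds.

Section cells.
Context {R : realType}.
Variable n : nat.
Hypothesis n0 : (0 < n)%N.
Implicit Types (i j m l : 'I_n) (k : R * R -> R) (x y : R * R).

Let nR : 0 < n%:R :> R. Proof. by rewrite ltr0n. Qed.
Let nN0 : n%:R != 0 :> R. Proof. by rewrite gt_eqF. Qed.

(** Cell number i, counted from 0, extends from [node i] to [node i.+1] and has centre [coord i];
    the extreme nodes are -1 at 0 and 1 at n. *)
Definition node (i : nat) : R := 2 * i%:R / n%:R - 1.
Definition coord (i : nat) : R := (2 * i + 1)%N%:R / n%:R - 1.

Lemma coord_node (i : nat) :
  coord i - n%:R^-1 = node i /\ coord i + n%:R^-1 = node i.+1.
Proof.
rewrite /coord /node natrD natrM -[i.+1]addn1 natrD.
by split; field.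
Qed.

Lemma cellE i j : cell R i j = `[node i, node i.+1[ `*` `[node j, node j.+1[.
Proof.
rewrite /cell /grid_pt /= -!/(coord _).
by have [-> ->] := coord_node i; have [-> ->] := coord_node j.
Qed.

Lemma measurable_cell i j : measurable (cell R i j).
Proof. by rewrite cellE; apply: measurableX; exact: measurable_itv. Qed.

Lemma node_le (i i' : nat) : (node i <= node i') = (i <= i')%N.
Proof.
rewrite /node lerD2r ler_pM2r ?invr_gt0// ler_pM2l// ler_nat//.
Qed.

(** Written as a difference of step functions so that the sum over the cells telescopes. *)
Lemma indic_nodes (i : nat) (y : R) : \1_`[node i, node i.+1[%classic y =
  (y < node i.+1)%R%:R - (y < node i)%R%:R :> R.
Proof.
have h : node i <= node i.+1 by rewrite node_le.
rewrite indicE mem_setE in_itv/=; have [yi|yi] := ltP y (node i).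
  by rewrite (lt_le_trans yi h)/= subrr.
by rewrite subr0.
Qed.

(** The exact union of the cells; a piecewise constant function vanishes on the two edges of the
    square that are left out. *)
Definition half_open_domain : set (R * R) := `[-1, 1[ `*` `[-1, 1[.

Lemma sum_indic_nodes (y : R) :
  \sum_(i < n) \1_`[node i, node i.+1[%classic y = \1_`[-1, 1[%classic y :> R.
Proof.
under eq_bigr do rewrite indic_nodes.
rewrite -(big_mkord predT (fun i : nat => (y < node i.+1)%R%:R - (y < node i)%R%:R)).
rewrite (telescope_sumr (fun i : nat => (y < node i)%R%:R : R))//.
have -> : node n = 1 by rewrite /node mulfK// -[2]/(1 + 1) addrK.
have -> : node 0 = -1 by rewrite /node mulr0 mul0r sub0r.
rewrite indicE mem_setE in_itv/=; have [h|h] := ltP y (-1).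
  by rewrite (lt_trans h)/= ?subrr// gtrN.
by rewrite subr0.
Qed.

Lemma sum_indic_cells y : \sum_(i < n) \sum_(j < n) \1_(cell R i j) y =
  \1_half_open_domain y :> R.
Proof.
rewrite indic_setX -!sum_indic_nodes mulr_suml; apply: eq_bigr => i _.
by rewrite mulr_sumr; apply: eq_bigr => j _; rewrite cellE indic_setX.
Qed.

Lemma cell_sub_domain i j : cell R i j `<=` io_domain R.
Proof.
have e : node n = 1 by rewrite /node mulfK// -[2]/(1 + 1) addrK.
have e0 : node 0 = -1 by rewrite /node mulr0 mul0r sub0r.
rewrite cellE /io_domain -e0 -e => -[y z] [/=]; rewrite !in_itv/= => /andP[y1 y2] /andP[z1 z2].
split; apply/andP; split.
- by apply: le_trans y1; rewrite node_le.
- by rewrite (le_trans (ltW y2))// node_le.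
- by apply: le_trans z1; rewrite node_le.
- by rewrite (le_trans (ltW z2))// node_le.
Qed.

Lemma grid_pt_in_cell m l i j : \1_(cell R i j) (grid_pt R m l) = ((m == i) && (l == j))%:R :> R.
Proof.
have h (a b : 'I_n) : \1_`[node a, node a.+1[%classic (coord b) = (b == a)%:R :> R.
  rewrite indicE mem_setE in_itv/= /node /coord lerD2r ltrD2r.
  rewrite ler_pM2r ?invr_gt0// ltr_pM2r ?invr_gt0// -!natrM ler_nat ltr_nat -val_eqE /=.
  congr (nat_of_bool _)%:R; lia.
by rewrite cellE indic_setX /= !h -mulnb natrM.
Qed.

Lemma pwconst_grid_pt (O : 'M[R]_n) m l : pwconst O (grid_pt R m l) = O m l.
Proof.
rewrite /pwconst (bigD1 m)//= (bigD1 l)//= grid_pt_in_cell !eqxx/= mul1r.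
rewrite big1 => [|j jl]; last by rewrite grid_pt_in_cell eq_sym (negbTE jl) andbF mul0r.
rewrite addr0 big1 ?addr0// => i im; rewrite big1// => j _.
by rewrite grid_pt_in_cell eq_sym (negbTE im) mul0r.
Qed.

Lemma measurable_pwconst (O : 'M[R]_n) : measurable_fun setT (pwconst O).
Proof.
apply: measurable_sum => i; apply: measurable_sum => j.
by apply: measurable_funM => //; apply: measurable_indic; exact: measurable_cell.
Qed.

(** The indicators of the cells form a partition of unity on the half-open square, so both terms
    expand over the same cells and only a cell containing y contributes. *)
Lemma pwconst_dist (O : 'M[R]_n) (v e : R) y :
  (forall i j, cell R i j y -> `|v - O i j| <= e) ->
  `|\1_half_open_domain y * v - pwconst O y| <= e * \1_half_open_domain y.
Proof.
move=> h; rewrite -sum_indic_cells /pwconst mulr_suml mulr_sumr -sumrB.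
apply: (le_trans (ler_norm_sum _ _ _)); apply: ler_sum => i _.
rewrite mulr_suml mulr_sumr -sumrB.
apply: (le_trans (ler_norm_sum _ _ _)); apply: ler_sum => j _.
rewrite -mulrBr indicE; have [yij|yij] := pselect (cell R i j y).
  by rewrite mem_set// mulr1 mul1r h.
by rewrite memNset// !(mul0r, mulr0) normr0.
Qed.

Lemma norm_pwconst (O : 'M[R]_n) y : `|pwconst O y| <= `|O|.
Proof.
have h i j : cell R i j y -> `|0 - O i j| <= `|O|.
  by move=> _; rewrite sub0r normrN norm_entry_le.
have := pwconst_dist h; rewrite mulr0 sub0r normrN => /le_trans; apply.
by rewrite ler_piMr//; case/andP: (indic_ge0_le1 R half_open_domain y).
Qed.

Definition center_cell : set (R * R) := `[- n%:R^-1, n%:R^-1[ `*` `[- n%:R^-1, n%:R^-1[.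

Definition offset (a : 'I_(n + n)) : R := 2 * (a%:R - n%:R) / n%:R.

(** The mean of k over the cell-sized square around an offset: n^2 / 4 is the reciprocal of the area
    of a cell, and it cancels the weight 4 / n^2 of the discrete convolution. *)
Definition average_kernel k : 'M[R]_(n + n) :=
  \matrix_(a, b) (n%:R ^+ 2 / 4 *
    \int[leb2 R]_u (\1_center_cell u * k ((offset a, offset b) - u))).

Lemma coordB m i : coord m - coord i = offset (Defs.shift m i).
Proof.
rewrite /coord /offset /=; have h : (i <= m + n)%N by rewrite (leq_trans (ltnW (ltn_ord i)))// leq_addl.
by rewrite natrB// !natrD; field.
Qed.

Lemma measurable_reflect k x : measurable_fun setT k -> measurable_fun setT (fun y => k (x - y)).
Proof.
move=> mk; apply: (measurableT_comp mk).
by apply/measurable_fun_pairP; split; apply: measurable_funB.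
Qed.

Lemma bounded_measurable_reflect k x : bounded_measurable k -> bounded_measurable (fun y => k (x - y)).
Proof. by move=> [mk [M HM]]; split; [exact: measurable_reflect|exists M]. Qed.

Lemma integrable_cell i j k : bounded_measurable k ->
  (leb2 R).-integrable setT (EFin \o (fun y => \1_(cell R i j) y * k y)).
Proof.
move=> [mk [M HM]]; under [X in EFin \o X]eq_fun do rewrite mulrC.
apply: (@integrableMb _ _ _ (leb2 R) k _ M) => //.
by rewrite cellE; exact: integrable_indic_box.
Qed.

Lemma integrable_domain k : bounded_measurable k ->
  (leb2 R).-integrable setT (EFin \o (fun y => \1_(io_domain R) y * k y)).
Proof.
move=> [mk [M HM]]; under [X in EFin \o X]eq_fun do rewrite mulrC.
by apply: (@integrableMb _ _ _ (leb2 R) k _ M) => //; exact: integrable_indic_box.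
Qed.

(** Moving the centre of the cell to the origin leaves a dependence on the differences of indices
    only, which is what a discrete convolution requires. *)
Lemma Rintegral_cell k m l i j : bounded_measurable k ->
  \int[leb2 R]_y (\1_(cell R i j) y * k (grid_pt R m l - y)) =
  \int[leb2 R]_u (\1_center_cell u * k ((offset (Defs.shift m i), offset (Defs.shift l j)) - u)).
Proof.
move=> bk.
have E u : \1_center_cell u * k ((offset (Defs.shift m i), offset (Defs.shift l j)) - u) =
    \1_(cell R i j) (translate2 (grid_pt R i j) u) * k (grid_pt R m l - translate2 (grid_pt R i j) u).
  congr (_ * k _).
    rewrite /cell /= !indic_setX /= !indicE !mem_setE !in_itv/=.
    by congr (_%:R * _%:R); congr (nat_of_bool (_ && _)); apply/idP/idP => h; lra.
  by rewrite -!coordB; congr (_, _); rewrite /= /coord; ring.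
pose f y := \1_(cell R i j) y * k (grid_pt R m l - y).
transitivity (\int[leb2 R]_u f (translate2 (grid_pt R i j) u)); last first.
  by apply: eq_Rintegral => u _; rewrite E.
rewrite Rintegral_translate//.
  by apply: measurable_funM; [apply: measurable_indic; exact: measurable_cell|exact: measurable_reflect bk.1].
rewrite /f -(funext E).
have [mk [M HM]] := bounded_measurable_reflect (offset (Defs.shift m i), offset (Defs.shift l j)) bk.
under [X in EFin \o X]eq_fun do rewrite mulrC.
apply: (@integrableMb _ _ _ (leb2 R) (fun u => k ((offset (Defs.shift m i), offset (Defs.shift l j)) - u)) _ M) => //.
exact: integrable_indic_box.
Qed.

Lemma dconv_average k (O : 'M[R]_n) m l : bounded_measurable k ->
  dconv (average_kernel k) O m l =
  \int[leb2 R]_(y in io_domain R) (k (grid_pt R m l - y) * pwconst O y).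
Proof.
move=> bk; rewrite mxE Rintegral_indic.
have bkr := bounded_measurable_reflect (grid_pt R m l) bk.
transitivity (\int[leb2 R]_y (\sum_(i < n) \sum_(j < n)
   O i j * (\1_(cell R i j) y * k (grid_pt R m l - y)))); last first.
  apply: eq_Rintegral => y _; rewrite /pwconst mulr_sumr mulr_sumr; apply: eq_bigr => i _.
  rewrite mulr_sumr mulr_sumr; apply: eq_bigr => j _.
  rewrite [in RHS]indicE [in LHS]indicE [in RHS]indicE.
  have [yij|yij] := pselect (cell R i j y).
    by rewrite mem_set// (mem_set (cell_sub_domain yij)) !mul1r mulrC.
  by rewrite (memNset yij) !(mul0r, mulr0).
rewrite Rintegral_sumR; last first.
  by move=> i; apply: integrable_sumR => j; apply: integrableZR; exact: integrable_cell.
rewrite mulr_sumr; apply: eq_bigr => i _.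
rewrite Rintegral_sumR; last by move=> j; apply: integrableZR; exact: integrable_cell.
rewrite mulr_sumr; apply: eq_bigr => j _.
rewrite RintegralZl//; last exact: integrable_cell.
by rewrite Rintegral_cell// mxE; field.
Qed.

End cells.

(** * The layers and the convolution with the first kernel *)

Section layers.
Context {R : realType}.
Variable n : nat.
Implicit Types (O : 'M[R]_(n + n, n)) (G : 'M[R]_(n + n)).

Lemma Pu_mul O : Pu R n *m O = usubmx O.
Proof. by rewrite -{1}(vsubmxK O) /Pu mul_row_col mul1mx mul0mx addr0. Qed.

Lemma Pl_mul O : Pl R n *m O = dsubmx O.
Proof. by rewrite -{1}(vsubmxK O) /Pl mul_row_col mul1mx mul0mx add0r. Qed.

Lemma layer_Pu G (P' : 'M[R]_(n, n + n)) O :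
  layer (Pu R n) G P' O = col_mx (dconv G (P' *m O)) 0.
Proof. by rewrite /layer tr_row_mx mul_col_mx trmx1 trmx0 mul1mx mul0mx. Qed.

Lemma layer_Pl G (P' : 'M[R]_(n, n + n)) O :
  layer (Pl R n) G P' O = col_mx 0 (dconv G (P' *m O)).
Proof. by rewrite /layer tr_row_mx mul_col_mx trmx1 trmx0 mul1mx mul0mx. Qed.

Definition component (k : 'I_2) O : 'M[R]_n := if k == 0 then usubmx O else dsubmx O.

Lemma pwconst2E O x k : pwconst2 O x k 0 = pwconst (component k O) x.
Proof. by rewrite mxE /component; case: (k == 0). Qed.

Lemma norm_component_le k O i j : `|component k O i j| <= `|O|.
Proof. by rewrite /component; case: ifP => _; rewrite mxE norm_entry_le. Qed.

Lemma norm_component k O : `|component k O| <= `|O|.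
Proof. by apply: matrix_norm_le => // i j; exact: norm_component_le. Qed.

Lemma component_le O (b : R) : 0 <= b -> (forall k i j, `|component k O i j| <= b) -> `|O| <= b.
Proof.
move=> b0 h; apply: matrix_norm_le => // i j.
case: (split_ordP i) => i' ->.
  by have := h 0 i' j; rewrite /component eqxx mxE.
by have := h 1 i' j; rewrite /component mxE.
Qed.

Lemma psi2_component (alpha : R) G O k :
  component k (psi2 alpha G O) = alpha ^- 2 *: component k O - dconv G (component k O).
Proof.
rewrite /psi2 layer_Pu layer_Pl Pu_mul Pl_mul.
rewrite add_col_mx addr0 add0r /component; case: ifP => _.
  by rewrite linearB linearZ /= col_mxKu.
by rewrite linearB linearZ /= col_mxKd.
Qed.

(* The (k, k') entry of [g1], the adjugate of the filter matrix, is
   [cross_sign k k'] times the filter with indices [cross_index k k']. *)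
Definition cross_index (k k' : 'I_2) : 'I_2 * 'I_2 :=
  if k == k' then (if k == 0 then (1, 1) else (0, 0)) else (0, 1).
Definition cross_sign (k k' : 'I_2) : R := if k == k' then 1 else -1.

Lemma psi1_component (alpha : R) (G : 'I_2 -> 'I_2 -> 'I_2 -> 'M[R]_(n + n)) O k :
  component k (psi1 alpha G O) = alpha *: component k O +
   \sum_(k' < 2) \sum_(i < 2) cross_sign k k' *:
     dconv (G i (cross_index k k').1 (cross_index k k').2) (component k' O).
Proof.
rewrite /psi1 !big_ord_recl !big_ord0.
rewrite !layer_Pu !layer_Pl !Pu_mul !Pl_mul.
rewrite (_ : lift ord0 ord0 = 1); last exact/val_inj.
have [->|->] := ord2P k; rewrite /component /cross_sign /cross_index /=.
  rewrite !(linearD, linearN, linearZ) /= !(col_mxKu, linear0).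
  by rewrite !scaleN1r !scale1r; apply/matrixP => a b; rewrite !mxE; ring.
rewrite !(linearD, linearN, linearZ) /= !(col_mxKd, linear0).
by rewrite !scaleN1r !scale1r; apply/matrixP => a b; rewrite !mxE; ring.
Qed.

End layers.

Section convolutions.
Context {R : realType}.
Variables (alpha : R) (omega : 'I_2 -> R).
Hypothesis homega : 0 < omega 0 < omega 1.

Definition cross_kernel (k k' : 'I_2) (y : R * R) : R :=
  \sum_(i < 2) cross_sign k k' * gfilter (omega i) (cross_index k k').1 (cross_index k k').2 y.

(** It reconciles the network, which uses G_12 in both off-diagonal blocks, with the lower row of
    [g1], which contains g_21. *)
Lemma gfilter_sym w y : gfilter w 1 0 y = gfilter w 0 1 y :> R.
Proof. by rewrite !gfilterE. Qed.

Lemma g1E k k' : (g1 alpha omega k k').1 = alpha * (k == k')%:R /\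
  (g1 alpha omega k k').2 = cross_kernel k k'.
Proof.
rewrite /g1 summxE /cross_kernel /cross_sign /cross_index !big_ord_recl big_ord0.
have [->|->] := ord2P k; have [->|->] := ord2P k'; rewrite !mxE /=; split.
all: try (apply/funext => y; rewrite !big_ord_recl big_ord0 /= ?addr0 ?mul1r ?mulN1r ?gfilter_sym //).
all: rewrite ?mulr0 ?mulr1 ?addr0 ?add0r ?oppr0 ?addr0 //=; lra.
Qed.

Definition filter_mass : R := (norm_c (omega 0) ^+ 2 + norm_c (omega 1) ^+ 2) * (2 * pi) ^+ 2.

Lemma filter_mass_ge0 : 0 <= filter_mass.
Proof. by rewrite mulr_ge0 ?addr_ge0 ?sqr_ge0. Qed.

Let norm_cross_sign k k' (z : R) : `|cross_sign k k' * z| = `|z|.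
Proof. by rewrite /cross_sign; case: ifP; rewrite ?mul1r ?mulN1r ?normrN. Qed.

Lemma cross_kernel_lipschitz k k' y z :
  `|cross_kernel k k' y - cross_kernel k k' z| <= filter_mass * (2 * omega 1) * dist1 y z.
Proof.
case/andP: homega => o0 o1.
rewrite /cross_kernel -sumrB (le_trans (ler_norm_sum _ _ _))//.
under eq_bigr do rewrite -mulrBr norm_cross_sign.
rewrite !big_ord_recl big_ord0 addr0.
rewrite (_ : lift ord0 ord0 = 1); last exact/val_inj.
set c := cross_index k k'.
have h0 := gfilter_lipschitz c.1 c.2 y z (ltW o0).
have h1 := gfilter_lipschitz c.1 c.2 y z (ltW (lt_trans o0 o1)).
rewrite /filter_mass.
rewrite (_ : _ * dist1 y z = norm_c (omega 0) ^+ 2 * ((2 * pi) ^+ 2 * (2 * omega 1)) * dist1 y z +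
   norm_c (omega 1) ^+ 2 * ((2 * pi) ^+ 2 * (2 * omega 1)) * dist1 y z); last by ring.
apply: lerD => //; apply: (le_trans h0).
apply: ler_wpM2r; first exact: dist1_ge0.
apply: ler_wpM2l; first exact: sqr_ge0.
apply: ler_wpM2l; first exact: sqr_ge0.
by rewrite ler_wpM2l// ltW.
Qed.

Lemma bounded_measurable_gfilter (w : R) j k : 0 <= w -> bounded_measurable (gfilter w j k).
Proof.
move=> w0; split; last first.
  by exists (norm_c w ^+ 2 * (2 * pi) ^+ 2) => y; exact: gfilter_norm_le.
apply: continuous_measurable_plane.
apply: (dist1_continuous _ (fun y z => gfilter_lipschitz j k y z w0)).
by rewrite mulr_ge0 ?sqr_ge0// mulr_ge0 ?sqr_ge0// mulr_ge0.
Qed.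

Let omega_ge0 i : 0 <= omega i.
Proof.
case/andP: homega => o0 o1.
by have [->|->] := ord2P i; rewrite ltW// (lt_trans o0).
Qed.

Lemma bounded_measurable_cross_kernel k k' : bounded_measurable (cross_kernel k k').
Proof.
have -> : cross_kernel k k' = (fun y => cross_sign k k' * gfilter (omega 0) (cross_index k k').1 (cross_index k k').2 y +
   cross_sign k k' * gfilter (omega 1) (cross_index k k').1 (cross_index k k').2 y).
  apply/funext => y; rewrite /cross_kernel !big_ord_recl big_ord0 addr0.
  by rewrite (_ : lift ord0 ord0 = 1)//; exact/val_inj.
have b i : bounded_measurable (fun y => cross_sign k k' * gfilter (omega i) (cross_index k k').1 (cross_index k k').2 y).
  apply: bounded_measurableM; first exact: bounded_measurable_cst.
  exact: bounded_measurable_gfilter.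
exact: bounded_measurableD.
Qed.

Variable n : nat.
Hypothesis n0 : (0 < n)%N.
Variable O : 'M[R]_(n + n, n).

Lemma bounded_measurable_pwconst (A : 'M[R]_n) : bounded_measurable (pwconst A).
Proof. by split; [exact: measurable_pwconst|exists `|A| => y; exact: norm_pwconst]. Qed.

(** The Lipschitz part of g_1 * O; the other part, alpha O, is piecewise constant and is therefore
    discretized without error. *)
Definition smooth_part (k : 'I_2) (x : R * R) : R := \sum_(k' < 2)
  \int[leb2 R]_(y in io_domain R) (cross_kernel k k' (x - y) * pwconst (component k' O) y).

Lemma mxconv_g1 k x : mxconv (g1 alpha omega) (pwconst2 O) x k 0 =
  alpha * pwconst (component k O) x + smooth_part k x.
Proof.
transitivity (\sum_(k' < 2) (alpha * (k == k')%:R * pwconst (component k' O) x +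
  \int[leb2 R]_(y in io_domain R) (cross_kernel k k' (x - y) * pwconst (component k' O) y))).
  rewrite mxE; apply: eq_bigr => k' _; have [d s] := g1E k k'.
  rewrite /Defs.conv d s; congr (_ * _ + _); first exact: pwconst2E.
  by apply: eq_Rintegral => y _; rewrite pwconst2E.
rewrite big_split /=; congr (_ + _).
rewrite (bigD1 k)//= eqxx mulr1 big1 ?addr0// => k' kk'.
by rewrite eq_sym (negbTE kk') mulr0 mul0r.
Qed.

Let integrable_cross k k' x : (leb2 R).-integrable setT
  (EFin \o (fun y => \1_(io_domain R) y * (cross_kernel k k' (x - y) * pwconst (component k' O) y))).
Proof.
apply: integrable_domain; apply: bounded_measurableM.
  exact: bounded_measurable_reflect (bounded_measurable_cross_kernel _ _).
exact: bounded_measurable_pwconst.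
Qed.

Lemma integral_domain : \int[leb2 R]_y (\1_(io_domain R) y) = 4 :> R.
Proof. rewrite Rintegral_indic_box; [ring|lra|lra]. Qed.

(** The factor 16 is 2 components times the area 4 of the square times the 2 in the bound 2 omega_2
    on frequencies. *)
Lemma smooth_part_lipschitz k x z :
  `|smooth_part k x - smooth_part k z| <= 16 * filter_mass * omega 1 * `|O| * dist1 x z.
Proof.
rewrite /smooth_part -sumrB (le_trans (ler_norm_sum _ _ _))//.
have h k' : `|\int[leb2 R]_(y in io_domain R) (cross_kernel k k' (x - y) * pwconst (component k' O) y) -
    \int[leb2 R]_(y in io_domain R) (cross_kernel k k' (z - y) * pwconst (component k' O) y)| <=
    8 * filter_mass * omega 1 * `|O| * dist1 x z.
  rewrite 2!(Rintegral_indic (leb2 R) (io_domain R)).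
  rewrite -(RintegralB measurableT (integrable_cross k k' x) (integrable_cross k k' z)).
  have i := integrableDR (integrable_cross k k' x) (integrableZR (-1) (integrable_cross k k' z)).
  rewrite (_ : \int[_]_y _ = \int[leb2 R]_y
     (\1_(io_domain R) y * (cross_kernel k k' (x - y) * pwconst (component k' O) y) +
      -1 * (\1_(io_domain R) y * (cross_kernel k k' (z - y) * pwconst (component k' O) y)))); last first.
    by apply: eq_Rintegral => y _; rewrite mulN1r.
  apply: (le_trans (le_normr_Rintegral measurableT i)).
  set c := filter_mass * (2 * omega 1) * dist1 x z * `|O|.
  have -> : 8 * filter_mass * omega 1 * `|O| * dist1 x z = \int[leb2 R]_y (c * \1_(io_domain R) y).
    rewrite RintegralZl ?integral_domain//; last exact: integrable_indic_box.
    rewrite /c; ring.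
  apply: le_Rintegral => //.
  - exact: integrable_norm.
  - by apply: integrableZR; exact: integrable_indic_box.
  move=> y _.
  rewrite (_ : _ + _ = \1_(io_domain R) y * ((cross_kernel k k' (x - y) - cross_kernel k k' (z - y)) *
    pwconst (component k' O) y)); last by ring.
  rewrite normrM ger0_norm; last by case/andP: (indic_ge0_le1 R (io_domain R) y).
  rewrite mulrC; apply: ler_wpM2r; first by case/andP: (indic_ge0_le1 R (io_domain R) y).
  rewrite normrM /c; apply: ler_pM => //.
    apply: (le_trans (cross_kernel_lipschitz _ _ _ _)).
    rewrite (_ : dist1 (x - y) (z - y) = dist1 x z)//.
    by rewrite /dist1 /= !opprB !addrA !subrK.
  exact: (le_trans (norm_pwconst n0 _ _) (norm_component _ _)).
apply: (@le_trans _ _ (\sum_(k' < 2) 8 * filter_mass * omega 1 * `|O| * dist1 x z)).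
  by apply: ler_sum => k' _; exact: h.
rewrite !big_ord_recl big_ord0; lra.
Qed.

Lemma bounded_measurable_smooth_part k : bounded_measurable (smooth_part k).
Proof.
split.
  apply: continuous_measurable_plane.
  apply: (dist1_continuous _ (smooth_part_lipschitz k)).
  rewrite mulr_ge0// mulr_ge0// mulr_ge0//.
  exact: filter_mass_ge0.
exists (\sum_(k' < 2) (projT1 (cid (bounded_measurable_cross_kernel k k').2) * `|O|) * 4) => x.
rewrite (le_trans (ler_norm_sum _ _ _))//; apply: ler_sum => k' _.
have HM := projT2 (cid (bounded_measurable_cross_kernel k k').2).
set M := projT1 _ in HM *; rewrite Rintegral_indic.
apply: (le_trans (le_normr_Rintegral measurableT (integrable_cross k k' x))).
rewrite -integral_domain -RintegralZl//; last exact: integrable_indic_box.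
apply: le_Rintegral => //.
- by apply: integrable_norm => //; exact: integrable_cross.
- by apply: integrableZR; exact: integrable_indic_box.
move=> y _; have /andP[i0 _] := indic_ge0_le1 R (io_domain R) y.
rewrite normrM ger0_norm// mulrC ler_wpM2r// normrM ler_pM//.
exact: (le_trans (norm_pwconst n0 _ _) (norm_component _ _)).
Qed.

Definition filter_average (i j k : 'I_2) : 'M[R]_(n + n) := average_kernel n (gfilter (omega i) j k).

Lemma psi1_exact k i j : component k (psi1 alpha filter_average O) i j =
  mxconv (g1 alpha omega) (pwconst2 O) (grid_pt R i j) k 0.
Proof.
rewrite psi1_component mxconv_g1 pwconst_grid_pt// !mxE; congr (_ + _).
rewrite summxE; apply: eq_bigr => k' _.
rewrite summxE.
transitivity (\sum_(l < 2) \int[leb2 R]_y (cross_sign k k' * (\1_(io_domain R) y *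
  (gfilter (omega l) (cross_index k k').1 (cross_index k k').2 (grid_pt R i j - y) *
   pwconst (component k' O) y)))).
  apply: eq_bigr => l _; rewrite mxE dconv_average//; last exact: bounded_measurable_gfilter.
  rewrite Rintegral_indic -RintegralZl//.
  apply: integrable_domain; apply: bounded_measurableM; last exact: bounded_measurable_pwconst.
  by apply: bounded_measurable_reflect; exact: bounded_measurable_gfilter.
rewrite -Rintegral_sumR; last first.
  move=> l; apply: integrableZR.
  apply: integrable_domain; apply: bounded_measurableM; last exact: bounded_measurable_pwconst.
  by apply: bounded_measurable_reflect; exact: bounded_measurable_gfilter.
rewrite (Rintegral_indic (leb2 R) (io_domain R)); apply: eq_Rintegral => y _.
rewrite /cross_kernel mulr_suml mulr_sumr; apply: eq_bigr => l _; ring.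
Qed.

End convolutions.

(** * The error estimate *)

Section error.
Context {R : realType}.
Variables (omega : 'I_2 -> R) (alpha : R) (n : nat) (g2a : R * R -> R).
Hypothesis homega : 0 < omega 0 < omega 1.
Hypothesis halpha : 0 < alpha.
Hypothesis n0 : (0 < n)%N.
Hypothesis hg2 : is_g2a alpha omega g2a.
Variable O : 'M[R]_(n + n, n).

Lemma half_open_domain_le y : \1_(half_open_domain : set (R * R)) y <= \1_(io_domain R) y :> R.
Proof.
rewrite !indic_setX ler_pM//.
all: rewrite !indicE !mem_setE !in_itv/= ler_nat.
  by case: (-1 <= y.1) => //=; case: ltP => // /ltW ->.
by case: (-1 <= y.2) => //=; case: ltP => // /ltW ->.
Qed.

(** The closed and the half-open square have the same area, but c controls f only on the latter. The
    majorant below equals c there and a global bound M on the remaining edges, and its integral is 4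
    c. *)
Lemma Rintegral_domain_le (f : R * R -> R) (c : R) : bounded_measurable f ->
  (forall y, half_open_domain y -> `|f y| <= c) ->
  `|\int[leb2 R]_(y in io_domain R) f y| <= 4 * c.
Proof.
move=> bf fc; rewrite Rintegral_indic; have i := integrable_domain bf.
apply: (le_trans (le_normr_Rintegral measurableT i)).
have [mf [M HM]] := bf.
have i1 : (leb2 R).-integrable setT (EFin \o \1_(io_domain R)) by exact: integrable_indic_box.
have i2 : (leb2 R).-integrable setT (EFin \o \1_(half_open_domain : set (R * R))).
  exact: integrable_indic_box.
have e1 := @integral_domain R.
have e2 : \int[leb2 R]_y \1_(half_open_domain : set (R * R)) y = 4 :> R.
  rewrite Rintegral_indic_box; [ring|lra|lra].
have -> : 4 * c = \int[leb2 R]_y (M * \1_(io_domain R) y + (c - M) * \1_(half_open_domain : set (R * R)) y).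
  rewrite RintegralD//; [|exact: integrableZR..].
  rewrite !RintegralZl// e1 e2; ring.
apply: le_Rintegral => //.
- exact: integrable_norm.
- by apply: integrableDR; exact: integrableZR.
move=> y _; have := half_open_domain_le y.
rewrite normrM !indicE.
have [yh|yh] := pselect (half_open_domain y).
  rewrite (mem_set yh); case: (_ \in _); rewrite /= ?normr1 ?normr0; have := fc y yh; lra.
rewrite (memNset yh); case: (_ \in _); rewrite /= ?normr1 ?normr0; have := HM y; lra.
Qed.

Lemma pwconstD (a : R) (A B : 'M[R]_n) y : pwconst (a *: A + B) y = a * pwconst A y + pwconst B y.
Proof.
rewrite /pwconst mulr_sumr -big_split /=; apply: eq_bigr => i _.
rewrite mulr_sumr -big_split /=; apply: eq_bigr => j _.
by rewrite !mxE; ring.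
Qed.

Lemma cell_dist1 (i j : 'I_n) y : cell R i j y -> dist1 y (grid_pt R i j) <= 2 / n%:R.
Proof.
rewrite /cell /dist1; set x := grid_pt R i j; case; rewrite /= !in_itv/= => /andP[a b] /andP[c d].
have -> : 2 / n%:R = n%:R^-1 + n%:R^-1 :> R by ring.
by apply: lerD; rewrite ler_norml; apply/andP; split; lra.
Qed.

Lemma mxconv_g2 (f : R * R -> 'cV[R]_2) (x : R * R) k :
  bounded_measurable (fun y : R * R => g2a (x - y) * f y k 0) ->
  mxconv ((g2 alpha g2a)%:M) f x k 0 = alpha ^- 2 * f x k 0 -
    \int[leb2 R]_(y in io_domain R) (g2a (x - y) * f y k 0).
Proof.
move=> b; rewrite mxE (bigD1 k)//= big1 ?addr0 => [|k' k'k].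
  rewrite /Defs.conv mxE eqxx mulr1n /= subr0; congr (_ + _).
  rewrite 2!(Rintegral_indic (leb2 R) (io_domain R)).
  rewrite -[RHS]mulN1r -RintegralZl//; last exact: integrable_domain.
  apply: eq_Rintegral => y _; rewrite /= (_ : (0 - g2a) (x - y) = - g2a (x - y)); last exact: sub0r.
  ring.
rewrite /Defs.conv mxE eq_sym (negbTE k'k) mulr0n /= mul0r add0r.
rewrite (Rintegral_indic (leb2 R) (io_domain R)) (_ : \int[_]_y _ = \int[leb2 R]_y (0 * \1_(io_domain R) y)).
  by rewrite RintegralZl ?mul0r//; exact: integrable_indic_box.
by apply: eq_Rintegral => y _; rewrite !mul0r mulr0.
Qed.

Lemma Psi2_component k (i j : 'I_n) : component k (Psi2 alpha omega g2a O) i j =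
  mxconv ((g2 alpha g2a)%:M) (mxconv (g1 alpha omega) (pwconst2 O)) (grid_pt R i j) k 0.
Proof.
by have [->|->] := ord2P k; rewrite /component /= ?col_mxKu ?col_mxKd mxE.
Qed.

Lemma componentB k (A B : 'M[R]_(n + n, n)) : component k (A - B) = component k A - component k B.
Proof. by rewrite /component; case: ifP => _; rewrite linearB. Qed.

Let bg2a : bounded_measurable g2a.
Proof. by have [cg bg _] := hg2; split=> //; exact: continuous_measurable_plane. Qed.

Let S := smooth_part omega O.

Let psi1E k : component k (psi1 alpha (filter_average omega n) O) =
  alpha *: component k O + \matrix_(i, j) S k (grid_pt R i j).
Proof.
apply/matrixP => i j; rewrite (psi1_exact _ homega n0) (mxconv_g1 _ _ _) !mxE.
by rewrite pwconst_grid_pt.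
Qed.

(** As [psi1] is exact at the grid points, the terms with alpha^-2 cancel, and so do the
    contributions of alpha O inside the second convolution. What is left is g_{2,alpha} integrated
    against the smooth part minus its piecewise constant interpolation. The bound is the area 4,
    times the supremum of g_{2,alpha}, times the Lipschitz constant, times the largest l^1 distance
    2 / n from a point of a cell to its centre. *)
Lemma component_error k (i j : 'I_n) :
  `|component k (Psi2 alpha omega g2a O -
     psi2 alpha (average_kernel n g2a) (psi1 alpha (filter_average omega n) O)) i j| <=
  4 * (alpha ^- 2 * (4 * omega 1) ^+ 2 / (2 * pi) ^+ 2 *
       (16 * filter_mass omega * omega 1 * `|O| * (2 / n%:R))).
Proof.
set x := grid_pt R i j.
have bS := bounded_measurable_smooth_part homega n0 O k.
have bp A := bounded_measurable_pwconst n0 (A : 'M[R]_n).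
have bx := bounded_measurable_reflect x bg2a.
pose A := \matrix_(i, j) S k (grid_pt R i j) : 'M[R]_n.
pose F y := alpha * pwconst (component k O) y + S k y.
have FE y : mxconv (g1 alpha omega) (pwconst2 O) y k 0 = F y by rewrite mxconv_g1.
have bF : bounded_measurable F.
  apply: bounded_measurableD => //; apply: bounded_measurableM => //; exact: bounded_measurable_cst.
have b1 : bounded_measurable (fun y : R * R => g2a (x - y) * F y) by exact: bounded_measurableM.
have b2 : bounded_measurable (fun y : R * R => g2a (x - y) * pwconst (alpha *: component k O + A) y).
  exact: bounded_measurableM.
have -> : component k (Psi2 alpha omega g2a O -
     psi2 alpha (average_kernel n g2a) (psi1 alpha (filter_average omega n) O)) i j =
   - \int[leb2 R]_(y in io_domain R) (g2a (x - y) * (S k y - pwconst A y)).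
  rewrite componentB psi2_component psi1E -/A.
  have -> (B C D : 'M[R]_n) (a : R) : (B - (a *: C - D)) i j = B i j - a * C i j + D i j.
    by rewrite !mxE; ring.
  rewrite Psi2_component -/x mxconv_g2; last first.
    by rewrite (_ : (fun y => _) = (fun y => g2a (x - y) * F y))//; apply/funext => y; rewrite FE.
  rewrite (dconv_average n0)// -/x.
  have -> : (alpha *: component k O + A) i j = F x by rewrite !mxE /F pwconst_grid_pt.
  rewrite FE 3!(Rintegral_indic (leb2 R) (io_domain R)).
  under eq_Rintegral do rewrite FE.
  rewrite (_ : forall a b c : R, a - b - a + c = - (b - c)); last by move=> *; ring.
  rewrite -(RintegralB measurableT (integrable_domain b1) (integrable_domain b2)); congr (- _).
  by apply: eq_Rintegral => y _; rewrite pwconstD /F; ring.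
rewrite normrN; apply: Rintegral_domain_le.
  apply: bounded_measurableM => //.
  under eq_fun do rewrite -mulN1r.
  apply: bounded_measurableD => //; apply: bounded_measurableM => //; exact: bounded_measurable_cst.
move=> y hy; rewrite normrM ler_pM//; first exact: (g2a_bound homega halpha hg2).
have h a b : cell R a b y -> `|S k y - A a b| <= 16 * filter_mass omega * omega 1 * `|O| * (2 / n%:R).
  move=> yab; rewrite mxE; apply: (le_trans (smooth_part_lipschitz homega n0 _ _ _ _)).
  apply: ler_wpM2l; last exact: cell_dist1.
  case/andP: homega => o0 o1.
  rewrite mulr_ge0// mulr_ge0//; last exact: ltW (lt_trans o0 o1).
  by rewrite mulr_ge0//; exact: filter_mass_ge0.
by have := pwconst_dist n0 h; rewrite indicE mem_set// mul1r mulr1.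
Qed.

End error.

(** The (2 pi)^2 of the torus cancels that of Fourier inversion, which leaves the constant 2^11
    omega_2^3; it is absorbed by [c_cnn] through sqrt 2 >= 1 and pi >= 2. *)
Lemma error_constant_le (R : realType) (omega : 'I_2 -> R) (a b m : R) :
  0 < omega 0 < omega 1 -> 0 <= a -> 0 <= b -> 0 <= m ->
  4 * (a * (4 * omega 1) ^+ 2 / (2 * pi) ^+ 2 *
       (16 * filter_mass omega * omega 1 * b * (2 * m))) <= c_cnn omega * b * a * m.
Proof.
case/andP=> o0 o1 a0 b0 m0; rewrite /filter_mass /c_cnn.
have w0 : 0 < omega 1 by rewrite (lt_trans o0).
set C := _ + norm_c _ ^+ 2; have C0 : 0 <= C by rewrite addr_ge0 ?sqr_ge0.
have p2 := @pi_ge2 R; have s1 : 1 <= Num.sqrt 2 :> R by rewrite -{1}sqrtr1 ler_sqrt// ler1n.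
have -> : 4 * (a * (4 * omega 1) ^+ 2 / (2 * pi) ^+ 2 * (16 * (C * (2 * pi) ^+ 2) * omega 1 * b * (2 * m))) =
    2048 * (omega 1 * C * b * a * m) * omega 1 ^+ 2.
  by move: pi p2 => p p2; field; lra.
have -> : 2 ^+ 7 * Num.sqrt 2 * pi * omega 1 * C * (pi + 2 ^+ 3 * omega 1 ^+ 2) * b * a * m =
    (128 * (omega 1 * C * b * a * m)) * (Num.sqrt 2 * pi * (pi + 8 * omega 1 ^+ 2)) by ring.
set X := omega 1 * C * b * a * m; have X0 : 0 <= X by rewrite !mulr_ge0// ltW.
have w2 : 0 <= omega 1 ^+ 2 by exact: sqr_ge0.
rewrite (_ : 2048 * X * omega 1 ^+ 2 = 128 * X * (1 * 2 * (8 * omega 1 ^+ 2))); last by ring.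
apply: ler_wpM2l; first by rewrite mulr_ge0.
by apply: ler_pM => //; [rewrite mulr_ge0|apply: ler_pM|rewrite lerDr (le_trans _ p2)].
Qed.

Unset Implicit Arguments.
Set Strict Implicit.

Theorem theorem3p3 (R : realType) (omega : 'I_2 -> R) (alpha : R) (n_c : nat)
    (g2a : R * R -> R)
    (homega : 0 < omega 0 < omega 1) (halpha : 0 < alpha) (hn : (0 < n_c)%N)
    (hg2 : is_g2a alpha omega g2a) :
  exists (G : 'I_2 -> 'I_2 -> 'I_2 -> 'M[R]_(n_c + n_c))
         (G2a : 'M[R]_(n_c + n_c)),
    forall O : 'M[R]_(n_c + n_c, n_c),
      `|Psi2 alpha omega g2a O - psi2 alpha G2a (psi1 alpha G O)|
        <= c_cnn omega * `|O| * alpha ^- 2 * n_c%:R^-1.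
Proof.
exists (filter_average omega n_c), (average_kernel n_c g2a) => O.
have a0 : 0 <= alpha ^- 2 by rewrite invr_ge0 sqr_ge0.
have m0 : 0 <= n_c%:R^-1 :> R by rewrite invr_ge0.
have b := error_constant_le homega a0 (normr_ge0 O) m0.
have c k i j := le_trans (component_error homega halpha hn hg2 O k i j) b.
(* The bound must also be shown nonnegative; it dominates the modulus of some entry, and one exists
   because n_c is positive. *)
by apply: component_le => //; exact: le_trans (c 0 (Ordinal hn) (Ordinal hn)).
Qed.
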